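(* Let $(I_j : j\ge 0)$ be independent $\{0,1\}$-valued random variables with $p_j=\mathbb{P}(I_j=1)=1-\mathbb{P}(I_j=0)$. (i) Suppose that there exist $c>0$ and $\alpha>1$ such that $p_n=c\,n^{-\alpha}(1+O(1/n))$ as $n\to\infty$. Then $$\mathbb{P}\Big(\sum_{j\ge 0} I_j\ge n\Big)\sim \frac{1}{\sqrt{2\pi\eta_*}}\; r_*^{-n}\, n^{-\alpha n-1/2}\,\exp\big(\Psi(r_* n^\alpha)\big)$$ as $n\to\infty$, where $r_*>0$ satisfies $$\int_0^\infty \frac{c\,r_*}{c\,r_*+x^\alpha}\,dx=1,$$ $$\eta_*=\int_0^\infty\frac{c\,r_*\,x^\alpha}{(c\,r_*+x^\alpha)^2}\,dx,$$ and $\Psi(y)=\sum_{j\ge 0}\log\big(1+p_j(y-1)\big)$. (ii) Suppose that $p_n=c\,(w+n)^{-\alpha}$ for all $n\ge 0$, where $c,w>0$ and $\alpha>1$. Then, with $r_*$ and $\eta_*$ defined from $c$ and $\alpha$ by the same formulas as in (i), $$\mathbb{P}\Big(\sum_{j\ge 0} I_j\ge n\Big)\sim \Big(\frac{1}{\sqrt{2\pi}}\Big)^{\alpha+1}\,\frac{\Gamma(w)^\alpha}{\sqrt{\eta_*}}\,(c\,r_* )^{\frac12-w}\; n^{-\alpha n+\frac12(\alpha-1)-w\alpha}\; e^{\gamma n}$$ as $n\to\infty$, where $$\gamma=\int_0^1\log\Big(1+\frac{1}{c\,r_*}x^\alpha\Big)dx+\int_1^\infty\log\big(1+c\,r_*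\,x^{-\alpha}\big)dx+\alpha+\log(c).$$
   Context: $a_n\sim b_n$ means $a_n/b_n\to1$ as $n\to\infty$ ($n$ integer). $\Gamma$ is the Gamma function. The quantity $\Psi(y)$ is the cumulant generating function $\log\mathbb{E}\exp(\theta Z)$ of $Z=\sum_{j\ge0}I_j$ evaluated at $\theta=\log y$, i.e. $\Psi(y)=\log\mathbb{E}[y^Z]$. *)

(* Defs.v *)
From HB Require Import structures.
From mathcomp Require Import all_boot all_order all_algebra finmap.
From mathcomp Require Import all_classical all_reals all_analysis.

Set Implicit Arguments.
Unset Strict Implicit.
Unset Printing Implicit Defensive.

Import Order.TTheory GRing.Theory Num.Theory.
Import numFieldNormedType.Exports.

Local Open Scope classical_set_scope.
Local Open Scope ring_scope.

Definition mutually_independent (K : choiceType) (d d' : measure_display)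
    (T : measurableType d) (T' : measurableType d') (R : realType)
    (P : probability T R) (X : K -> {RV P >-> T'}) : Prop :=
  forall (J : {fset K}) (A : K -> set T'),
    (forall j, measurable (A j)) ->
    P (\bigcap_(j in [set` J]) (X j @^-1` A j)) =
    (\prod_(j <- J) P (X j @^-1` A j))%E.

(* The sum is extended-real valued, so no convergence assumption is needed. *)
Definition indicator_sum (d : measure_display) (T : measurableType d)
    (R : realType) (P : probability T R) (I : nat -> {RV P >-> bool})
    (t : T) : \bar R :=
  (\sum_(0 <= j <oo) ((I j t)%:R : R)%:E)%E.

(* log E[exp (theta * Z)] for an extended-real valued Z *)
Definition cumulant_gen_fun (d : measure_display) (T : measurableType d)
    (R : realType) (P : probability T R) (Z : T -> \bar R) (theta : R)
    : \bar R :=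
  lne (\int[P]_t expeR (theta%:E * Z t))%E.

Definition Psi (R : realType) (p : nat -> R) (y : R) : R :=
  limn (series (fun j => ln (1 + p j * (y - 1)))).

Definition asymp_equiv (R : realType) (a b : nat -> R) : Prop :=
  a n / b n @[n --> \oo] --> (1 : R).

Definition is_rstar (R : realType) (c alpha r : R) : Prop :=
  0 < r /\
  \int[lebesgue_measure]_(x in `[0, +oo[) (c * r / (c * r + x `^ alpha)) = 1.

Definition eta_star (R : realType) (c alpha r : R) : R :=
  \int[lebesgue_measure]_(x in `[0, +oo[)
    (c * r * x `^ alpha / (c * r + x `^ alpha) ^+ 2).

Definition gamma_rate (R : realType) (c alpha r : R) : R :=
  \int[lebesgue_measure]_(x in `[0, 1]) ln (1 + (c * r)^-1 * x `^ alpha) +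
  \int[lebesgue_measure]_(x in `[1, +oo[) ln (1 + c * r * x `^ (- alpha)) +
  alpha + ln c.

(* Euler's integral; it is only used for w > 0, where it converges. *)
Definition Gamma (R : realType) (w : R) : R :=
  \int[lebesgue_measure]_(x in `]0, +oo[) (x `^ (w - 1) * expR (- x)).

Arguments mutually_independent {K d d' T T' R} P X.
Arguments indicator_sum {d T R} P I t.

(* Main.v *)
Require Import Defs.
From HB Require Import structures.
From mathcomp Require Import all_boot all_order all_algebra finmap.
From mathcomp Require Import all_classical all_reals all_analysis.
From mathcomp Require Import ring lra zify.
From mathcomp Require Import complex measurable_realfun.

Set Implicit Arguments.
Unset Strict Implicit.
Unset Printing Implicit Defensive.

Import Order.TTheory GRing.Theory Num.Theory.
Import numFieldNormedType.Exports.

Local Open Scope classical_set_scope.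
Local Open Scope ring_scope.

(** Truncate the sum at [N = N(n)] variables and tilt: with [y = r n^alpha] and
    [q_j = p_j y / (1 + p_j (y - 1))], the tail [P (Z_N >= n)] equals
    [y^-n E[y^Z_N]] times [P (Z~ = n) + O(1/y)], where [Z~] is a sum of
    independent Bernoulli variables of parameters [q_j]. Since [q_j] is close to
    [phi (j/n)], [phi x = cr / (cr + x^alpha)], Riemann sums show that [Z~] has
    mean [n + o(sqrt n)], by the equation defining [r], and variance
    [~ eta n]. A local limit theorem, proved by Fourier inversion, gives
    [P (Z~ = n) ~ (2 pi eta n)^(-1/2)], which is part (i).
    For part (ii), [Psi (r n^alpha)] is expanded up to [o(1)]: an Euler-Maclaurin
    estimate over the cells [[j/n, (j+1)/n]] handles the sums of
    [log (1 + x^alpha / cr)] and [log (1 + cr x^-alpha)] at [x = (w + j)/n], and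
    the remaining sum of [log ((w + j)/n)] is a ratio of Gamma values, estimated by
    Stirling's formula, whose constant comes from the local limit theorem for
    fair coins. *)

(** * Local limit theorem for Bernoulli sums *)

(** Two scales shape the proof. After tilting, only the term [k = n] of the tail matters: the terms
    [k > n] carry a factor [y^-1], of order [n^-alpha], which [alpha > 1] makes negligible against
    [n^(-1/2)]. The mean, however, must be known up to [o(sqrt n)]; the relative error [O(1/n)] of
    [p_n], once summed, contributes only [O(log n)]. Truncation turns the generating function into a
    polynomial whose coefficients are the probabilities; since [N(n)] is obtained from mere limits,
    without a rate, every estimate has to be uniform in [N]. In part (ii) the function
    [log (1 + cr x^-alpha)] is unbounded at [0]; on [[0, 1]] it is rewritten as [log (1 + x^alpha /
    cr) + log (cr) - alpha log x], which isolates the singularity in a sum that Gamma values compute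
    exactly. At the cut [x = 1] the boundary corrections of the two pieces combine into the power
    [(cr)^(1/2 - w)]. Of the [alpha + 1] factors [(2 pi)^(-1/2)], one comes from the local limit
    theorem and [alpha] from Stirling's formula. *)

Lemma ler_deriv (R : realType) (f g df dg : R -> R) (a b : R) :
  a <= b ->
  (forall x, x \in `]a, b[ -> is_derive x 1 f (df x)) ->
  (forall x, x \in `]a, b[ -> is_derive x 1 g (dg x)) ->
  {within `[a, b], continuous f} -> {within `[a, b], continuous g} ->
  (forall x, x \in `]a, b[ -> df x <= dg x) ->
  f b - f a <= g b - g a.
Proof.
move=> ab Df Dg cf cg dfg.
have Dh x : x \in `]a, b[ -> is_derive x 1 (g - f) (dg x - df x).
  by move=> xab; apply: is_deriveB; [exact: Dg|exact: Df].
have ch : {within `[a, b], continuous (g - f)}.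
  by move=> x; apply: cvgB; [exact: cg|exact: cf].
have := @ger0_derive1_le_cc R (g - f) a b _ _ ch.
have h1 x : x \in `]a, b[ -> derivable (g - f) x 1 by move=> /Dh[].
have h2 x : x \in `]a, b[ -> 0 <= (g - f)^`()%classic x.
  by move=> xab; rewrite derive1E; have [_ ->] := Dh _ xab; rewrite subr_ge0 dfg.
move=> /(_ h1 h2 a b); rewrite !in_itv/= !lexx ab => /(_ isT isT isT).
rewrite !fctE /=; lra.
Qed.

Lemma ler_deriv_continuous (R : realType) (f g df dg : R -> R) (a b : R) :
  a <= b ->
  (forall x, a <= x <= b -> is_derive x 1 f (df x)) ->
  (forall x, a <= x <= b -> is_derive x 1 g (dg x)) ->
  (forall x, a < x < b -> df x <= dg x) ->
  f b - f a <= g b - g a.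
Proof.
move=> ab Df Dg dfg; apply: (@ler_deriv R f g df dg) => //.
- by move=> x /[!in_itv]/= /andP[ax xb]; apply: Df; rewrite !ltW.
- by move=> x /[!in_itv]/= /andP[ax xb]; apply: Dg; rewrite !ltW.
- apply: derivable_within_continuous => x /[!in_itv]/= xab.
  by have [] := Df _ xab.
- apply: derivable_within_continuous => x /[!in_itv]/= xab.
  by have [] := Dg _ xab.
Qed.

(** * Taylor bounds for sine, cosine and the exponential *)

Section trigonometric_bounds.
Variable R : realType.
Implicit Types x : R.

(** This bound and the next three form a ladder: each compares derivatives, and the inequality
    between the derivatives is the previous bound, starting from [cos <= 1]. *)
Lemma sin_le x : 0 <= x -> sin x <= x.
Proof.
move=> x0.
have := @ler_deriv_continuous R sin id cos (cst 1) 0 x x0.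
rewrite sin0 !subr0; apply => // y _; first [exact: is_derive_id|exact: cos_le1].
Qed.

Lemma cos_ge x : 0 <= x -> 1 - x ^+ 2 / 2 <= cos x.
Proof.
move=> x0.
have := @ler_deriv_continuous R (fun x => - x ^+ 2 / 2) cos -%R (- sin) 0 x x0.
rewrite cos0 expr0n/= oppr0 mul0r => h; suff : - x ^+ 2 / 2 - 0 <= cos x - 1 by lra.
apply: h => y /andP[y0 _]; last by rewrite fctE lerN2 sin_le// ltW.
apply: is_derive_eq; rewrite /GRing.scale/=; lra.
Qed.

Lemma sin_ge x : 0 <= x -> x - x ^+ 3 / 6 <= sin x.
Proof.
move=> x0.
have := @ler_deriv_continuous R (fun x => x - x ^+ 3 / 6) sin
  (fun x => 1 - x ^+ 2 / 2) cos 0 x x0.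
rewrite sin0 expr0n/= mul0r !subr0; apply => y /andP[y0 _].
- by apply: is_derive_eq; rewrite /GRing.scale/=; field.
- by rewrite cos_ge// ltW.
Qed.

Lemma cos_le x : 0 <= x -> cos x <= 1 - x ^+ 2 / 2 + x ^+ 4 / 24.
Proof.
move=> x0.
have := @ler_deriv_continuous R cos (fun x => - x ^+ 2 / 2 + x ^+ 4 / 24)
  (- sin) (fun x => - x + x ^+ 3 / 6) 0 x x0.
rewrite cos0 !expr0n/= oppr0 !mul0r => h.
suff : cos x - 1 <= - x ^+ 2 / 2 + x ^+ 4 / 24 - (0 + 0) by lra.
apply: h => y /andP[y0 _].
- by apply: is_derive_eq; rewrite /GRing.scale/=; field.
- by have := sin_ge (ltW y0); rewrite fctE; lra.
Qed.

Lemma cos_taylor x : `|cos x - (1 - x ^+ 2 / 2)| <= x ^+ 4.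
Proof.
wlog x0 : x / 0 <= x => [hw|].
  have [|/ltW] := lerP 0 x; first exact: hw.
  by rewrite -oppr_ge0 => /hw; rewrite cosN sqrrN (exprNn _ 4) -signr_odd/= mul1r.
have := cos_ge x0; have := cos_le x0; have : 0 <= x ^+ 4 by rewrite exprn_ge0.
by move=> h1 h2 h3; rewrite ler_norml; apply/andP; split; lra.
Qed.

Lemma sin_taylor x : `|sin x - x| <= `|x| ^+ 3.
Proof.
wlog x0 : x / 0 <= x => [hw|].
  have [|/ltW] := lerP 0 x; first exact: hw.
  by rewrite -oppr_ge0 => /hw; rewrite sinN -opprD normrN normrN.
have := sin_ge x0; have := sin_le x0; have : 0 <= x ^+ 3 by rewrite exprn_ge0.
by move=> h1 h2 h3; rewrite ler_norml (ger0_norm x0); apply/andP; split; lra.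
Qed.

(** Write [1 - cos y = 2 sin^2 (y/2)] with [y = |x|]. The cubic lower bound of the sine gives
    [sin (y/2) >= y/6] as long as [y <= 4], and [pi < 4]; squaring and doubling gives the constant
    [18]. *)
Lemma cos_le_pi x : `|x| <= pi -> x ^+ 2 / 18 <= 1 - cos x.
Proof.
move=> xpi.
have -> : cos x = cos `|x| by rewrite cos_norm.
rewrite -real_normK ?num_real//; move: (normr_ge0 x) xpi.
move: `|x| => y y0 ypi.
have -> : cos y = 1 - 2 * sin (y / 2) ^+ 2.
  rewrite {1}(_ : y = (y / 2) *+ 2) ?cos_mulr2n ?cos2sin2; last by rewrite mulr2n; lra.
  by rewrite mulr2n; lra.
have h : y / 2 - (y / 2) ^+ 3 / 6 <= sin (y / 2) by apply: sin_ge; lra.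
have p2 := @pihalf_lt2 R.
have y3 : y / 6 <= y / 2 - (y / 2) ^+ 3 / 6 by nra.
have : y / 6 <= sin (y / 2) by lra.
have : 0 <= y / 6 by lra.
nra.
Qed.

Lemma expRN_taylor x : 0 <= x -> `|expR (- x) - (1 - x)| <= x ^+ 2.
Proof.
move=> x0.
have h1 := @expR_ge1Dx R (- x); have h2 := @expR_ge1Dx R x.
have h3 : expR (- x) * expR x = 1 by rewrite mulrC expRxMexpNx_1.
have h4 := @expR_gt0 R (-x).
have h5 : expR (- x) * (1 + x) <= 1 by rewrite -[leRHS]h3 ler_wpM2l// ltW.
have : expR (- x) * (1 + x) <= (1 - x + x ^+ 2) * (1 + x) by nra.
rewrite ler_pM2r; last lra.
by move=> h6; rewrite ler_norml; apply/andP; split; nra.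
Qed.

End trigonometric_bounds.

Section unit_complex.
Variable R : realType.
Local Open Scope complex_scope.
Import Normc.

Definition cis (x : R) : R[i] := cos x +i* sin x.

Lemma cisD x y : cis (x + y) = cis x * cis y.
Proof. by rewrite /cis cosD sinD; congr (_ +i* _); rewrite addrC [cos x * _]mulrC. Qed.

Lemma cis0 : cis 0 = 1.
Proof. by rewrite /cis cos0 sin0. Qed.

Lemma cisMn x n : cis (x *+ n) = cis x ^+ n.
Proof. by elim: n => [|n ih]; rewrite ?cis0// mulrS cisD ih exprS. Qed.

Lemma cis_sum (I : Type) (r : seq I) (F : I -> R) :
  cis (\sum_(i <- r) F i) = \prod_(i <- r) cis (F i).
Proof. by apply: (big_morph _ cisD cis0). Qed.

Lemma normc_cis x : normc (cis x) = 1.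
Proof. by rewrite /= cos2Dsin2 sqrtr1. Qed.

Lemma normc_prod (I : Type) (r : seq I) (F : I -> R[i]) :
  normc (\prod_(i <- r) F i) = \prod_(i <- r) normc (F i).
Proof. exact: (big_morph _ (@normcM R) (@normc1 R)). Qed.

Lemma normc_ge0 (z : R[i]) : 0 <= normc z.
Proof. by case: z => a b; exact: sqrtr_ge0. Qed.

Lemma normr_Re_le (z : R[i]) : `|complex.Re z| <= normc z.
Proof.
case: z => a b /=; rewrite -sqrtr_sqr ler_sqrt ?addr_ge0 ?sqr_ge0//.
by rewrite lerDl sqr_ge0.
Qed.

Lemma normc_le_ReIm (z : R[i]) : normc z <= `|complex.Re z| + `|complex.Im z|.
Proof.
case: z => a b /=; rewrite -[leRHS]ger0_norm ?addr_ge0// -sqrtr_sqr.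
rewrite ler_sqrt ?sqr_ge0// sqrrD !real_normK ?num_real//.
by rewrite -addrAC lerDl mulrn_wge0// mulr_ge0.
Qed.

(** The factors are exchanged one at a time; all the others have modulus at most [1], so each
    exchange costs at most its own difference. *)
Lemma normc_prodB_le (I : Type) (r : seq I) (z w : I -> R[i]) :
  (forall i, normc (z i) <= 1) -> (forall i, normc (w i) <= 1) ->
  normc (\prod_(i <- r) z i - \prod_(i <- r) w i) <=
  \sum_(i <- r) normc (z i - w i).
Proof.
move=> z1 w1; elim: r => [|i r ih]; first by rewrite !big_nil subrr normc0.
rewrite !big_cons; set A := \prod_(j <- r) z j; set B := \prod_(j <- r) w j.
have -> : z i * A - w i * B = (z i - w i) * A + w i * (A - B) by ring.
apply: (le_trans (@le_normcD R _ _)); rewrite !normcM; apply: lerD.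
  rewrite ler_piMr ?normc_ge0// /A normc_prod.
  by apply: prodr_ile1 => j _; rewrite normc_ge0 z1.
by rewrite (le_trans _ ih)// ler_piMl ?normc_ge0// w1.
Qed.

End unit_complex.

(** * Characteristic functions of Bernoulli sums *)

Section bernoulli_factor.
Variable R : realType.
Local Open Scope complex_scope.
Import Normc.

(** The characteristic function at [x] of a Bernoulli variable of parameter [q]; the next definition
    is that of the same variable minus its mean. *)
Definition bern_factor (q x : R) : R[i] := (1 - q)%:C + q%:C * cis x.

Definition centered_bern_factor (q x : R) : R[i] :=
  cis (- (q * x)) * bern_factor q x.

(** The squared modulus is exactly [1 - 2 q (1 - q) (1 - cos x)], and [1 - t <= exp (-t)]. *)
Lemma normc_bern_factor_le (q x : R) : 0 <= q <= 1 ->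
  normc (bern_factor q x) <= expR (- (q * (1 - q) * (1 - cos x))).
Proof.
move=> /andP[q0 q1].
have e0 := @expR_gt0 R (- (q * (1 - q) * (1 - cos x))).
rewrite -(ger0_norm (ltW e0)) -sqrtr_sqr /bern_factor /cis; simpc => /=.
rewrite ler_sqrt ?sqr_ge0//.
have -> : expR (- (q * (1 - q) * (1 - cos x))) ^+ 2 =
  expR (- (2 * (q * (1 - q) * (1 - cos x)))).
  by rewrite -expRM_natl mulrN.
apply: (le_trans _ (expR_ge1Dx _)).
have := cos2Dsin2 x; nra.
Qed.

Lemma normc_centered_bern_factor (q x : R) :
  normc (centered_bern_factor q x) = normc (bern_factor q x).
Proof. by rewrite normcM normc_cis mul1r. Qed.

Lemma normc_bern_factor_le1 (q x : R) : 0 <= q <= 1 ->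
  normc (bern_factor q x) <= 1.
Proof.
move=> q01; apply: (le_trans (normc_bern_factor_le x q01)).
case/andP: q01 => q0 q1.
rewrite -[leRHS]expR0 ler_expR oppr_le0 !mulr_ge0// subr_ge0//; exact: cos_le1.
Qed.

Lemma centered_bern_factorE (q x : R) : centered_bern_factor q x =
  ((1 - q) * cos (q * x) + q * cos ((1 - q) * x)) +i*
  (q * sin ((1 - q) * x) - (1 - q) * sin (q * x)).
Proof.
rewrite /centered_bern_factor /bern_factor /cis cosN sinN; simpc.
have -> : (1 - q) * x = x - q * x by ring.
rewrite cosB sinB; congr (_ +i* _); ring.
Qed.

(** Centering cancels the first-order terms, in the real and in the imaginary part. What matters is
    that every remainder keeps the factor [q (1 - q)]: summed over the variables, the error is then
    proportional to the variance, however many variables there are. *)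
Lemma centered_bern_factor_taylor (q x : R) : 0 <= q <= 1 ->
  normc (centered_bern_factor q x - (expR (- (q * (1 - q) * x ^+ 2 / 2)))%:C)
  <= q * (1 - q) * (`|x| ^+ 3 + 2 * x ^+ 4).
Proof.
move=> /andP[q0 q1]; set v := q * (1 - q).
have v0 : 0 <= v by rewrite mulr_ge0// subr_ge0.
have v1 : v <= 1 by rewrite /v; nra.
apply: (le_trans (normc_le_ReIm _)); rewrite centered_bern_factorE; simpc => /=.
have x40 : 0 <= x ^+ 4 by rewrite (exprM x 2 2) sqr_ge0.
have x30 : 0 <= `|x| ^+ 3 by rewrite exprn_ge0.
have x20 : 0 <= x ^+ 2 by rewrite sqr_ge0.
have hre : `|(1 - q) * cos (q * x) + q * cos ((1 - q) * x) -
             expR (- (v * x ^+ 2 / 2))| <= v * (2 * x ^+ 4).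
  have h1 := cos_taylor (q * x); have h2 := cos_taylor ((1 - q) * x).
  have h3 := @expRN_taylor R (v * x ^+ 2 / 2) _.
  have {}h3 := h3 ltac:(nra).
  rewrite (_ : _ - _ = (1 - q) * (cos (q * x) - (1 - (q * x) ^+ 2 / 2)) +
    q * (cos ((1 - q) * x) - (1 - ((1 - q) * x) ^+ 2 / 2)) -
    (expR (- (v * x ^+ 2 / 2)) - (1 - v * x ^+ 2 / 2))); last by rewrite /v; field.
  apply: (le_trans (ler_normB _ _)).
  have : `|(1 - q) * (cos (q * x) - (1 - (q * x) ^+ 2 / 2)) +
    q * (cos ((1 - q) * x) - (1 - ((1 - q) * x) ^+ 2 / 2))| <= v * x ^+ 4.
    apply: (le_trans (ler_normD _ _)); rewrite !normrM (ger0_norm q0).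
    rewrite (@ger0_norm _ (1 - q)) ?subr_ge0//.
    apply: (@le_trans _ _ ((1 - q) * (q * x) ^+ 4 + q * ((1 - q) * x) ^+ 4)).
      by apply: lerD; apply: ler_wpM2l => //; rewrite subr_ge0.
    rewrite !exprMn (_ : _ + _ = v * (q ^+ 3 + (1 - q) ^+ 3) * x ^+ 4); last first.
      by rewrite /v; ring.
    rewrite ler_wpM2r// ler_piMr//.
    rewrite (_ : q ^+ 3 + _ = 1 - 3 * v); last by rewrite /v; ring.
    lra.
  have : (v * x ^+ 2 / 2) ^+ 2 <= v * x ^+ 4.
    rewrite (_ : _ ^+ 2 = v * (v * x ^+ 4) / 4); last by field.
    have : v * (v * x ^+ 4) <= v * x ^+ 4 by rewrite ler_piMl// mulr_ge0.
    have : 0 <= v * x ^+ 4 by rewrite mulr_ge0.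
    lra.
  lra.
have him : `|q * sin ((1 - q) * x) - (1 - q) * sin (q * x)| <= v * `|x| ^+ 3.
  rewrite (_ : _ - _ = q * (sin ((1 - q) * x) - (1 - q) * x) -
     (1 - q) * (sin (q * x) - q * x)); last by ring.
  apply: (le_trans (ler_normB _ _)); rewrite !normrM (ger0_norm q0).
  rewrite (@ger0_norm _ (1 - q)) ?subr_ge0//.
  have h1 := sin_taylor (q * x); have h2 := sin_taylor ((1 - q) * x).
  apply: (@le_trans _ _ (q * `|(1 - q) * x| ^+ 3 + (1 - q) * `|q * x| ^+ 3)).
    by apply: lerD; apply: ler_wpM2l => //; rewrite subr_ge0.
  rewrite !normrM (ger0_norm q0) (@ger0_norm _ (1 - q)) ?subr_ge0// !exprMn.
  rewrite (_ : _ + _ = v * (q ^+ 2 + (1 - q) ^+ 2) * `|x| ^+ 3); last first.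
    by rewrite /v; ring.
  rewrite ler_wpM2r// ler_piMr//.
  rewrite (_ : q ^+ 2 + _ = 1 - 2 * v); last by rewrite /v; ring.
  lra.
by rewrite mulrDr addrC lerD// ?oppr0 ?addr0.
Qed.

Variables (N : nat) (q : nat -> R).
Hypothesis q01 : forall j, 0 <= q j <= 1.

(** The probability generating function of a sum of [N] independent Bernoulli variables: its
    coefficient of degree [k] is the probability that the sum equals [k]. *)
Definition bern_poly : {poly R} := \prod_(j < N) ((1 - q j)%:P + q j *: 'X).
Definition bern_mean : R := \sum_(j < N) q j.
Definition bern_var : R := \sum_(j < N) q j * (1 - q j).

Lemma bern_var_ge0 : 0 <= bern_var.
Proof.
apply: sumr_ge0 => j _; have /andP[? ?] := q01 j.
by rewrite mulr_ge0// subr_ge0.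
Qed.

(** The characteristic function of the sum minus [k]. Splitting off the phase [(bern_mean - k) x]
    leaves factors that are centered at their own means. *)
Definition centered_charfun (k : nat) (x : R) : R[i] :=
  cis ((bern_mean - k%:R) * x) * \prod_(j < N) centered_bern_factor (q j) x.

(** This Gaussian bound on a whole period becomes, after scaling by the standard deviation, the
    dominating function of the local limit theorem. *)
Lemma centered_charfun_le k x : `|x| <= pi ->
  normc (centered_charfun k x) <= expR (- (bern_var * x ^+ 2 / 18)).
Proof.
move=> xpi; rewrite normcM normc_cis mul1r normc_prod.
apply: (@le_trans _ _
  (\prod_(j < N) expR (- (q j * (1 - q j) * (x ^+ 2 / 18))))).
  apply: ler_prod => j _; apply/andP; split; first exact: normc_ge0.
  rewrite normc_centered_bern_factor.
  apply: (le_trans (normc_bern_factor_le x (q01 j))).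
  have /andP[? ?] := q01 j.
  by rewrite ler_expR lerN2 ler_wpM2l ?mulr_ge0 ?subr_ge0// cos_le_pi.
rewrite -expR_sum ler_expR sumrN lerN2.
by rewrite -big_distrl/= mulrA.
Qed.

Lemma centered_charfun_cvg k x :
  `|complex.Re (centered_charfun k x) - expR (- (bern_var * x ^+ 2 / 2))| <=
  bern_var * (`|x| ^+ 3 + 2 * x ^+ 4) + `|cos ((bern_mean - k%:R) * x) - 1|.
Proof.
set E := expR _; rewrite /centered_charfun.
set P := \prod_(j < N) _; set d := (bern_mean - k%:R) * x.
have -> : cis d * P = cis d * (P - E%:C) + cis d * E%:C by ring.
have -> : complex.Re (cis d * (P - E%:C) + cis d * E%:C) - E =
   complex.Re (cis d * (P - E%:C)) + (cos d - 1) * E.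
  by rewrite raddfD/= mulr0 subr0; ring.
apply: (le_trans (ler_normD _ _)); apply: lerD; last first.
  rewrite normrM ler_piMr// ger0_norm ?expR_ge0// -[leRHS]expR0 ler_expR oppr_le0.
  by rewrite divr_ge0// mulr_ge0 ?bern_var_ge0 ?sqr_ge0.
apply: (le_trans (normr_Re_le _)); rewrite normcM normc_cis mul1r.
have -> : E%:C = \prod_(j < N) (expR (- (q j * (1 - q j) * x ^+ 2 / 2)))%:C.
  rewrite -rmorph_prod -expR_sum; congr (expR _)%:C.
  by rewrite sumrN /bern_var !mulr_suml.
have E1 (j : 'I_N) : normc (expR (- (q j * (1 - q j) * x ^+ 2 / 2)))%:C <= 1.
  rewrite /= expr0n addr0 sqrtr_sqr ger0_norm ?expR_ge0// -[leRHS]expR0 ler_expR.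
  have /andP[? ?] := q01 j.
  by rewrite oppr_le0 divr_ge0// mulr_ge0 ?sqr_ge0// mulr_ge0// subr_ge0.
apply: (le_trans (normc_prodB_le _ _ E1)) => [j|].
  by rewrite normc_centered_bern_factor normc_bern_factor_le1.
rewrite /bern_var mulr_suml; apply: ler_sum => j _.
exact: centered_bern_factor_taylor.
Qed.

Lemma Re_centered_charfun k x : complex.Re (centered_charfun k x) =
  \sum_(l < size bern_poly) bern_poly`_l * cos ((l%:R - k%:R) * x).
Proof.
have -> : centered_charfun k x =
    cis (- (k%:R * x)) * (map_poly (real_complex R) bern_poly).[cis x].
  rewrite rmorph_prod horner_prod /centered_charfun big_split/= mulrA.
  rewrite -cis_sum -cisD.
  congr (cis _ * _); first by rewrite sumrN -mulr_suml -/bern_mean; ring.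
  apply: eq_bigr => j _.
  by rewrite rmorphD/= map_polyC map_polyZ/= map_polyX !hornerE.
rewrite horner_coef size_map_poly mulr_sumr raddf_sum/=; apply: eq_bigr => l _.
rewrite coef_map -cisMn mulrCA -cisD /cis; simpc => /=.
by congr (_ * cos _); rewrite -mulr_natl; ring.
Qed.

End bernoulli_factor.

(** * Recovering a coefficient by Fourier inversion *)

Section fourier.
Variable R : realType.
Local Notation mu := (@lebesgue_measure R).

Lemma sin_npi n : sin (pi *+ n) = 0 :> R.
Proof. by elim: n => [|n ih]; rewrite ?mulr0n ?sin0// mulrSr sinDpi ih oppr0. Qed.

Lemma sin_subnat_pi (l k : nat) : sin ((l%:R - k%:R) * pi) = 0 :> R.
Proof.
have [kl|/ltnW lk] := leqP k l.
  by rewrite -natrB// mulr_natl sin_npi.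
by rewrite -opprB mulNr sinN -natrB// mulr_natl sin_npi oppr0.
Qed.

Lemma is_derive_bigsum n (F dF : 'I_n -> R -> R) (x : R) :
  (forall i, is_derive x 1 (F i) (dF i x)) ->
  is_derive x 1 (fun t => \sum_(i < n) F i t) (\sum_(i < n) dF i x).
Proof.
move=> h; have := @is_derive_sum R R R n F x 1 (fun i => dF i x) h.
by rewrite (_ : \sum_(i < n) F i = fun t => \sum_(i < n) F i t)// fct_sumE.
Qed.

Lemma poly_cos_continuous (p : {poly R}) (k : nat) (s : R) :
  continuous (fun t : R => \sum_(l < size p) p`_l * cos ((l%:R - k%:R) * (t / s))).
Proof.
move=> x; apply/differentiable_continuous/derivable1_diffP.
have := @is_derive_bigsum (size p)
  (fun l t => p`_l * cos ((l%:R - k%:R) * (t / s)))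
  (fun l t => - (p`_l * ((l%:R - k%:R) / s) * sin ((l%:R - k%:R) * (t / s)))) x.
case=> // l; apply: is_derive_eq; rewrite /GRing.scale/=; ring.
Qed.

(** Orthogonality of the cosines, read off an explicit antiderivative: only [l = k] survives at the
    endpoints. The variable is already scaled by [s], to be taken as the standard deviation, so that
    the integrand has a pointwise limit. As the coefficients are real, cosines suffice. *)
Lemma poly_coef_fourier (p : {poly R}) (k : nat) (s : R) : 0 < s ->
  (\int[mu]_(t in `[(- (pi * s))%R, (pi * s)%R])
     (\sum_(l < size p) p`_l * cos ((l%:R - k%:R) * (t / s)))%R%:E =
  (2 * pi * s * p`_k)%R%:E)%E.
Proof.
move=> s0; have ps0 : 0 < pi * s by rewrite mulr_gt0// pi_gt0.
pose F l (t : R) := p`_l * (if l == k then t else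
  sin ((l%:R - k%:R) * (t / s)) * (s / (l%:R - k%:R))).
have DF (x : R) : is_derive x 1 (fun t : R => \sum_(l < size p) F l t)
    (\sum_(l < size p) p`_l * cos ((l%:R - k%:R) * (x / s))).
  apply: (@is_derive_bigsum _ (fun l t => F l t)
    (fun l t => p`_l * cos ((l%:R - k%:R) * (t / s)))) => l.
  rewrite /F; case: eqP => [->|/eqP lk].
    by apply: is_derive_eq; rewrite /GRing.scale/= subrr mul0r cos0; ring.
  have lk0 : (l%:R - k%:R : R) != 0 by rewrite subr_eq0 eqr_nat.
  apply: is_derive_eq; rewrite /GRing.scale/=; field.
  by rewrite lk0 lt0r_neq0.
have cF : continuous (fun t : R => \sum_(l < size p) F l t).
  move=> x; apply/differentiable_continuous/derivable1_diffP.
  by have [] := DF x.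
rewrite (@continuous_FTC2 _ _ (fun t : R => \sum_(l < size p) F l t)); first last.
- by move=> x _; rewrite derive1E; have [_ ->] := DF x.
- split; first by move=> x _; have [] := DF x.
  + exact: cvg_at_right_filter (cF _).
  + exact: cvg_at_left_filter (cF _).
- exact/continuous_subspaceT/poly_cos_continuous.
- by rewrite gtrN.
rewrite -EFinB -sumrB; congr (_%:E).
have [kp|pk] := ltnP k (size p); last first.
  rewrite (nth_default _ pk) mulr0 big1// => l _.
  rewrite /F ltn_eqF ?(leq_trans _ pk)//.
  by rewrite mulNr mulrN sinN mulfK ?lt0r_neq0// sin_subnat_pi oppr0 subrr.
rewrite (bigD1 (Ordinal kp))//= big1 ?addr0 => [|l lk].
  by rewrite /F eqxx; ring.
rewrite /F; case: eqP => [lk'|_]; first by case/eqP: lk; exact/val_inj.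
by rewrite mulNr mulrN sinN mulfK ?lt0r_neq0// sin_subnat_pi oppr0 subrr.
Qed.

End fourier.

Section local_limit.
Variable R : realType.
Local Notation mu := (@lebesgue_measure R).
Variables (N : nat -> nat) (q : nat -> nat -> R) (k : nat -> nat).
Hypothesis q01 : forall n j, 0 <= q n j <= 1.
Let V n := bern_var (N n) (q n).
Let m n := bern_mean (N n) (q n).
Hypothesis Voo : V n @[n --> \oo] --> +oo.
Hypothesis mk : (m n - (k n)%:R) / Num.sqrt (V n) @[n --> \oo] --> (0 : R).

Let s n := Num.sqrt (V n).
(** The empty set is chosen when the variance vanishes, so that the domination [u_le] holds for
    every [n] and not only eventually. *)
Let D n : set R := if 0 < s n then `[- (pi * s n), pi * s n]%classic else set0.
Let u n (t : R) := complex.Re (centered_charfun (N n) (q n) (k n) (t / s n)).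

Let mD n : measurable (D n).
Proof. by rewrite /D; case: ifP. Qed.

Let uE n : u n = fun t => \sum_(l < size (bern_poly (N n) (q n)))
  (bern_poly (N n) (q n))`_l * cos ((l%:R - (k n)%:R) * (t / s n)).
Proof. by apply/funext => t; rewrite /u Re_centered_charfun. Qed.

Let soo : (s n)^-1 @[n --> \oo] --> (0 : R).
Proof.
apply/cvgrPdist_lt => e e0.
move/cvgryPgt : Voo => /(_ (e ^- 2)) [M _ hM]; exists M => // n /= /hM /= VM.
have e20 : 0 < e ^- 2 by rewrite invr_gt0 exprn_gt0.
have es : e^-1 < s n.
  rewrite -(ger0_norm (_ : 0 <= e^-1)) ?invr_ge0 ?(ltW e0)// -sqrtr_sqr.
  by rewrite ltr_sqrt ?(lt_trans e20)// exprVn.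
have s0 : 0 < s n by rewrite (lt_trans _ es)// invr_gt0.
by rewrite sub0r normrN gtr0_norm ?invr_gt0// invf_plt.
Qed.

Let s_gt0 : \forall n \near \oo, 0 < s n.
Proof.
move/cvgryPgt : Voo => /(_ 0) [M _ hM]; exists M => // n /= /hM /= VM.
by rewrite sqrtr_gt0.
Qed.

Let u_cvg t : (u n \_ (D n)) t @[n --> \oo] --> expR (- (t ^+ 2 / 2)).
Proof.
have key : \forall n \near \oo,
    `|expR (- (t ^+ 2 / 2)) - (u n \_ (D n)) t| <=
    `|t| ^+ 3 * (s n)^-1 + 2 * t ^+ 4 * (s n)^-1 ^+ 2 +
    `|cos ((m n - (k n)%:R) / s n * t) - 1|.
  near=> n.
  have sn0 : 0 < s n by near: n; exact: s_gt0.
  have Vs : V n = s n ^+ 2 by rewrite sqr_sqrtr// bern_var_ge0.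
  have st : `|t| / pi * (s n)^-1 < 1.
    near: n.
    have : `|t| / pi * (s n)^-1 @[n --> \oo] --> (`|t| / pi * 0 : R).
      exact: cvgZr.
    rewrite mulr0 => /cvgr_lt; exact.
  rewrite patchE ifT; last first.
    rewrite /D sn0 inE/= in_itv/= -ler_norml ltW//.
    by move: st; rewrite ltr_pdivrMr// mul1r ltr_pdivrMr ?pi_gt0// mulrC.
  rewrite distrC.
  have := centered_charfun_cvg (N n) (q01 n) (k n) (t / s n).
  rewrite -/(V n) -/(m n) -/(u n t) => h; move: h.
  have -> : V n * (t / s n) ^+ 2 = t ^+ 2.
    by rewrite Vs; field; rewrite lt0r_neq0.
  move=> /le_trans; apply; apply: lerD; last first.
    by rewrite mulrA mulrAC.
  rewrite Vs normrM (@ger0_norm _ (s n)^-1) ?invr_ge0 ?(ltW sn0)//.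
  rewrite le_eqVlt; apply/orP; left; apply/eqP; field.
  by rewrite lt0r_neq0.
apply/cvgrPdist_le => e e0.
have h0 : `|t| ^+ 3 * (s n)^-1 + 2 * t ^+ 4 * (s n)^-1 ^+ 2 +
    `|cos ((m n - (k n)%:R) / s n * t) - 1| @[n --> \oo] -->
    `|t| ^+ 3 * 0 + 2 * t ^+ 4 * (0 * 0) + `|cos (0 * t) - 1|.
  apply: cvgD; first (apply: cvgD; apply: cvgMr).
  - exact: soo.
  - by under eq_fun do rewrite expr2; apply: cvgM; exact: soo.
  apply: cvg_norm; apply: cvgB; last exact: cvg_cst.
  apply: (@cvg_comp _ _ _ _ cos _ (nbhs (0 * t))).
    by apply: cvgMl; exact: mk.
  exact: continuous_cos.
move: h0; rewrite !(mulr0, mul0r) cos0 subrr normr0 !addr0 => h0.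
near=> n; apply: (@le_trans _ _ (`|t| ^+ 3 * (s n)^-1 + 2 * t ^+ 4 * (s n)^-1 ^+ 2 +
    `|cos ((m n - (k n)%:R) / s n * t) - 1|)).
  by near: n; exact: key.
near: n; move/cvgr_le: h0; exact.
Unshelve. all: by end_near. Qed.

Let u_le n t : `|(u n \_ (D n)) t| <= expR (- (t ^+ 2 / 18)).
Proof.
rewrite patchE; case: ifPn => [|_]; last by rewrite normr0 expR_ge0.
rewrite inE /D; case: ifP => // sn0; rewrite /= in_itv/= -ler_norml => tpi.
have Vs : V n = s n ^+ 2 by rewrite sqr_sqrtr// bern_var_ge0.
apply: (le_trans (normr_Re_le _)).
have := @centered_charfun_le R (N n) (q n) (q01 n) (k n) (t / s n).
rewrite -/(V n) normrM normfV (gtr0_norm sn0) ler_pdivrMr// => /(_ tpi).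
move=> /le_trans; apply; rewrite ler_expR Vs le_eqVlt; apply/orP; left.
by apply/eqP; field; rewrite lt0r_neq0.
Qed.

Let gauss_integrable : mu.-integrable setT (fun t : R => (expR (- (t ^+ 2 / 18)))%:E).
Proof.
(* The exponent [t^2 / 18] is that of the centered normal density of standard deviation [3]. *)
have h := @integrable_normal_pdf R 0 3.
have p0 : normal_peak (3 : R) != 0 by rewrite lt0r_neq0// normal_peak_gt0.
have : mu.-integrable setT
    (fun t : R => ((normal_peak 3)^-1%:E * (normal_pdf 0 3 t)%:E)%E).
  exact: integrableZl.
apply: eq_integrable => //= t _; rewrite -EFinM; congr EFin.
rewrite normal_pdfE//= /normal_fun mulrA mulVf// mul1r subr0.
by congr expR; rewrite mulNr; congr (- _); congr (_ / _); ring.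
Qed.

Let gauss_value :
  (\int[mu]_t (expR (- (t ^+ 2 / 2)))%:E = (Num.sqrt (2 * pi))%:E :> \bar R)%E.
Proof.
have h := @integral_normal_pdf R 0 1.
have hi := @integrable_normal_pdf R 0 1.
have p0 : normal_peak (1 : R) != 0 by rewrite lt0r_neq0// normal_peak_gt0.
transitivity (\int[mu]_t ((normal_peak 1)^-1%:E * (normal_pdf 0 1 t)%:E))%E.
  apply: eq_integral => t _; rewrite -EFinM; congr EFin.
  rewrite normal_pdfE//= /normal_fun mulrA mulVf// mul1r subr0.
  by congr expR; rewrite mulNr; congr (- _); congr (_ / _); ring.
rewrite integralZl// h mule1 /normal_peak invrK; congr (Num.sqrt _)%:E.
by rewrite expr1n mul1r mulr_natl.
Qed.

Let int_u_cvg :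
  (\int[mu]_t ((u n \_ (D n)) t)%:E @[n --> \oo] --> (Num.sqrt (2 * pi))%:E)%E.
Proof.
have := @dominated_convergence _ _ _ mu setT measurableT
  (fun n t => ((u n \_ (D n)) t)%:E) (fun t => (expR (- (t ^+ 2 / 2)))%:E)
  (fun t => (expR (- (t ^+ 2 / 18)))%:E).
rewrite gauss_value => h; apply h => //.
- move=> n; apply/measurable_EFinP; apply: (measurable_restrictT _ (mD n)).1.
  apply: measurable_funTS; apply: continuous_measurable_fun.
  by rewrite uE; apply: poly_cos_continuous.
- apply/measurable_EFinP; apply: continuous_measurable_fun => t.
  apply: continuous_comp; last exact: continuous_expR.
  by apply: cvgN; apply: cvgMl; apply: exprn_continuous.
- by apply/nearW => t _; apply/cvg_EFin; [exact: nearW|exact: u_cvg].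
- by apply/nearW => t n _; rewrite /= lee_fin.
Qed.

(** By inversion at scale [s n], the quantity [2 pi s n P(Z = k n)] is the integral of [u n] over
    [D n], and dominated convergence sends it to the Gaussian integral [sqrt (2 pi)]. The setting is
    a triangular array in which [k n] is within [o(s n)] of the mean; it serves both the tilted
    variables and the fair coins behind Stirling's constant. *)
Theorem bernoulli_local_limit :
  Num.sqrt (2 * pi * bern_var (N n) (q n)) * (bern_poly (N n) (q n))`_(k n)
    @[n --> \oo] --> (1 : R).
Proof.
have sp0 : 0 < Num.sqrt (2 * pi) :> R by rewrite sqrtr_gt0 mulr_gt0// pi_gt0.
have h : (2 * pi * s n * (bern_poly (N n) (q n))`_(k n))%:E @[n --> \oo] -->
    (Num.sqrt (2 * pi))%:E.
  apply: cvg_trans int_u_cvg; apply: near_eq_cvg; near=> n.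
  have sn0 : 0 < s n by near: n; exact: s_gt0.
  rewrite -(poly_coef_fourier _ _ sn0).
  rewrite [RHS]integral_mkcond; apply: eq_integral => t _.
  by rewrite uE /D sn0 !patchE; case: ifP.
have {}h : 2 * pi * s n * (bern_poly (N n) (q n))`_(k n) @[n --> \oo] -->
    (Num.sqrt (2 * pi) : R) by apply: fine_cvg h.
have : (Num.sqrt (2 * pi))^-1 * (2 * pi * s n * (bern_poly (N n) (q n))`_(k n))
    @[n --> \oo] --> (Num.sqrt (2 * pi))^-1 * (Num.sqrt (2 * pi) : R).
  exact: cvgMr.
rewrite mulVf ?lt0r_neq0//; apply: cvg_trans; apply: near_eq_cvg.
apply: nearW => n /=.
rewrite [Num.sqrt (_ * bern_var _ _)]sqrtrM ?mulr_ge0 ?pi_ge0// -/(V n) -/(s n).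
set r := Num.sqrt (2 * pi) in sp0 *.
have -> : 2 * pi = r ^+ 2 :> R by rewrite sqr_sqrtr// mulr_ge0// pi_ge0.
by field; rewrite lt0r_neq0.
Unshelve. all: by end_near. Qed.

End local_limit.

(** * Exponential tilting *)

Section bern_poly_theory.
Variable R : realType.
Implicit Types (p q : nat -> R) (N k n : nat).

Lemma bern_poly0 p : bern_poly 0 p = 1.
Proof. by rewrite /bern_poly big_ord0. Qed.

Lemma bern_polyS N p :
  bern_poly N.+1 p = bern_poly N p * ((1 - p N)%:P + p N *: 'X).
Proof. by rewrite /bern_poly big_ord_recr. Qed.

Lemma coef_bern_polyS N p k : (bern_poly N.+1 p)`_k =
  (1 - p N) * (bern_poly N p)`_k +
  p N * (if k is k'.+1 then (bern_poly N p)`_k' else 0).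
Proof.
rewrite bern_polyS mulrDr coefD mulrC coefCM -scalerAr coefZ coefMX.
by case: k.
Qed.

Lemma size_bern_poly N p : (size (bern_poly N p) <= N.+1)%N.
Proof.
apply/leq_sizeP; elim: N => [|N ih] k; first by rewrite bern_poly0 coef1; case: k.
by case: k => // k Nk; rewrite coef_bern_polyS !ih ?mulr0 ?addr0// ltnW.
Qed.

Lemma bern_polyE N p y : (bern_poly N p).[y] = \prod_(j < N) (1 + p j * (y - 1)).
Proof.
rewrite horner_prod; apply: eq_bigr => j _; rewrite !hornerE; ring.
Qed.

Lemma bern_poly1 N p : (bern_poly N p).[1] = 1.
Proof. by rewrite bern_polyE big1// => j _; rewrite subrr mulr0 addr0. Qed.

Lemma coef_bern_poly_ge0 N p k :
  (forall j, 0 <= p j <= 1) -> 0 <= (bern_poly N p)`_k.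
Proof.
move=> p01; elim: N k => [|N ih] k; first by rewrite bern_poly0 coef1 ler0n.
have /andP[p0 p1] := p01 N.
by rewrite coef_bern_polyS addr_ge0 ?mulr_ge0 ?subr_ge0//; case: k.
Qed.

Lemma sum_coef_bern_poly N p : \sum_(k < N.+1) (bern_poly N p)`_k = 1.
Proof.
rewrite -(bern_poly1 N p) (horner_coef_wide _ (size_bern_poly N p)).
by apply: eq_bigr => k _; rewrite expr1n mulr1.
Qed.

(** The success probability after reweighting the law of a Bernoulli variable by [y^I / E[y^I]]; the
    denominator is [E[y^I]]. *)
Definition tilt (y : R) p j : R := p j * y / (1 + p j * (y - 1)).

Section tilting.
Variables (p : nat -> R) (y : R).
Hypotheses (p01 : forall j, 0 <= p j <= 1) (y0 : 0 < y).

Lemma tilt_denom_gt0 j : 0 < 1 + p j * (y - 1).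
Proof.
have /andP[h0 h1] := p01 j.
have [->|pj0] := eqVneq (p j) 0; first by rewrite mul0r addr0.
have : 0 < p j * y by rewrite mulr_gt0// lt0r pj0.
lra.
Qed.

Lemma tilt01 j : 0 <= tilt y p j <= 1.
Proof.
have h := tilt_denom_gt0 j; have /andP[h0 h1] := p01 j.
rewrite /tilt divr_ge0 ?mulr_ge0 ?(ltW y0) ?(ltW h)//=.
by rewrite ler_pdivrMr// mul1r; lra.
Qed.

(** The change of measure for the sum, coefficient by coefficient: the normalising factors of the
    single variables multiply up to the value of the polynomial at [y]. *)
Lemma coef_bern_poly_tilt N k :
  (bern_poly N p)`_k * y ^+ k =
  (bern_poly N p).[y] * (bern_poly N (tilt y p))`_k.
Proof.
rewrite bern_polyE.
elim: N k => [|N ih] k.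
  by rewrite !bern_poly0 big_ord0 mul1r coef1; case: k => [|k]; rewrite ?expr0 ?mulr1 ?mul0r.
rewrite !coef_bern_polyS big_ord_recr/=.
have h := lt0r_neq0 (tilt_denom_gt0 N).
have e1 : 1 - tilt y p N = (1 - p N) / (1 + p N * (y - 1)) by rewrite /tilt; field.
have e2 : tilt y p N = p N * y / (1 + p N * (y - 1)) by [].
rewrite e1 e2; set Q := \prod_(j < N) _ in ih *.
case: k => [|k].
  have := ih 0%N; rewrite expr0 !mulr1 !mulr0 !addr0 => ->; by field.
have -> : ((1 - p N) * (bern_poly N p)`_k.+1 + p N * (bern_poly N p)`_k) * y ^+ k.+1
  = (1 - p N) * ((bern_poly N p)`_k.+1 * y ^+ k.+1)
    + p N * y * ((bern_poly N p)`_k * y ^+ k) by rewrite exprS; ring.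
rewrite !ih; by field.
Qed.

(** After tilting, the normalised tail is the sum over [k >= n] of [b_k y^-(k - n)], where [b] is
    the tilted law. The term [k = n] is the one subtracted; every other term has a factor at most
    [y^-1], and the [b_k] sum to at most [1]. *)
Lemma tail_bern_poly_tilt N n : 1 <= y ->
  `| (\sum_(n <= k < N.+1) (bern_poly N p)`_k) * y ^+ n / (bern_poly N p).[y]
     - (bern_poly N (tilt y p))`_n | <= y^-1.
Proof.
move=> y1; set b := bern_poly N (tilt y p).
have Q0 : 0 < (bern_poly N p).[y].
  by rewrite bern_polyE prodr_gt0// => j _; exact: tilt_denom_gt0.
have yk k : y ^+ k != 0 by rewrite expf_neq0// lt0r_neq0.
have b0 k : 0 <= b`_k by apply: coef_bern_poly_ge0 => j; exact: tilt01.
have aE k : (n <= k)%N ->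
    (bern_poly N p)`_k * y ^+ n / (bern_poly N p).[y] = b`_k * y ^- (k - n).
  move=> nk; have := coef_bern_poly_tilt N k; rewrite -/b.
  have -> : y ^+ k = y ^+ (k - n) * y ^+ n by rewrite -exprD subnK.
  move=> h; apply: (mulIf (yk (k - n)%N)); rewrite mulfVK ?yk//.
  apply: (mulfI (lt0r_neq0 Q0)); rewrite -h; field.
  by rewrite lt0r_neq0.
rewrite mulr_suml mulr_suml.
rewrite (eq_big_nat _ _ (F2 := fun k => b`_k * y ^- (k - n))); last first.
  by move=> k /andP[nk _]; rewrite aE.
have [Nn|nN] := ltnP N n.
  rewrite big_geq// nth_default ?subrr ?normr0 ?invr_ge0 ?(ltW y0)//.
  exact: leq_trans (size_bern_poly _ _) _.
rewrite big_nat_recl// subnn invr1 mulr1 addrAC subrr add0r.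
rewrite ger0_norm; last first.
  by apply: sumr_ge0 => k _; rewrite mulr_ge0// invr_ge0 exprn_ge0// ltW.
apply: (@le_trans _ _ (\sum_(n <= k < N) b`_k.+1 * y^-1)).
  rewrite !big_nat; apply: ler_sum => k /andP[nk kN].
  rewrite ler_wpM2l// lef_pV2 ?posrE ?exprn_gt0// subSn// exprS.
  by rewrite ler_peMr ?(ltW y0)// exprn_ege1.
rewrite -mulr_suml ler_piMl ?invr_ge0 ?(ltW y0)//.
rewrite -(sum_coef_bern_poly N (tilt y p)) -/b -(big_mkord xpredT (fun k => b`_k)).
rewrite [leRHS](@big_cat_nat _ _ _ n.+1)//= big_add1/=.
by rewrite lerDr sumr_ge0.
Qed.

End tilting.
End bern_poly_theory.

(** * Laws of the partial sums and the generating function of the full sum *)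

Section bernoulli_count.
Variables (d : measure_display) (T : measurableType d) (R : realType).
Variables (P : probability T R) (I : nat -> {RV P >-> bool}) (p : nat -> R).
Hypothesis indep : mutually_independent P I.
Hypothesis pE : forall j, P [set t | I j t = true] = (p j)%:E.

Lemma prob01 j : 0 <= p j <= 1.
Proof.
have mI : measurable [set t | I j t = true].
  exact: (@measurable_funPTI _ _ _ _ (I j) [set true]).
have : (0%:E <= (p j)%:E <= 1%:E)%E.
  by rewrite -pE; apply/andP; split; [exact: measure_ge0|exact: probability_le1].
by rewrite !lee_fin.
Qed.

Lemma measurable_I j (A : set bool) : measurable (I j @^-1` A).
Proof. by apply: measurable_funPTI. Qed.

Lemma pEF j : P (I j @^-1` [set false]) = (1 - p j)%:E.
Proof.
have -> : I j @^-1` [set false] = ~` [set t | I j t = true].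
  by apply/seteqP; split => t /=; [move=> -> | case: (I j t)].
by rewrite probability_setC ?pE//; exact: (measurable_I j [set true]).
Qed.

Definition count N t : nat := \sum_(j < N) I j t.

Lemma countS N t : count N.+1 t = (count N t + I N t)%N.
Proof. by rewrite /count big_ord_recr. Qed.

Lemma count_le N t : (count N t <= N)%N.
Proof.
elim: N => [|N ih]; first by rewrite /count big_ord0.
by rewrite countS -addn1 leq_add//; case: (I N t).
Qed.

Lemma count_homo t : {homo count^~ t : m n / (m <= n)%N}.
Proof.
by apply: homo_leq => // [?|] //; [exact: leq_trans|move=> n; rewrite countS leq_addr].
Qed.

Lemma count_eqS N k : [set t | count N.+1 t = k] =
  ([set t | count N t = k] `&` I N @^-1` [set false]) `|`
  ((if k is k'.+1 then [set t | count N t = k'] else set0) `&` I N @^-1` [set true]).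
Proof.
apply/seteqP; split => t /=; rewrite countS.
  case: (I N t) => /=; last by rewrite addn0; left.
  by rewrite addn1; case: k => // k [<-]; right.
by case=> -[+ ->]; rewrite ?addn0//; case: k => //= k ->; rewrite addn1.
Qed.

Lemma measurable_count N k : measurable [set t | count N t = k].
Proof.
elim: N k => [|N ih] k.
  have [->|k0] := eqVneq k 0%N.
    by rewrite (_ : mkset _ = setT)//; apply/seteqP; split => t // _; rewrite /= /count big_ord0.
  rewrite (_ : mkset _ = set0)//; apply/seteqP; split => t //=.
  by rewrite /count big_ord0 => /esym/eqP; rewrite (negbTE k0).
rewrite count_eqS; apply: measurableU; apply: measurableI => //; try exact: measurable_I.
by case: k.
Qed.

(** Independence is given for events on single variables, while the count depends on many of them.
    The induction therefore carries an arbitrary cylinder over indices at least [N]; the step moves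
    the index [N] from the count into the cylinder. *)
Lemma prob_count_cylinder N k (J : {fset nat}) (A : nat -> set bool) :
  (forall j, j \in J -> (N <= j)%N) ->
  P ([set t | count N t = k] `&` \bigcap_(j in [set` J]) (I j @^-1` A j)) =
  (((bern_poly N p)`_k)%:E * \prod_(j <- J) P (I j @^-1` A j))%E.
Proof.
elim: N k J A => [|N ih] k J A NJ.
  rewrite bern_poly0 coef1; have [->|k0] := eqVneq k 0%N.
    rewrite (_ : mkset _ = setT) ?setTI ?mul1e ?indep//.
    by apply/seteqP; split => t // _; rewrite /= /count big_ord0.
  rewrite (_ : mkset _ = set0) ?set0I ?measure0 ?mul0e//.
  apply/seteqP; split => t //=.
  by rewrite /count big_ord0 => /esym/eqP; rewrite (negbTE k0).
have NnJ : N \notin J by apply/negP => /NJ; rewrite ltnn.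
pose A' b j := if j == N then [set b] else A j.
pose B b := \bigcap_(j in [set` (N |` J)%fset]) (I j @^-1` A' b j).
have BE b : B b = I N @^-1` [set b] `&` \bigcap_(j in [set` J]) (I j @^-1` A j).
  apply/seteqP; split => t.
    move=> h; split; first by have := h N; rewrite /= /A' eqxx; apply; rewrite fset1U1.
    move=> j /= jJ; have := h j; rewrite /= /A' ifF; last first.
      by apply: contraNF NnJ => /eqP <-.
    by apply; rewrite fset1Ur.
  move=> [hN h] j /=; rewrite in_fset1U => /orP[/eqP ->|jJ].
    by rewrite /A' eqxx.
  rewrite /A' ifF; first exact: h.
  by apply: contraNF NnJ => /eqP <-.
have PB b n : P ([set t | count N t = n] `&` B b) =
    (((bern_poly N p)`_n)%:E * (P (I N @^-1` [set b]) * \prod_(j <- J) P (I j @^-1` A j)))%E.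
  rewrite ih; last first.
    by move=> j; rewrite in_fset1U => /orP[/eqP ->//|/NJ /ltnW].
  rewrite big_fsetU1//= {1}/A' eqxx; congr (_ * (_ * _))%E.
  rewrite big_seq [RHS]big_seq; apply: eq_bigr => j jJ.
  by rewrite /A' ifF//; apply: contraNF NnJ => /eqP <-.
have mB b : measurable (B b).
  by apply: fin_bigcap_measurable => // j _; exact: measurable_I.
have mE n b : measurable ([set t | count N t = n] `&` B b).
  by apply: measurableI => //; exact: measurable_count.
have -> : [set t | count N.+1 t = k] `&` \bigcap_(j in [set` J]) (I j @^-1` A j) =
    ([set t | count N t = k] `&` B false) `|`
    ((if k is k'.+1 then [set t | count N t = k'] else set0) `&` B true).
  by rewrite count_eqS setIUl -!setIA -!BE.
rewrite measureU//; first last.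
- rewrite -subset0 => t -[] [_ +] [_ +]; rewrite !BE => -[/= -> _] [].
  by [].
- by case: k => [|k]; rewrite ?set0I//; exact: mE.
have PBt : P ((if k is k'.+1 then [set t | count N t = k'] else set0) `&` B true) =
    ((if k is k'.+1 then (bern_poly N p)`_k' else 0)%:E *
     (P (I N @^-1` [set true]) * \prod_(j <- J) P (I j @^-1` A j)))%E.
  by case: k => [|k]; [rewrite set0I measure0 mul0e|exact: PB].
transitivity (((bern_poly N p)`_k)%:E *
     (P (I N @^-1` [set false]) * \prod_(j <- J) P (I j @^-1` A j)) +
    (if k is k'.+1 then (bern_poly N p)`_k' else 0)%:E *
     (P (I N @^-1` [set true]) * \prod_(j <- J) P (I j @^-1` A j)))%E.
  exact: (congr2 adde (PB false k) PBt).
have -> : P (I N @^-1` [set true]) = (p N)%:E by rewrite -pE.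
have -> : (\prod_(j <- J) P (I j @^-1` A j) =
    (\prod_(j <- J) fine (P (I j @^-1` A j)))%:E)%E.
  rewrite -prodEFin; apply: eq_bigr => j _; rewrite fineK//.
  by apply: fin_num_measure; exact: measurable_I.
have -> : P (I N @^-1` [set false]) = (1 - p N)%:E by exact: pEF.
rewrite coef_bern_polyS.
by case: k {PBt} => [|k]; rewrite -!EFinM -EFinD; congr EFin; ring.
Qed.

Lemma prob_count N k : P [set t | count N t = k] = ((bern_poly N p)`_k)%:E.
Proof.
have := @prob_count_cylinder N k fset0 (fun=> setT); rewrite big_nil mule1 => <- //.
by rewrite (_ : \bigcap_(j in _) _ = setT) ?setIT// set_fset0 bigcap_set0.
Qed.

Lemma prob_count_ge N n :
  P [set t | (n <= count N t)%N] = (\sum_(n <= k < N.+1) (bern_poly N p)`_k)%:E.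
Proof.
suff h m : P [set t | (n <= count N t < m)%N] =
      (\sum_(n <= k < m) (bern_poly N p)`_k)%:E /\
    measurable [set t | (n <= count N t < m)%N].
  rewrite -(h N.+1).1; congr (P _); apply/seteqP; split => t /=.
    by rewrite ltnS count_le andbT.
  by case/andP.
elim: m => [|m [ih mm]].
  rewrite (_ : mkset _ = set0) ?measure0 ?big_geq//.
  by apply/seteqP; split => t //=; rewrite ltn0 andbF.
have [nm|mn] := leqP n m; last first.
  rewrite (_ : mkset _ = set0) ?measure0 ?big_geq//.
  apply/seteqP; split => t //= /andP[h1 h2].
  by move: h1 h2 mn; lia.
rewrite big_nat_recr//= EFinD -ih -prob_count.
have -> : [set t | (n <= count N t < m.+1)%N] =
    [set t | (n <= count N t < m)%N] `|` [set t | count N t = m].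
  apply/seteqP; split => t /=.
    move=> /andP[h1]; rewrite ltnS leq_eqVlt => /predU1P[->|h2]; first by right.
    by left; rewrite h1.
  by case=> [/andP[-> /ltnW]//|->]; rewrite nm leqnn.
split; last by apply: measurableU => //; exact: measurable_count.
rewrite measureU//; first exact: measurable_count.
rewrite -subset0 => t /= [/andP[_ +] e].
by rewrite e ltnn.
Qed.

Lemma measurable_count_ge N n : measurable [set t | (n <= count N t)%N].
Proof.
have -> : [set t | (n <= count N t)%N] =
    \bigcup_(k in [set k | (n <= k)%N]) [set t | count N t = k].
  by apply/seteqP; split => t /=; [exists (count N t)|case=> k /= nk ->].
by apply: bigcup_measurable => k _; exact: measurable_count.
Qed.

Lemma indicator_sum_partial N t :
  (\sum_(0 <= j < N) ((I j t)%:R : R)%:E)%E = ((count N t)%:R)%:E.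
Proof. by rewrite sumEFin -natr_sum big_mkord. Qed.

Lemma indicator_sum_ge n t :
  (n%:R%:E <= indicator_sum P I t)%E <-> exists N, (n <= count N t)%N.
Proof.
have I0 j : (0 <= ((I j t)%:R : R)%:E)%E by rewrite lee_fin ler0n.
split => [h|[N nN]]; last first.
  apply: (@le_trans _ _ ((count N t)%:R)%:E); first by rewrite lee_fin ler_nat.
  by rewrite -indicator_sum_partial; apply: nneseries_lim_ge.
apply: contrapT => /forallNP hN.
(* Partial sums are integers, so those below [n] are at most [n - 1]; unlike the strict inequality,
   this gap survives the limit. *)
suff : (indicator_sum P I t <= (n%:R - 1)%:E)%E.
  by move=> /(le_trans h); rewrite lee_fin; lra.
apply: lime_le; first exact: is_cvg_nneseries.
apply: nearW => N; rewrite indicator_sum_partial lee_fin.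
have /negP := hN N; rewrite -ltnNge => cn.
by rewrite lerBrDr natr1 ler_nat.
Qed.

(** The events that the partial count reaches [n] increase to the event for the full sum, hence
    continuity from below. *)
Lemma prob_indicator_sum_ge_cvg n :
  \sum_(n <= k < N.+1) (bern_poly N p)`_k @[N --> \oo] -->
  fine (P [set t | (n%:R%:E <= indicator_sum P I t)%E]).
Proof.
have -> : [set t | (n%:R%:E <= indicator_sum P I t)%E] =
    \bigcup_N [set t | (n <= count N t)%N].
  by apply/seteqP; split => t /=; [move=> /indicator_sum_ge[N]; exists N|
     move=> [N _ h]; apply/indicator_sum_ge; exists N].
suff : (\sum_(n <= k < N.+1) (bern_poly N p)`_k)%:E @[N --> \oo] -->
    (fine (P (\bigcup_N [set t | (n <= count N t)%N])))%:E.
  by move=> h; apply: fine_cvg h.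
rewrite fineK; last first.
  apply: fin_num_measure.
  by apply: bigcup_measurable => N _; exact: measurable_count_ge.
under eq_fun do rewrite -prob_count_ge.
apply: nondecreasing_cvg_mu.
- by move=> N; exact: measurable_count_ge.
- by apply: bigcup_measurable => N _; exact: measurable_count_ge.
- move=> M N MN; apply/subsetPset => t /= h; exact: leq_trans h (count_homo t MN).
Qed.

Section generating_function.
Variable y : R.
Hypothesis y0 : 0 < y.

Lemma integral_expn_count N :
  (\int[P]_t (y ^+ count N t)%:E = (bern_poly N p).[y]%:E)%E.
Proof.
transitivity (\int[P]_t (\sum_(k < N.+1)
    (y ^+ k)%:E * (\1_[set t | count N t = k] t)%:E))%E.
  apply: eq_integral => t _; under [RHS]eq_bigr do rewrite -EFinM.
  rewrite sumEFin; congr EFin.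
  rewrite (bigD1 (Ordinal (_ : count N t < N.+1)%N)) ?ltnS ?count_le//= => ct.
  rewrite indicE mem_set//= mulr1 big1 ?addr0// => k kt.
  rewrite indicE memNset ?mulr0//= => e; case/eqP: kt.
  exact/val_inj.
rewrite ge0_integral_sum//; last first.
- by move=> k t _; rewrite mule_ge0 ?lee_fin// exprn_ge0// ltW.
- move=> k; apply: measurable_funeM; apply/measurable_EFinP.
  by apply: measurable_indic; exact: measurable_count.
rewrite (horner_coef_wide _ (size_bern_poly N p)) -sumEFin.
apply: eq_bigr => k _; rewrite ge0_integralZl//.
- rewrite integral_indic//; last exact: measurable_count.
  rewrite setIT [in RHS]mulrC EFinM; congr (_ * _)%E; exact: prob_count.
- apply/measurable_EFinP.
  by apply: measurable_indic; exact: measurable_count.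
- by rewrite lee_fin exprn_ge0// ltW.
Qed.

Lemma count_cvg t :
  (exists K N0, (forall N, (N0 <= N)%N -> count N t = K) /\
     indicator_sum P I t = K%:R%:E) \/
  ((forall K, exists N0, forall N, (N0 <= N)%N -> (K <= count N t)%N) /\
     indicator_sum P I t = +oo%E).
Proof.
have [[K hK]|h] := pselect (exists K, forall N, (count N t <= K)%N).
  left; have [M hM] : exists M, forall N, (count N t <= count M t)%N.
    elim: K hK => [|K ih] hK; first by exists 0%N => N; rewrite (leq_trans (hK _)).
    have [[M hM]|/forallNP h] := pselect (exists M, count M t = K.+1).
      by exists M => N; rewrite hM.
    by apply: ih => N; rewrite -ltnS ltn_neqAle hK andbT; apply/eqP.
  exists (count M t), M; have cM N : (M <= N)%N -> count N t = count M t.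
    by move=> MN; apply/eqP; rewrite eqn_leq hM count_homo.
  split => //; rewrite /indicator_sum; apply: cvg_lim => //.
  apply: cvg_near_cst; exists M => // N /= MN.
  by rewrite indicator_sum_partial cM.
right; split.
  move=> K; apply: contrapT => /forallNP hK; apply: h; exists K => N.
  have := hK N; move=> /existsNP[N' /not_implyP[NN' /negP]].
  rewrite -ltnNge => /ltnW; apply: leq_trans; exact: count_homo.
have {h} h n : (n%:R%:E <= indicator_sum P I t)%E.
  apply/indicator_sum_ge; apply: contrapT => /forallNP hn; apply: h.
  by exists n => N; have /negP := hn N; rewrite -ltnNge => /ltnW.
case: (indicator_sum P I t) h => [r|//|] h; last by have := h 0%N.
have := h (Num.bound r); rewrite lee_fin leNgt => /negP; case.
exact: unstable.ltr_bound.
Qed.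

Lemma expn_count_cvg t : (y ^+ count N t)%:E @[N --> \oo] -->
  expeR ((ln y)%:E * indicator_sum P I t)%E.
Proof.
have yK K : expeR ((ln y)%:E * K%:R%:E)%E = (y ^+ K)%:E.
  by rewrite -EFinM /= expRM_natr lnK.
case: (count_cvg t) => [[K [N0 [hK ->]]]|[hK ->]].
  rewrite yK; apply: cvg_near_cst; exists N0 => // N /= N0N.
  by rewrite hK.
(* The sum is infinite here, and the value of [expeR] follows the extended conventions: [1] for
   [y = 1] because zero times infinity is zero, [+oo] for [y > 1], and [0] for [y < 1]. *)
have [y1|y1|->] := ltgtP y 1; last first.
- rewrite ln1 mul0e expeR0; under eq_fun do rewrite expr1n.
  exact: cvg_cst.
- rewrite gt0_muley ?lte_fin ?ln_gt0//=; apply/cvgeryP/cvgryPge => A.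
  have y1' : 0 < y - 1 by lra.
  have [n0 hn0] : exists n0, A <= y ^+ n0.
    have yn n : 1 + n%:R * (y - 1) <= y ^+ n.
      elim: n => [|n ih]; first by rewrite mul0r addr0 expr0.
      have n0 : 0 <= n%:R :> R by [].
      have h1 : y * (1 + n%:R * (y - 1)) <= y * y ^+ n by rewrite ler_wpM2l// ltW.
      have h2 : 0 <= n%:R * ((y - 1) * (y - 1)) by rewrite !mulr_ge0// ltW.
      by rewrite exprS -natr1; lra.
    exists (Num.bound (A / (y - 1))); apply: (le_trans _ (yn _)).
    have := @unstable.ltr_bound R (A / (y - 1)); rewrite ltr_pdivrMr//; lra.
  have [N0 hN0] := hK n0.
  exists N0 => // N /= /hN0 h; rewrite (le_trans hn0)//.
  by rewrite ler_weXn2l// ltW.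
- rewrite lt0_muley ?lte_fin ?ln_lt0 ?y0//=; apply/cvg_EFin; first exact: nearW.
  apply/cvgrPdist_le => e e0.
  have : (y ^+ n) @[n --> \oo] --> 0 by apply: cvg_expr; rewrite ger0_norm ?ltW.
  move/cvgrPdist_le/(_ e e0) => [n0 _ hn0]; have [N0 hN0] := hK n0.
  exists N0 => // N /= /hN0 h; apply: (le_trans _ (hn0 n0 _)) => //=.
  rewrite !sub0r !normrN !ger0_norm ?exprn_ge0 ?(ltW y0)//.
  by apply: ler_wiXn2l => //; rewrite ltW.
Qed.

Lemma measurable_expn_count N : measurable_fun setT (fun t => (y ^+ count N t)%:E).
Proof.
apply/measurable_EFinP.
have -> : (fun t => y ^+ count N t) = (fun t => \prod_(j < N) (y ^+ I j t)).
  by apply/funext => t; rewrite -expr_sum.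
apply: measurable_prod => j _.
have : measurable_fun setT (fun b : bool => y ^+ b) by [].
by move=> h; apply: (measurableT_comp h).
Qed.

(** The powers of [y] are monotone in [N] when [y >= 1], and bounded by [1] when [y < 1]: monotone
    convergence covers the first case and dominated convergence the second. *)
Lemma genfun_cvg : (bern_poly N p).[y]%:E @[N --> \oo] -->
  (\int[P]_t expeR ((ln y)%:E * indicator_sum P I t))%E.
Proof.
under eq_fun do rewrite -integral_expn_count.
have [y1|y1] := leP 1 y.
  have -> : (\int[P]_t expeR ((ln y)%:E * indicator_sum P I t) =
      \int[P]_t limn (fun N => (y ^+ count N t)%:E))%E.
    apply: eq_integral => t _; apply/esym/cvg_lim => //; exact: expn_count_cvg.
  apply: cvg_monotone_convergence => //.
  - by move=> N; exact: measurable_expn_count.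
  - by move=> N t _; rewrite lee_fin exprn_ge0// ltW.
  - by move=> t _ M N MN; rewrite lee_fin ler_weXn2l// count_homo.
have := @dominated_convergence _ _ _ P setT measurableT
  (fun N t => (y ^+ count N t)%:E)
  (fun t => expeR ((ln y)%:E * indicator_sum P I t)%E) (cst 1%:E).
move=> h; apply h => //.
- by move=> N; exact: measurable_expn_count.
- apply: (emeasurable_fun_cvg (fun N t => (y ^+ count N t)%:E)) => //.
    by move=> N; exact: measurable_expn_count.
  by move=> t _; exact: expn_count_cvg.
- by apply/nearW => t _; exact: expn_count_cvg.
- exact: finite_measure_integrable_cst.
- apply/nearW => t N _ /=; rewrite lee_fin ger0_norm ?exprn_ge0 ?(ltW y0)//.
  by rewrite exprn_ile1// ltW.
Qed.

End generating_function.

(** Both signs use [log (1 + u) <= u], the lower bound after inverting the argument of the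
    logarithm. The term [y^-1] covers small [y]; summability of [p] then gives absolute convergence
    of the series defining [Psi]. *)
Lemma norm_ln_genfun_le j y : 0 < y ->
  `|ln (1 + p j * (y - 1))| <= p j * (y + y^-1).
Proof.
move=> y0; have /andP[h0 h1] := prob01 j.
have yV : 0 < y^-1 by rewrite invr_gt0.
have D0 := tilt_denom_gt0 prob01 y0 j.
have up : ln (1 + p j * (y - 1)) <= p j * (y + y^-1).
  apply: (le_trans (le_ln1Dx _)); first by lra.
  by rewrite ler_wpM2l//; lra.
rewrite ler_norml up andbT -lerN2 opprK -lnV ?posrE//.
have -> : (1 + p j * (y - 1))^-1 = 1 + - (p j * (y - 1)) / (1 + p j * (y - 1)).
  by field; rewrite lt0r_neq0.
apply: (le_trans (le_ln1Dx _)).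
  rewrite ltrNl -mulNr opprK ltr_pdivrMr// mul1r; lra.
rewrite ler_pdivrMr// -subr_ge0.
have -> : p j * (y + y^-1) * (1 + p j * (y - 1)) - - (p j * (y - 1)) =
   p j * ((y + y^-1) * (1 - p j) + (p j * y ^+ 2) + p j * (y^-1 * y) + y - 1).
  ring.
rewrite mulVf ?lt0r_neq0// mulr1 mulr_ge0//.
have yy : 2 <= y + y^-1.
  have : 0 <= (y - 1) ^+ 2 * y^-1 by rewrite mulr_ge0 ?sqr_ge0// ltW.
  have -> : (y - 1) ^+ 2 * y^-1 = y + y^-1 - 2 by field; rewrite lt0r_neq0.
  lra.
have : 2 * (1 - p j) <= (y + y^-1) * (1 - p j) by rewrite ler_wpM2r// subr_ge0.
have : 0 <= p j * y ^+ 2 by rewrite mulr_ge0// sqr_ge0.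
lra.
Qed.

Lemma Psi_cvg y : 0 < y -> cvgn (series p) ->
  series (fun j => ln (1 + p j * (y - 1))) @ \oo --> Psi p y.
Proof.
move=> y0 cp; suff : cvgn (series (fun j => ln (1 + p j * (y - 1)))) by [].
apply: normed_cvg; apply: (@series_le_cvg _ _ (fun j => p j * (y + y^-1))).
- by move=> j /=.
- move=> j; have /andP[h0 _] := prob01 j.
  by rewrite mulr_ge0// addr_ge0 ?invr_ge0// ltW.
- by move=> j; exact: norm_ln_genfun_le.
- have -> : series (fun j => p j * (y + y^-1)) = fun n => series p n * (y + y^-1).
    by apply/funext => n; rewrite /series/= mulr_suml.
  by apply: is_cvgM => //; exact: is_cvg_cst.
Qed.

Lemma expR_series_ln_genfun N y : 0 < y ->
  expR (series (fun j => ln (1 + p j * (y - 1))) N) = (bern_poly N p).[y].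
Proof.
move=> y0; rewrite bern_polyE /series/= big_mkord expR_sum.
apply: eq_bigr => j _; rewrite lnK// posrE; exact: tilt_denom_gt0 prob01 y0 j.
Qed.

Lemma cumulant_gen_funE y : 0 < y -> cvgn (series p) ->
  cumulant_gen_fun P (indicator_sum P I) (ln y) = (Psi p y)%:E.
Proof.
move=> y0 cp; rewrite /cumulant_gen_fun.
rewrite -(cvg_lim _ (genfun_cvg y0))//.
have -> : limn (fun N => (bern_poly N p).[y]%:E) = (expR (Psi p y))%:E.
  apply: cvg_lim => //; apply/cvg_EFin; first exact: nearW.
  have -> : fine \o (fun N => (bern_poly N p).[y]%:E) =
      expR \o series (fun j => ln (1 + p j * (y - 1))).
    by apply/funext => N /=; rewrite expR_series_ln_genfun.
  exact: (cvg_comp _ _ (Psi_cvg y0 cp) (@continuous_expR R _)).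
by rewrite lne_EFin ?expR_gt0// expRK.
Qed.

End bernoulli_count.

(** * Riemann sums and the limiting tilted parameters *)

Section primitive.
Variable R : realType.
Local Notation mu := (@lebesgue_measure R).
Variables (f : R -> R) (a : R).
Hypothesis cf : forall x, a <= x -> {for x, continuous f}.

Definition primitive (x : R) : R := \int[mu]_(t in `[a, x]) f t.

Let cfw b : {within `[a, b], continuous f}.
Proof.
apply: continuous_in_subspaceT => x; rewrite inE/= in_itv/= => /andP[ax _].
exact: cf.
Qed.

Lemma integrable_segment b : mu.-integrable `[a, b] (EFin \o f).
Proof.
by apply: continuous_compact_integrable; [exact: segment_compact|exact: cfw].
Qed.

Lemma is_derive_primitive x : a < x -> is_derive x 1 primitive (f x).
Proof.
move=> ax; have xu : x < x + 1 by rewrite ltrDl.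
have h := continuous_FTC1_closed xu (integrable_segment (x + 1)) ax (cf (ltW ax)).
apply: DeriveDef; first exact: h.1.
rewrite -derive1E; exact: h.2.
Qed.

Lemma primitive_continuous b c : a <= b -> {within `[b, c], continuous primitive}.
Proof.
move=> ab; have [bc|cb] := leP b c; last first.
  rewrite set_itv_ge; first by exact: continuous_subspace0.
  by rewrite bnd_simp -ltNge.
have := parameterized_integral_continuous (le_trans ab bc) (integrable_segment c).
by apply: continuous_subspaceW; apply: subset_itvr; rewrite bnd_simp.
Qed.

Lemma primitive_left : primitive a = 0.
Proof. by rewrite /primitive set_itv1 Rintegral_set1. Qed.

Lemma primitiveB_le b c M : a <= b <= c ->
  (forall x, x \in `]b, c[ -> f x <= M) -> primitive c - primitive b <= M * (c - b).
Proof.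
move=> /andP[ab bc] fM; rewrite mulrBr.
apply: (@ler_deriv R primitive (fun x => M * x) f (cst M)) => //.
- move=> x; rewrite in_itv/= => /andP[bx _].
  by apply: is_derive_primitive; exact: le_lt_trans ab bx.
- by move=> x _; apply: is_derive_eq; rewrite /GRing.scale/= mulr1.
- exact: primitive_continuous.
- by apply: continuous_subspaceT => x; apply: cvgMr; exact: cvg_id.
Qed.

Lemma primitiveB_ge b c m : a <= b <= c ->
  (forall x, x \in `]b, c[ -> m <= f x) -> m * (c - b) <= primitive c - primitive b.
Proof.
move=> /andP[ab bc] fM; rewrite mulrBr.
apply: (@ler_deriv R (fun x => m * x) primitive (cst m) f) => //.
- by move=> x _; apply: is_derive_eq; rewrite /GRing.scale/= mulr1.
- move=> x; rewrite in_itv/= => /andP[bx _].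
  by apply: is_derive_primitive; exact: le_lt_trans ab bx.
- by apply: continuous_subspaceT => x; apply: cvgMr; exact: cvg_id.
- exact: primitive_continuous.
Qed.

Section improper.
Variable M : R.
Hypothesis f0 : forall x, a <= x -> 0 <= f x.
Hypothesis fM : forall x, a <= x -> primitive x <= M.

Lemma primitive_homo : {in `[a, +oo[ &, {homo primitive : x y / x <= y}}.
Proof.
move=> x y; rewrite !in_itv/= !andbT => ax ay xy.
rewrite -subr_ge0 -(mul0r (y - x)); apply: primitiveB_ge; first by rewrite ax.
by move=> z; rewrite in_itv/= => /andP[xz _]; rewrite f0// (le_trans ax)// ltW.
Qed.

Let mf : measurable_fun `[a, +oo[ f.
Proof.
apply: subspace_continuous_measurable_fun => //.
apply: continuous_in_subspaceT => x; rewrite inE/= in_itv/= andbT => ax.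
exact: cf.
Qed.

Let E n : (\int[mu]_(t in `[a, (a + n%:R)%R]) (f t)%:E = (primitive (a + n%:R))%:E)%E.
Proof.
rewrite /primitive /Rintegral fineK//.
exact: integrable_fin_num (integrable_segment _).
Qed.

Let cvgE : (primitive (a + n%:R))%:E @[n --> \oo] -->
  (\int[mu]_(t in `[a, +oo[) (f t)%:E)%E.
Proof.
under eq_fun do rewrite -E.
rewrite itv_bndy_bigcup_BRight.
apply: ge0_nondecreasing_set_cvg_integral.
- move=> m n mn; apply/subsetPset; apply: subset_itvl; rewrite bnd_simp.
  by rewrite lerD2l ler_nat.
- by move=> n.
- move=> n; apply/measurable_EFinP; apply: measurable_funS mf => //.
  by apply: subset_itvl.
- by move=> n x /=; rewrite in_itv/= => /andP[ax _]; rewrite lee_fin f0.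
Qed.

Lemma improper_integrable : mu.-integrable `[a, +oo[ (EFin \o f).
Proof.
apply/integrableP; split; first exact/measurable_EFinP.
apply: (@le_lt_trans _ _ M%:E); last exact: ltry.
have -> : (\int[mu]_(t in `[a, +oo[) `|(EFin \o f) t| =
    \int[mu]_(t in `[a, +oo[) (f t)%:E)%E.
  apply: eq_integral => /=; by move=> x; rewrite inE/= in_itv/= andbT => ax; rewrite ger0_norm// f0.
rewrite -(cvg_lim _ cvgE)//; apply: lime_le; first by apply/cvg_ex; eexists; exact: cvgE.
by apply: nearW => n; rewrite lee_fin fM// lerDl.
Qed.

Lemma primitive_le_improper x : a <= x -> primitive x <= \int[mu]_(t in `[a, +oo[) f t.
Proof.
move=> ax; rewrite /primitive /Rintegral; apply: fine_le.
- exact: integrable_fin_num (integrable_segment _).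
- exact: integrable_fin_num improper_integrable.
- apply: ge0_subset_integral => //.
  + exact/measurable_EFinP.
  + by move=> y; rewrite /= in_itv/= andbT => ay; rewrite lee_fin f0.
  + by apply: subset_itvl.
Qed.

(** Convergence is known along [a + n] for integers [n]; monotonicity of the primitive extends it to
    real [x]. *)
Lemma primitive_cvg : primitive x @[x --> +oo] --> \int[mu]_(t in `[a, +oo[) f t.
Proof.
have h : primitive (a + n%:R) @[n --> \oo] --> \int[mu]_(t in `[a, +oo[) f t.
  suff : (primitive (a + n%:R))%:E @[n --> \oo] --> (\int[mu]_(t in `[a, +oo[) f t)%:E.
    by move=> h; apply: fine_cvg h.
  rewrite [X in _ --> X%:E]/Rintegral fineK; first exact: cvgE.
  exact: integrable_fin_num improper_integrable.
apply/cvgrPdist_le => e e0; move/cvgrPdist_le : h => /(_ e e0) [n _ /(_ n (leqnn n))].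
move=> /= hn; near=> x.
have nx : a + n%:R <= x by near: x; apply: nbhs_pinfty_ge; rewrite num_real.
have an : a <= a + n%:R by rewrite lerDl.
have ax := le_trans an nx.
rewrite ger0_norm ?subr_ge0 ?primitive_le_improper//.
apply: (le_trans _ (le_trans (ler_norm _) hn)); rewrite lerD2l lerN2.
by apply: primitive_homo => //; rewrite in_itv/= andbT.
Unshelve. all: by end_near. Qed.

End improper.
End primitive.

Section riemann_sum.
Variable R : realType.
Local Notation mu := (@lebesgue_measure R).
Variable h : R -> R.
Hypothesis ch : forall x, 0 <= x -> {for x, continuous h}.
Hypothesis h0 : forall x, 0 <= x -> 0 <= h x.
Hypothesis hn : {in `[0, +oo[ &, {homo h : x y /~ x <= y}}.

(** For a nonincreasing [h] the integral lies between the right and the left sums, whose difference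
    telescopes to [h 0 - h (N/n)]. The bound involves neither [n] nor [N], which lets [N] be chosen
    without control. *)
Lemma riemann_sum_dist (n N : nat) : (0 < n)%N ->
  `|\sum_(j < N) h (j%:R / n%:R) - n%:R * primitive h 0 (N%:R / n%:R)| <= h 0.
Proof.
move=> n0; have n0' : 0 < n%:R :> R by rewrite ltr0n.
have jn j : (0 : R) <= j%:R / n%:R by rewrite divr_ge0.
have jn1 j : (j%:R / n%:R : R) <= j.+1%:R / n%:R by rewrite ler_pM2r ?invr_gt0// ler_nat.
have dj j : (j.+1%:R / n%:R - j%:R / n%:R : R) = n%:R^-1.
  by rewrite -mulrBl -natrB// subSnn mul1r.
have up : n%:R * primitive h 0 (N%:R / n%:R) <= \sum_(j < N) h (j%:R / n%:R).
  elim: N => [|N ih]; first by rewrite mul0r primitive_left mulr0 big_ord0.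
  rewrite big_ord_recr/= -lerBlDl; apply: (le_trans (lerB (lexx _) ih)).
  rewrite -mulrBr mulrC -ler_pdivlMr//.
  rewrite -[X in _ <= _ * X](dj N); apply: primitiveB_le => //; first by rewrite jn jn1.
  move=> x; rewrite in_itv/= => /andP[Nx _]; apply: hn; last exact: ltW.
    by rewrite in_itv/= andbT (le_trans (jn N))// ltW.
  by rewrite in_itv/= andbT.
have lo : \sum_(j < N) h (j.+1%:R / n%:R) <= n%:R * primitive h 0 (N%:R / n%:R).
  elim: N {up} => [|N ih]; first by rewrite mul0r primitive_left mulr0 big_ord0.
  rewrite big_ord_recr/= -lerBrDl; apply: (le_trans _ (lerB (lexx _) ih)).
  rewrite -mulrBr [leRHS]mulrC -ler_pdivrMr//.
  rewrite -[X in _ * X <= _](dj N); apply: primitiveB_ge => //; first by rewrite jn jn1.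
  move=> x; rewrite in_itv/= => /andP[Nx xN]; apply: hn; last exact: ltW.
    by rewrite in_itv/= andbT.
  by rewrite in_itv/= andbT (le_trans (jn N))// ltW.
have e : \sum_(j < N) h (j%:R / n%:R) - \sum_(j < N) h (j.+1%:R / n%:R) =
    h 0 - h (N%:R / n%:R).
  elim: N {up lo} => [|N ih]; first by rewrite !big_ord0 mul0r !subrr.
  by rewrite !big_ord_recr/=; lra.
rewrite ger0_norm ?subr_ge0//.
have := h0 (jn N); lra.
Qed.

End riemann_sum.

Section positive_power.
Variable R : realType.
Implicit Types (a x y : R).

(* Unlike [x `^ a], which is 1 for negative [x], this extension of the power
   function is continuous on the whole line. *)
Definition ppow a x : R := if 0 < x then x `^ a else 0.

Lemma ppowE a x : 0 < x -> ppow a x = x `^ a.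
Proof. by rewrite /ppow => ->. Qed.

Lemma ppow_ge0E a x : a != 0 -> 0 <= x -> ppow a x = x `^ a.
Proof.
move=> a0; rewrite le_eqVlt => /predU1P[<-|]; last exact: ppowE.
by rewrite /ppow ltxx powR0.
Qed.

Lemma ppow_ge0 a x : 0 <= ppow a x.
Proof. by rewrite /ppow; case: ifP => // _; exact: powR_ge0. Qed.

Lemma ppow_homo a : 0 <= a -> {homo ppow a : x y / x <= y}.
Proof.
move=> a0 x y xy; rewrite /ppow; case: ifP => [x0|_]; last first.
  by case: ifP => // _; exact: powR_ge0.
have y0 := lt_le_trans x0 xy; rewrite y0.
by apply: ge0_ler_powR => //; rewrite nnegrE ltW.
Qed.

Lemma is_derive_ppow a x : 0 < x -> is_derive x 1 (ppow a) (a * x `^ (a - 1)).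
Proof.
move=> x0; have := is_derive1_powR a x0.
apply: (@near_eq_is_derive _ _ _ (fun y => y `^ a) (ppow a)).
by near=> y; rewrite ppowE//; near: y; exact: lt_nbhsr.
Unshelve. all: by end_near. Qed.

Lemma powR_continuous a x : 0 < x -> {for x, continuous (fun y => y `^ a)}.
Proof.
move=> x0; have [h _] := is_derive1_powR a x0.
exact/differentiable_continuous/derivable1_diffP.
Qed.

Lemma ppow_continuous a : 0 < a -> continuous (ppow a).
Proof.
move=> a0 x; have [x0|x0|->] := ltgtP x 0; last first.
- have p0 : ppow a 0 = 0 by rewrite /ppow ltxx.
  apply/cvgrPdist_le => e e0; have d0 : 0 < e `^ a^-1 by rewrite powR_gt0.
  near=> y; rewrite p0 sub0r normrN ger0_norm ?ppow_ge0//.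
  apply: (@le_trans _ _ (ppow a (e `^ a^-1))).
    apply: ppow_homo; first exact: ltW.
    by apply: ltW; near: y; exact: lt_nbhsl.
  by rewrite ppowE// -powRrM mulVf ?lt0r_neq0// powRr1// ltW.
- have [h _] := is_derive_ppow a x0.
  exact/differentiable_continuous/derivable1_diffP.
- apply: (@near_cst_continuous _ _ 0); near=> y.
  rewrite /ppow ifF//; apply/negbTE; rewrite -leNgt ltW//.
  by near: y; exact: lt_nbhsl.
Unshelve. all: by end_near. Qed.

End positive_power.

Section phi.
Variables (R : realType) (alpha : R).
Hypothesis alpha_gt1 : 1 < alpha.
Local Notation mu := (@lebesgue_measure R).
Let alpha0 : 0 < alpha. Proof. by rewrite (lt_trans _ alpha_gt1). Qed.

(* The limiting tilted probability of the index [j = x n]. *)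
Definition phi (A x : R) : R := A / (A + ppow alpha x).

Section fixed.
Variable A : R.
Hypothesis A0 : 0 < A.

Let den x : 0 < A + ppow alpha x.
Proof. by rewrite (lt_le_trans A0)// lerDl ppow_ge0. Qed.

Lemma phi_gt0 x : 0 < phi A x.
Proof. by rewrite divr_gt0. Qed.

Lemma phi_le1 x : phi A x <= 1.
Proof. by rewrite ler_pdivrMr// mul1r lerDl ppow_ge0. Qed.

Lemma phi_continuous : continuous (phi A).
Proof.
move=> x; apply: cvgM; first exact: cvg_cst.
apply: cvgV; first by rewrite lt0r_neq0.
by apply: cvgD; [exact: cvg_cst|exact: ppow_continuous].
Qed.

Lemma phi_homo : {homo phi A : x y /~ x <= y}.
Proof.
move=> x y xy; rewrite /phi ler_wpM2l ?(ltW A0)// lef_pV2 ?posrE//.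
by rewrite lerD2l ppow_homo// ltW.
Qed.

Lemma phi_lt1 x : 0 < x -> phi A x < 1.
Proof. by move=> x0; rewrite ltr_pdivrMr// mul1r ltrDl ppowE// powR_gt0. Qed.

Let cphi x : 0 <= x -> {for x, continuous (phi A)}.
Proof. by move=> _; exact: phi_continuous. Qed.

(** [phi] is at most [1] on [[0, 1]] and at most [A x^-alpha] beyond, whose integral over [[1, +oo[]
    is [A / (alpha - 1)]. *)
Lemma primitive_phi_le x : 0 <= x -> primitive (phi A) 0 x <= 1 + A / (alpha - 1).
Proof.
have a1 : 0 < alpha - 1 by rewrite subr_gt0.
have h1 x0 : 0 <= x0 -> primitive (phi A) 0 x0 <= x0.
  move=> x00; have := @primitiveB_le R (phi A) 0 cphi 0 x0 1.
  rewrite primitive_left !subr0 mul1r lexx x00; apply => // z _; exact: phi_le1.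
move=> x0; have [x1|/ltW x1] := leP x 1.
  rewrite (le_trans (h1 _ x0))// (le_trans x1)// lerDl divr_ge0// ltW//.
suff : primitive (phi A) 0 x - primitive (phi A) 0 1 <=
    - (A / (alpha - 1)) * x `^ (1 - alpha) - - (A / (alpha - 1)) * 1 `^ (1 - alpha).
  have := h1 1 ler01; have : 0 <= A / (alpha - 1) * x `^ (1 - alpha).
    by rewrite mulr_ge0 ?powR_ge0// divr_ge0// ltW.
  rewrite powR1; lra.
apply: (@ler_deriv R (primitive (phi A) 0)
  (fun x => - (A / (alpha - 1)) * x `^ (1 - alpha)) (phi A)
  (fun x => A * x `^ (- alpha)) 1 x x1).
- move=> z; rewrite in_itv/= => /andP[z1 _]; apply: is_derive_primitive => //.
  exact: lt_trans z1.
- move=> z; rewrite in_itv/= => /andP[z1 _].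
  have z0 : 0 < z by exact: lt_trans z1.
  have := is_derive1_powR (1 - alpha) z0 => h.
  apply: is_derive_eq; rewrite /GRing.scale/= (_ : 1 - alpha - 1 = - alpha); last by ring.
  by field; rewrite lt0r_neq0.
- by apply: primitive_continuous.
- apply: continuous_in_subspaceT => z; rewrite inE/= in_itv/= => /andP[z1 _].
  have z0 : 0 < z by exact: lt_le_trans z1.
  by apply: cvgMr; exact: powR_continuous.
- move=> z; rewrite in_itv/= => /andP[z1 _].
  have z0 : 0 < z by exact: lt_trans z1.
  rewrite /phi ppowE// powRN ler_wpM2l ?(ltW A0)// lef_pV2 ?posrE ?powR_gt0//.
    by rewrite lerDr ltW.
  by rewrite addr_gt0// powR_gt0.
Qed.

Lemma primitive_phi_lipschitz u v : 0 <= u -> u <= v ->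
  0 <= primitive (phi A) 0 v - primitive (phi A) 0 u <= v - u.
Proof.
move=> u0 uv; apply/andP; split.
  rewrite -[leLHS](mul0r (v - u)); apply: primitiveB_ge => //; first by rewrite u0.
  by move=> x _; rewrite ltW// phi_gt0.
rewrite -[leRHS]mul1r; apply: primitiveB_le => //; first by rewrite u0.
by move=> x _; exact: phi_le1.
Qed.

Lemma phi_integrable : mu.-integrable `[0, +oo[ (EFin \o phi A).
Proof.
apply: improper_integrable => //; last exact: primitive_phi_le.
by move=> x _; rewrite ltW// phi_gt0.
Qed.

Lemma primitive_phi_cvg :
  primitive (phi A) 0 x @[x --> +oo] --> \int[mu]_(t in `[0, +oo[) phi A t.
Proof.
apply: primitive_cvg => //; last exact: primitive_phi_le.
by move=> x _; rewrite ltW// phi_gt0.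
Qed.

Lemma primitive_phi_le_int x : 0 <= x ->
  primitive (phi A) 0 x <= \int[mu]_(t in `[0, +oo[) phi A t.
Proof.
apply: primitive_le_improper => //; last exact: primitive_phi_le.
by move=> z _; rewrite ltW// phi_gt0.
Qed.

Lemma integral_phi_gt0 : 0 < \int[mu]_(t in `[0, +oo[) phi A t.
Proof.
apply: (lt_le_trans _ (primitive_phi_le_int ler01)).
apply: (@lt_le_trans _ _ (phi A 1)); first exact: phi_gt0.
have := @primitiveB_ge R (phi A) 0 cphi 0 1 (phi A 1).
rewrite primitive_left !subr0 mulr1; apply; first by rewrite lexx ler01.
by move=> x; rewrite in_itv/= => /andP[_ x1]; apply: phi_homo; exact: ltW.
Qed.

End fixed.

(** The change of variables [x = b z], under which [phi] of parameter [b^alpha] becomes [phi] of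
    parameter [1]. Both sides have the same derivative and vanish at [0]; equality follows from two
    opposite comparisons by [ler_deriv]. *)
Lemma primitive_phi_scale (b x : R) : 0 < b -> 0 <= x ->
  primitive (phi (b `^ alpha)) 0 (b * x) = b * primitive (phi 1) 0 x.
Proof.
move=> b0 x0; have A0 : 0 < b `^ alpha by rewrite powR_gt0.
set A := b `^ alpha in A0 *.
have E z : 0 < z -> phi A (b * z) = phi 1 z.
  move=> z0; rewrite /phi !ppowE ?mulr_gt0// powRM ?ltW// -/A; field.
  have : 0 < 1 + z `^ alpha by rewrite addr_gt0// powR_gt0.
  by move=> h; rewrite !lt0r_neq0// -{1}(mulr1 A) -mulrDr mulr_gt0.
have D1 z : z \in `]0, x[ -> is_derive z 1
    (fun x => primitive (phi A) 0 (b * x)) (b * phi 1 z).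
  rewrite in_itv/= => /andP[z0 _].
  have h : is_derive (b * z) 1 (primitive (phi A) 0) (phi A (b * z)).
    apply: is_derive_primitive; last by rewrite mulr_gt0.
    by move=> u _; exact: phi_continuous.
  have h2 : is_derive z 1 (fun x => b * x) b.
    by apply: is_derive_eq; rewrite /GRing.scale/= mulr1.
  have := @is_derive1_comp _ (primitive (phi A) 0) (fun x => b * x) z _ _ h h2.
  by rewrite E// mulrC.
have D2 z : z \in `]0, x[ -> is_derive z 1
    (fun x => b * primitive (phi 1) 0 x) (b * phi 1 z).
  rewrite in_itv/= => /andP[z0 _].
  have h : is_derive z 1 (primitive (phi 1) 0) (phi 1 z).
    by apply: is_derive_primitive => // u _; exact: phi_continuous.
  by apply: is_derive_eq.
(* The Lipschitz bound provides continuity within the closed interval, including the endpoint [0],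
   where no two-sided derivative is at hand. *)
have lip z y : 0 <= z -> 0 <= y ->
    `|primitive (phi A) 0 (b * z) - primitive (phi A) 0 (b * y)| <= b * `|z - y|.
  have bz u : 0 <= u -> 0 <= b * u by move=> u0; rewrite mulr_ge0// ltW.
  wlog zy : z y / z <= y => [hw z0 y0|z0 y0].
    have [zy|/ltW yz] := leP z y; first exact: hw.
    by rewrite distrC (distrC z); exact: hw.
  have bzy : b * z <= b * y by rewrite ler_pM2l.
  have /andP[h1 h2] := primitive_phi_lipschitz A0 (bz _ z0) bzy.
  by rewrite distrC (ger0_norm h1) distrC ger0_norm ?subr_ge0// mulrBr.
have C1 : {within `[0, x], continuous (fun x => primitive (phi A) 0 (b * x))}.
  apply/subspace_continuousP => z /=; rewrite in_itv/= => /andP[z0 _].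
  apply/cvgrPdist_le => e e0; rewrite near_withinE; near=> y => /=.
  rewrite in_itv/= => /andP[y0 _].
  apply: (@le_trans _ _ (b * `|z - y|)).
    exact: lip.
  rewrite mulrC -ler_pdivlMr//; near: y.
  by apply: (cvgrPdist_le _ _).1; [exact: cvg_id|rewrite divr_gt0].
have C2 : {within `[0, x], continuous (fun x => b * primitive (phi 1) 0 x)}.
  move=> z; apply: cvgMr.
  have := @primitive_continuous R (phi 1) 0 _ 0 x (lexx 0); apply.
  by move=> u _; exact: phi_continuous.
apply/eqP; rewrite eq_le; apply/andP; split.
  have := ler_deriv x0 D1 D2 C1 C2; rewrite mulr0 !primitive_left mulr0 !subr0.
  by apply => z _.
have := ler_deriv x0 D2 D1 C2 C1; rewrite mulr0 !primitive_left mulr0 !subr0.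
by apply => z _.
Unshelve. all: by end_near. Qed.

Lemma integral_phi_scale (b : R) : 0 < b ->
  \int[mu]_(t in `[0, +oo[) phi (b `^ alpha) t =
  b * \int[mu]_(t in `[0, +oo[) phi 1 t.
Proof.
move=> b0; have A0 : 0 < b `^ alpha by rewrite powR_gt0.
have h1 := primitive_phi_cvg A0.
have {h1} h1 : primitive (phi (b `^ alpha)) 0 (b * n%:R) @[n --> \oo] -->
    \int[mu]_(t in `[0, +oo[) phi (b `^ alpha) t.
  apply: (cvg_comp _ _ _ h1); apply/cvgryPge => M.
  near=> n; rewrite mulrC -ler_pdivrMr//; near: n; exact: nbhs_infty_ger.
have h2 := @primitive_phi_cvg 1 ltr01.
have {}h2 : b * primitive (phi 1) 0 n%:R @[n --> \oo] -->
    b * \int[mu]_(t in `[0, +oo[) phi 1 t.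
  apply: cvgMr; apply: (cvg_comp _ _ _ h2); apply/cvgryPge => M.
  near=> n; near: n; exact: nbhs_infty_ger.
have E : (fun n => b * primitive (phi 1) 0 n%:R) =
    (fun n => primitive (phi (b `^ alpha)) 0 (b * n%:R)).
  by apply/funext => n; rewrite primitive_phi_scale.
by rewrite E in h2; exact: (cvg_unique _ h1 h2).
Unshelve. all: by end_near. Qed.

Lemma is_rstar_phi (c r : R) : 0 < c -> is_rstar c alpha r <->
  0 < r /\ \int[mu]_(t in `[0, +oo[) phi (c * r) t = 1.
Proof.
move=> c0; rewrite /is_rstar.
suff -> : \int[mu]_(x in `[0, +oo[) (c * r / (c * r + x `^ alpha)) =
   \int[mu]_(t in `[0, +oo[) phi (c * r) t by [].
apply: eq_Rintegral => x; rewrite inE/= in_itv/= andbT => x0.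
by rewrite /phi ppow_ge0E// lt0r_neq0.
Qed.

Lemma exists_rstar (c : R) : 0 < c -> exists r, is_rstar c alpha r.
Proof.
move=> c0; set K := \int[mu]_(t in `[0, +oo[) phi 1 t.
have K0 : 0 < K by exact: integral_phi_gt0.
(* By scaling, the integral for [c r = b^alpha] is [b K], so [b = K^-1] makes it [1]. *)
exists (K^-1 `^ alpha / c); apply/is_rstar_phi => //; split.
  by rewrite divr_gt0// powR_gt0// invr_gt0.
rewrite [c * _]mulrC divfK ?lt0r_neq0// integral_phi_scale ?invr_gt0//.
by rewrite -/K mulVf// lt0r_neq0.
Qed.

End phi.

Section eta.
Variables (R : realType) (alpha : R).
Hypothesis alpha_gt1 : 1 < alpha.
Local Notation mu := (@lebesgue_measure R).
Let alpha0 : 0 < alpha. Proof. by rewrite (lt_trans _ alpha_gt1). Qed.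
Variables (A : R).
Hypothesis A0 : 0 < A.
Local Notation phi := (phi alpha).
Let phi2 x := phi A x ^+ 2.
(** The limiting variance [phi (1 - phi)] of a tilted variable. It need not be monotone, so Riemann
    sums are taken for [phi] and [phi^2] separately, both being nonincreasing on the half-line. *)
Let psi x := phi A x - phi A x ^+ 2.

Let phi_ge0 x : 0 <= phi A x. Proof. by rewrite ltW// phi_gt0. Qed.

Let cphi2 : continuous phi2.
Proof.
move=> x; apply: (@continuous_comp _ _ _ (phi A) (fun y => y ^+ 2)).
  exact: phi_continuous.
exact: exprn_continuous.
Qed.

Let cpsi : continuous psi.
Proof. by move=> x; apply: cvgB; [exact: phi_continuous|exact: cphi2]. Qed.

Let phi2_le x : phi2 x <= phi A x.
Proof. by rewrite /phi2 expr2 ler_piMl// phi_le1. Qed.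

Let psi_ge0 x : 0 <= psi x. Proof. by rewrite subr_ge0; exact: phi2_le. Qed.

Let psi_le x : psi x <= phi A x.
Proof. by rewrite lerBlDr lerDl sqr_ge0. Qed.

Let primitive_le (f g : R -> R) : continuous f -> continuous g -> (forall x, f x <= g x) ->
  forall x, 0 <= x -> primitive f 0 x <= primitive g 0 x.
Proof.
move=> cf cg fg x x0; rewrite /primitive; apply: le_Rintegral => //.
- by apply: integrable_segment => z _; exact: cf.
- by apply: integrable_segment => z _; exact: cg.
Qed.

Let primitive_bound (f : R -> R) : continuous f -> (forall x, f x <= phi A x) ->
  forall x, 0 <= x -> primitive f 0 x <= 1 + A / (alpha - 1).
Proof.
move=> cf fphi x x0; apply: (@le_trans _ _ (primitive (phi A) 0 x)).
  by apply: primitive_le => //; exact: phi_continuous.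
exact: primitive_phi_le.
Qed.

Lemma phi2_integrable : mu.-integrable `[0, +oo[ (EFin \o phi2).
Proof.
apply: (@improper_integrable _ _ _ _ (1 + A / (alpha - 1))) => x x0.
- exact: cphi2.
- exact: sqr_ge0.
- exact: primitive_bound.
Qed.

Lemma primitive_phi2_cvg :
  primitive phi2 0 x @[x --> +oo] --> \int[mu]_(t in `[0, +oo[) phi2 t.
Proof.
apply: (@primitive_cvg _ _ _ _ (1 + A / (alpha - 1))) => x x0.
- exact: cphi2.
- exact: sqr_ge0.
- exact: primitive_bound.
Qed.

Lemma integral_psi : \int[mu]_(t in `[0, +oo[) psi t =
  \int[mu]_(t in `[0, +oo[) phi A t - \int[mu]_(t in `[0, +oo[) phi2 t.
Proof.
apply: RintegralB => //; first exact: phi_integrable.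
exact: phi2_integrable.
Qed.

Lemma integral_psi_gt0 : 0 < \int[mu]_(t in `[0, +oo[) psi t.
Proof.
have c x : 0 <= x -> {for x, continuous psi} by move=> _; exact: cpsi.
have p1 := phi_lt1 alpha A0 (@ltr01 R); have p2 := @phi_gt0 R alpha A A0 2.
have m0 : 0 < phi A 2 * (1 - phi A 1) by rewrite mulr_gt0// subr_gt0.
have h : phi A 2 * (1 - phi A 1) <= primitive psi 0 2 - primitive psi 0 1.
  have := @primitiveB_ge _ psi 0 c 1 2 (phi A 2 * (1 - phi A 1)).
  rewrite (_ : 2 - 1 = 1 :> R); last by ring.
  rewrite mulr1; apply; first by rewrite ler01 ler1n.
  move=> x; rewrite in_itv/= => /andP[x1 x2].
  have h1 : phi A 2 <= phi A x by apply: phi_homo => //; exact: ltW.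
  have h2 : phi A x <= phi A 1 by apply: phi_homo => //; exact: ltW.
  rewrite (_ : psi x = phi A x * (1 - phi A x)); last by rewrite /psi; ring.
  by apply: ler_pM => //; lra.
have h1 : 0 <= primitive psi 0 1.
  have := @primitiveB_ge _ psi 0 c 0 1 0.
  by rewrite primitive_left mul0r subr0 lexx ler01; apply.
have : primitive psi 0 2 <= \int[mu]_(t in `[0, +oo[) psi t.
  apply: (@primitive_le_improper _ _ _ _ (1 + A / (alpha - 1))) => // x x0.
  exact: primitive_bound.
lra.
Qed.

Lemma riemann_sum_phi n N : (0 < n)%N ->
  `|\sum_(j < N) phi A (j%:R / n%:R) - n%:R * primitive (phi A) 0 (N%:R / n%:R)| <= 1.
Proof.
move=> n0; apply: (le_trans _ (phi_le1 alpha A0 0)); apply: riemann_sum_dist => //.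
- by move=> x _; exact: phi_continuous.
- by move=> x y _ _; exact: phi_homo.
Qed.

Lemma riemann_sum_phi2 n N : (0 < n)%N ->
  `|\sum_(j < N) phi A (j%:R / n%:R) ^+ 2 - n%:R * primitive phi2 0 (N%:R / n%:R)| <= 1.
Proof.
move=> n0; apply: (@le_trans _ _ (phi2 0)).
  apply: (@riemann_sum_dist R phi2) => //.
  - by move=> x _; exact: cphi2.
  - by move=> x _; exact: sqr_ge0.
  - move=> x y _ _ xy; rewrite /phi2 ler_sqr ?nnegrE//; exact: phi_homo.
by rewrite (le_trans (phi2_le 0))// phi_le1.
Qed.

Lemma eta_starE c r : c * r = A ->
  eta_star c alpha r = \int[mu]_(t in `[0, +oo[) psi t.
Proof.
move=> crA; apply: eq_Rintegral => x; rewrite inE/= in_itv/= andbT => x0.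
rewrite crA /psi /phi ppow_ge0E ?lt0r_neq0//.
have : A + x `^ alpha != 0 by rewrite lt0r_neq0// ltr_wpDr// powR_ge0.
by move=> h; field.
Qed.

End eta.

Lemma sum_ltn_le (R : realType) (m J : nat) :
  \sum_(0 <= j < m) ((j < J)%:R : R) <= J%:R.
Proof.
rewrite -natr_sum ler_nat; elim: m J => [|m ih] J; first by rewrite big_geq.
rewrite big_nat_recl//; case: J => [|J]; first by rewrite big1.
by rewrite add1n ltnS ih.
Qed.

Section tilt_estimate.
Variables (R : realType) (alpha c r : R) (p : nat -> R).
Hypotheses (alpha_gt1 : 1 < alpha) (c0 : 0 < c) (r0 : 0 < r).
Hypothesis p01 : forall j, 0 <= p j <= 1.
Variables (C : R) (J : nat).
Hypotheses (C0 : 0 <= C) (J0 : (0 < J)%N).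
Hypothesis pC : forall j, (J <= j)%N ->
  `|p j - c * j%:R `^ (- alpha)| <= C / j%:R * (c * j%:R `^ (- alpha)).
Local Notation phi := (phi alpha).
Let alpha0 : 0 < alpha. Proof. by rewrite (lt_trans _ alpha_gt1). Qed.

Lemma p_summable : cvgn (series p).
Proof.
have p0 j : 0 <= p j by have /andP[] := p01 j.
apply: nondecreasing_is_cvgn.
  by apply/nondecreasing_seqP => n; rewrite /series/= big_nat_recr//= lerDl.
pose M := 1 + (1 + 1 / (alpha - 1) : R).
exists (J%:R + (1 + C) * (2 * c) * M) => _ [n _ <-].
(* The sum is compared with a Riemann sum of [phi 1] of mesh [1]: for [j >= 1], [j^alpha >= 1] gives
   [j^-alpha <= 2 phi 1 j], and the finitely many [j < J] contribute at most [1] each. *)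
have h : series p n <= \sum_(0 <= j < n) ((j < J)%:R + (1 + C) * (2 * c) * phi 1 (j%:R / 1%:R)).
  rewrite /series/=; apply: ler_sum => j _; have [jJ|Jj] := ltnP j J.
    rewrite (@le_trans _ _ 1)//; first by have /andP[] := p01 j.
    rewrite lerDl mulr_ge0//; last by rewrite ltW// phi_gt0.
    by rewrite !mulr_ge0 ?addr_ge0// ltW.
  have j0 : 0 < j%:R :> R by rewrite ltr0n (leq_trans J0).
  have j1 : 1 <= j%:R :> R by rewrite ler1n (leq_trans J0).
  rewrite add0r divr1; have := ler_distlDr (pC Jj) => /le_trans; apply.
  have ja : 1 <= j%:R `^ alpha by have := ler_powR j1 (ltW alpha0); rewrite powRr0.
  have h1 : j%:R `^ (- alpha) <= 2 * phi 1 j%:R.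
    rewrite /phi ppowE// powRN mul1r -{1}(mul1r _^-1) ler_pdivrMr; last lra.
    rewrite mulrAC ler_pdivlMr; lra.
  have h2 : C / j%:R <= C by rewrite ler_pdivrMr// ler_peMr.
  have h3 : 0 <= c * j%:R `^ (- alpha) by rewrite mulr_ge0 ?powR_ge0// ltW.
  rewrite -{1}[c * _]mul1r -mulrDl -!mulrA.
  by apply: ler_pM => //; [rewrite addr_ge0// divr_ge0|rewrite lerD2l|rewrite mulrCA ler_pM2l].
apply: (le_trans h); rewrite big_split/= lerD//.
  exact: sum_ltn_le.
rewrite -mulr_sumr ler_wpM2l//; first by rewrite !mulr_ge0 ?addr_ge0// ltW.
have := riemann_sum_phi alpha_gt1 (@ltr01 R) n (ltn0Sn 0).
rewrite mul1r divr1 big_mkord => h2.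
have := primitive_phi_le alpha_gt1 (@ltr01 R) (ler0n R n).
have := ler_normlW h2; rewrite /M; lra.
Qed.

Let y n := r * n%:R `^ alpha.

(** With the exact power [p' = c j^-alpha], [phi (j/n)] equals [p' y / (1 + p' y)]. Two errors
    remain: having [y - 1] instead of [y] in the denominator costs at most [p j], and the relative
    error [C / j] of [p j] is passed on to the quotient. *)
Lemma tilt_phi_dist n j : (0 < n)%N -> 1 <= y n -> (J <= j)%N ->
  `|tilt (y n) p j - phi (c * r) (j%:R / n%:R)| <=
  p j + C / j%:R * phi (c * r) (j%:R / n%:R).
Proof.
move=> n0 y1 Jj; have /andP[p0 p1] := p01 j.
have yn0 : 0 < y n by lra.
have j0 : 0 < j%:R :> R by rewrite ltr0n (leq_trans J0).
have n0' : 0 < n%:R :> R by rewrite ltr0n.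
set p' := c * j%:R `^ (- alpha).
have p'0 : 0 < p' by rewrite mulr_gt0// powR_gt0.
have phiE : phi (c * r) (j%:R / n%:R) = p' * y n / (1 + p' * y n).
  rewrite /phi ppowE ?divr_gt0// powRM ?ltW ?invr_gt0//.
  have -> : n%:R^-1 `^ alpha = (n%:R `^ alpha)^-1.
    by rewrite -powR_inv1 ?ltW// -powRrM mulN1r powRN.
  rewrite /p' !powRN /y.
  have h1 : 0 < j%:R `^ alpha by exact: powR_gt0.
  have h2 : 0 < n%:R `^ alpha by exact: powR_gt0.
  by field; rewrite !lt0r_neq0 ?addr_gt0 ?mulr_gt0.
have d1 : 0 < 1 + p j * y n by rewrite ltr_wpDr// mulr_ge0// ltW.
have d2 : 0 < 1 + p' * y n by rewrite ltr_wpDr// mulr_ge0// ltW.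
have d3 := tilt_denom_gt0 p01 yn0 j.
rewrite phiE.
have -> : tilt (y n) p j - p' * y n / (1 + p' * y n) =
    p j * (p j * y n / (1 + p j * y n)) / (1 + p j * (y n - 1)) +
    (p j - p') * (y n / (1 + p' * y n)) / (1 + p j * y n).
  by rewrite /tilt; field; rewrite !lt0r_neq0.
apply: (le_trans (ler_normD _ _)); apply: lerD.
  have s0 : 0 <= p j * y n by rewrite mulr_ge0// ltW.
  rewrite ger0_norm; last first.
    by apply: divr_ge0; [apply: mulr_ge0 => //; apply: divr_ge0 => //|]; exact: ltW.
  rewrite -mulrA ler_piMr// ler_pdivrMr// mul1r.
  apply: (@le_trans _ _ 1).
    by rewrite ler_pdivrMr// mul1r; lra.
  by rewrite lerDl mulr_ge0// subr_ge0.
rewrite normrM normfV (gtr0_norm d1) ler_pdivrMr// normrM.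
rewrite (@gtr0_norm _ (y n / _)) ?divr_gt0//.
apply: (@le_trans _ _ (C / j%:R * p' * (y n / (1 + p' * y n)))).
  by rewrite ler_wpM2r ?pC// divr_ge0// ltW.
rewrite (_ : C / j%:R * p' * _ = C / j%:R * (p' * y n / (1 + p' * y n))); last first.
  by rewrite !mulrA.
apply: ler_peMr; last by rewrite lerDl mulr_ge0// ltW.
apply: mulr_ge0; first by rewrite divr_ge0// ltW.
by apply: divr_ge0; [apply: mulr_ge0|]; exact: ltW.
Qed.

Hypothesis int1 : \int[@lebesgue_measure R]_(t in `[0, +oo[) phi (c * r) t = 1.

Let cr0 : 0 < c * r. Proof. by rewrite mulr_gt0. Qed.

Lemma sum_phi_le n N : (0 < n)%N ->
  \sum_(j < N) phi (c * r) (j%:R / n%:R) <= n%:R + 1.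
Proof.
move=> n0; have /ler_normlW h := riemann_sum_phi alpha_gt1 cr0 N n0.
have n0' : 0 < n%:R :> R by rewrite ltr0n.
have := @primitive_phi_le_int R alpha alpha_gt1 _ cr0 (N%:R / n%:R) (divr_ge0 (ler0n _ _) (ltW n0')).
rewrite int1 => h2.
have : n%:R * primitive (phi (c * r)) 0 (N%:R / n%:R) <= n%:R * 1 by rewrite ler_pM2l.
lra.
Qed.

Lemma sum_inv_le_ln n : (0 < n)%N -> \sum_(1 <= j < n.+1) (j%:R^-1 : R) <= 1 + ln n%:R.
Proof.
elim: n => // n ih _; case: n ih => [_|n ih]; first by rewrite big_nat1 ln1 addr0 invr1.
rewrite big_nat_recr//=.
have n1 : 0 < n.+1%:R :> R by rewrite ltr0n.
have n2 : 0 < n.+2%:R :> R by rewrite ltr0n.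
suff : n.+2%:R^-1 <= ln n.+2%:R - ln n.+1%:R :> R.
  move: (ih isT) => h1 h2; apply: (le_trans (lerD h1 h2)).
  by rewrite -addrA (addrC (ln n.+1%:R)) subrK.
have -> : ln n.+2%:R - ln n.+1%:R = - ln (1 + - n.+2%:R^-1) :> R.
  rewrite -[LHS]opprB -ln_div ?posrE//; congr (- ln _).
  have -> : n.+1%:R = n.+2%:R - 1 :> R by rewrite -[n.+2%:R]natr1 addrK.
  by rewrite mulrBl divff ?lt0r_neq0// mul1r.
rewrite lerNr; apply: le_ln1Dx.
by rewrite ltrN2 invf_lt1// ltr1n.
Qed.

Let D n := J%:R + limn (series p) + C * (3 + ln n%:R).

Lemma sum_tilt_phi_dist n N : (0 < n < N)%N -> 1 <= y n ->
  \sum_(j < N) `|tilt (y n) p j - phi (c * r) (j%:R / n%:R)| <= D n.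
Proof.
move=> /andP[n0 nN] y1; have n0' : 0 < n%:R :> R by rewrite ltr0n.
have yn0 : 0 < y n by lra.
(* Summing [1/j] over all [j < N] would bring in [log N], which is not controlled. Beyond [n] the
   decay of [phi] is kept instead and [1/j] is bounded by [1/n]; as the [phi] values sum to at most
   [n + 1], that range costs a constant. *)
pose u j : R := if (0 < j <= n)%N then j%:R^-1 else phi (c * r) (j%:R / n%:R) / n%:R.
have u0 j : 0 <= u j.
  by rewrite /u; case: ifP => _; rewrite ?invr_ge0// divr_ge0// ltW// phi_gt0.
have h j : `|tilt (y n) p j - phi (c * r) (j%:R / n%:R)| <= ((j < J)%:R + p j) + C * u j.
  have /andP[p0 p1] := p01 j; have [jJ|Jj] := ltnP j J.
    have /andP[t0 t1] := tilt01 p01 yn0 j.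
    have f0 := ltW (phi_gt0 alpha cr0 (j%:R / n%:R)).
    have f1 := phi_le1 alpha cr0 (j%:R / n%:R).
    apply: (@le_trans _ _ 1); first by rewrite ler_norml; apply/andP; split; lra.
    by rewrite -addrA lerDl addr_ge0// mulr_ge0.
  rewrite add0r; apply: (le_trans (tilt_phi_dist n0 y1 Jj)).
  rewrite lerD2l -mulrA ler_wpM2l// /u.
  have j0 : (0 < j)%N by exact: leq_trans Jj.
  rewrite j0/=; case: leqP => jn.
    by rewrite ler_piMr ?invr_ge0// phi_le1.
  rewrite mulrC ler_wpM2l//; first by rewrite ltW// phi_gt0.
  rewrite lef_pV2 ?posrE ?ltr0n// ler_nat.
  exact: ltnW.
apply: (le_trans (ler_sum _ (fun (j : 'I_N) _ => h j))).
rewrite -(big_mkord xpredT (fun j => (j < J)%:R + p j + C * u j)).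
rewrite big_split/= big_split/= -mulr_sumr; apply: lerD; first apply: lerD.
- exact: sum_ltn_le.
- have h0 : nondecreasing_seq (series p).
    apply/nondecreasing_seqP => m; rewrite /series/= big_nat_recr//= lerDl.
    by have /andP[] := p01 m.
  exact: (nondecreasing_cvgn_le h0 p_summable N).
- rewrite ler_wpM2l//.
  rewrite (@big_cat_nat _ _ _ n.+1)//= big_ltn//= /u.
  rewrite (eq_big_nat _ _ (F2 := fun j => j%:R^-1)); last first.
    by move=> j /andP[j0 jn]; rewrite j0 -ltnS jn.
  have -> : \sum_(n.+1 <= i < N) (if (0 < i <= n)%N then i%:R^-1
      else phi (c * r) (i%:R / n%:R) / n%:R) =
      \sum_(n.+1 <= i < N) phi (c * r) (i%:R / n%:R) / n%:R.
    apply: eq_big_nat; by move=> j /andP[nj _]; rewrite (leqNgt j n) nj andbF.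
  have := sum_inv_le_ln n0; have := sum_phi_le N n0.
  rewrite -(big_mkord xpredT (fun j => phi (c * r) (j%:R / n%:R))).
  rewrite (@big_cat_nat _ _ _ n.+1)//= big_ltn//= -mulr_suml.
  set S0 := phi _ _; set S1 := \sum_(1 <= i < n.+1) _; set S2 := \sum_(n.+1 <= i < N) _.
  move=> h1 h2; have S10 : 0 <= S1 by apply: sumr_ge0 => j _; rewrite ltW// phi_gt0.
  have : (S0 + S2) / n%:R <= 2.
    rewrite ler_pdivrMr//; have : 1 <= n%:R :> R by rewrite ler1n.
    lra.
  rewrite mulrDl; lra.
Qed.

(** The limiting mean is [n] because [phi] has integral [1]. The constant [2] is one unit for the
    Riemann sum and one for the truncated integral; [D n] is [O(log n)], hence [o(sqrt n)]. *)
Lemma tilt_mean_dist n N : (0 < n < N)%N -> 1 <= y n ->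
  1 - primitive (phi (c * r)) 0 (N%:R / n%:R) <= n%:R^-1 ->
  `|bern_mean N (tilt (y n) p) - n%:R| <= 2 + D n.
Proof.
move=> /[dup] /andP[n0 _] nN y1 h; have n0' : 0 < n%:R :> R by rewrite ltr0n.
have h1 := sum_tilt_phi_dist nN y1.
have h2 := riemann_sum_phi alpha_gt1 cr0 N n0.
have h3 := @primitive_phi_le_int R alpha alpha_gt1 _ cr0 (N%:R / n%:R)
  (divr_ge0 (ler0n _ _) (ltW n0')).
rewrite int1 in h3.
have h4 : n%:R * (1 - primitive (phi (c * r)) 0 (N%:R / n%:R)) <= 1.
  by rewrite mulrC -ler_pdivlMr// div1r.
have h5 : 0 <= n%:R * (1 - primitive (phi (c * r)) 0 (N%:R / n%:R)).
  by rewrite mulr_ge0 ?subr_ge0// ltW.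
have h6 : `|bern_mean N (tilt (y n) p) - \sum_(j < N) phi (c * r) (j%:R / n%:R)| <= D n.
  by rewrite /bern_mean -sumrB; apply: (le_trans (ler_norm_sum _ _ _)).
move: h2 h6; rewrite !ler_norml; lra.
Qed.

Let eta := \int[@lebesgue_measure R]_(t in `[0, +oo[) (phi (c * r) t - phi (c * r) t ^+ 2).

Lemma tilt_var_dist n N : (0 < n < N)%N -> 1 <= y n ->
  1 - primitive (phi (c * r)) 0 (N%:R / n%:R) <= n%:R^-1 ->
  `|\int[@lebesgue_measure R]_(t in `[0, +oo[) (phi (c * r) t ^+ 2) -
    primitive (fun t => phi (c * r) t ^+ 2) 0 (N%:R / n%:R)| <= n%:R^-1 ->
  `|bern_var N (tilt (y n) p) - n%:R * eta| <= 4 + D n.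
Proof.
move=> /[dup] /andP[n0 _] nN y1 h h'; have n0' : 0 < n%:R :> R by rewrite ltr0n.
have yn0 : 0 < y n by lra.
have h1 := sum_tilt_phi_dist nN y1.
have h2 := riemann_sum_phi alpha_gt1 cr0 N n0.
have h2' := riemann_sum_phi2 alpha_gt1 cr0 N n0.
have h3 := @primitive_phi_le_int R alpha alpha_gt1 _ cr0 (N%:R / n%:R)
  (divr_ge0 (ler0n _ _) (ltW n0')).
rewrite int1 in h3.
rewrite /eta (integral_psi alpha_gt1 cr0) int1.
pose K := \int[@lebesgue_measure R]_(t in `[0, +oo[) (phi (c * r) t ^+ 2).
rewrite -/K in h' *.
have h4 : n%:R * (1 - primitive (phi (c * r)) 0 (N%:R / n%:R)) <= 1.
  by rewrite mulrC -ler_pdivlMr// div1r.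
have h5 : 0 <= n%:R * (1 - primitive (phi (c * r)) 0 (N%:R / n%:R)).
  by rewrite mulr_ge0 ?subr_ge0// ltW.
have h4' : `|n%:R * (K - primitive (fun t => phi (c * r) t ^+ 2) 0 (N%:R / n%:R))| <= 1.
  by rewrite normrM (gtr0_norm n0') mulrC -ler_pdivlMr// div1r.
have h6 : `|bern_var N (tilt (y n) p) - (\sum_(j < N) phi (c * r) (j%:R / n%:R) -
     \sum_(j < N) phi (c * r) (j%:R / n%:R) ^+ 2)| <= D n.
  rewrite /bern_var -!sumrB; apply: (le_trans (ler_norm_sum _ _ _)).
  apply: (le_trans _ h1); apply: ler_sum => j _.
  set t := tilt _ _ _; set f := phi _ _.
  (* As [t] and [f] lie in [[0, 1]], the second factor has modulus at most [1]: variances are no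
     further apart than means. *)
  have -> : t * (1 - t) - (f - f ^+ 2) = (t - f) * (1 - t - f) by ring.
  have /andP[t0 t1] := tilt01 p01 yn0 j.
  have f0 := ltW (phi_gt0 alpha cr0 (j%:R / n%:R)).
  have f1 := phi_le1 alpha cr0 (j%:R / n%:R).
  rewrite normrM ler_piMr// ler_norml; rewrite -/t -/f in t0 t1 f0 f1 *.
  by apply/andP; split; lra.
move: h2 h2' h4' h6; rewrite !ler_norml; lra.
Qed.

End tilt_estimate.

(** * Tail asymptotics *)

Section sequence_limits.
Variable R : realType.

Lemma natpowN_cvg0 (b : R) : 0 < b -> n%:R `^ (- b) @[n --> \oo] --> (0 : R).
Proof.
move=> b0; apply/cvgrPdist_le => e e0; near=> n.
rewrite sub0r normrN ger0_norm ?powR_ge0// powRN.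
have n0 : 0 < n%:R :> R by rewrite ltr0n; near: n; exact: nbhs_infty_gt.
have en : e `^ (- b^-1) <= n%:R by near: n; exact: nbhs_infty_ger.
rewrite -[leRHS]invrK lef_pV2 ?posrE ?powR_gt0 ?invr_gt0//.
have -> : e^-1 = (e `^ (- b^-1)) `^ b.
  by rewrite -powRrM mulNr mulVf ?lt0r_neq0// powR_inv1// ltW.
by apply: ge0_ler_powR => //; rewrite ?nnegrE ?powR_ge0// ltW.
Unshelve. all: by end_near. Qed.

Lemma sqrt_natV_cvg0 : (Num.sqrt n%:R)^-1 @[n --> \oo] --> (0 : R).
Proof.
have h := @natpowN_cvg0 2^-1 ltac:(by rewrite invr_gt0).
by under eq_fun do rewrite -powR12_sqrt// -powRN.
Qed.

Lemma ln_div_sqrt_cvg0 : ln n%:R / Num.sqrt n%:R @[n --> \oo] --> (0 : R).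
Proof.
(* The bound is [log n = 4 log (n^(1/4)) <= 4 n^(1/4)]. *)
have h : 4 * n%:R `^ (- 4^-1) @[n --> \oo] --> (4 * 0 : R).
  by apply: cvgMr; apply: natpowN_cvg0; rewrite invr_gt0.
rewrite mulr0 in h.
apply: (@squeeze_cvgr _ _ _ _ (fun=> 0) (fun n => 4 * n%:R `^ (- 4^-1))) => //; last exact: cvg_cst.
near=> n; have n0 : (0 < n)%N by near: n; exact: nbhs_infty_gt.
have n0' : 0 < n%:R :> R by rewrite ltr0n.
have s0 : 0 < Num.sqrt n%:R :> R by rewrite sqrtr_gt0.
rewrite divr_ge0 ?(ltW s0) ?ln_ge0 ?ler1n//=.
rewrite ler_pdivrMr// -powR12_sqrt ?ltW// -mulrA -powRD; last first.
  by rewrite (lt0r_neq0 n0') implybT.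
have -> : - 4^-1 + 2^-1 = 4^-1 :> R by field.
have := @ln_sublinear R (n%:R `^ 4^-1) ltac:(by rewrite powR_gt0).
rewrite ln_powR; lra.
Unshelve. all: by end_near. Qed.

End sequence_limits.

Section tail_asymptotics.
Variables (d : measure_display) (T : measurableType d) (R : realType).
Variables (P : probability T R) (I : nat -> {RV P >-> bool}) (p : nat -> R).
Hypothesis indep : mutually_independent P I.
Hypothesis pE : forall j, P [set t | I j t = true] = (p j)%:E.
Variables (c alpha r : R).
Hypotheses (c0 : 0 < c) (alpha_gt1 : 1 < alpha).
Hypothesis rstar : is_rstar c alpha r.
Variables (C : R) (J : nat).
Hypotheses (C0 : 0 <= C) (J0 : (0 < J)%N).
Hypothesis pC : forall j, (J <= j)%N ->
  `|p j - c * j%:R `^ (- alpha)| <= C / j%:R * (c * j%:R `^ (- alpha)).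
Local Notation mu := (@lebesgue_measure R).
Local Notation phi := (phi alpha).
Let alpha0 : 0 < alpha. Proof. by rewrite (lt_trans _ alpha_gt1). Qed.
Let r0 : 0 < r. Proof. by have [] := rstar. Qed.
Let cr0 : 0 < c * r. Proof. by rewrite mulr_gt0. Qed.
Let int1 : \int[mu]_(t in `[0, +oo[) phi (c * r) t = 1.
Proof. by have /(is_rstar_phi alpha_gt1 r c0)[] := rstar. Qed.
Let p01 j : 0 <= p j <= 1. Proof. exact: (prob01 pE). Qed.
Let eta := eta_star c alpha r.
Let etaE : eta = \int[mu]_(t in `[0, +oo[) (phi (c * r) t - phi (c * r) t ^+ 2).
Proof. exact: eta_starE. Qed.
Let eta0 : 0 < eta.
Proof. by rewrite etaE; exact: integral_psi_gt0. Qed.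
Let psum : cvgn (series p) := p_summable alpha_gt1 c0 p01 C0 J0 pC.

Let tail n : R := fine (P [set t | (n%:R%:E <= indicator_sum P I t)%E]).
Let y n : R := r * n%:R `^ alpha.
Let B n : R := (Num.sqrt (2 * pi * eta))^-1 * r ^- n *
  n%:R `^ (- alpha * n%:R - 2^-1) * expR (Psi p (y n)).
Let a N n : R := \sum_(n <= k < N.+1) (bern_poly N p)`_k.

Let y_gt0 n : (0 < n)%N -> 0 < y n.
Proof. by move=> n0; rewrite mulr_gt0// powR_gt0// ltr0n. Qed.

Let B_gt0 n : (0 < n)%N -> 0 < B n.
Proof.
move=> n0; rewrite /B !mulr_gt0 ?expR_gt0 ?powR_gt0 ?ltr0n ?invr_gt0 ?exprn_gt0//.
by rewrite sqrtr_gt0 !mulr_gt0// pi_gt0.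
Qed.

(** For fixed [n] each quantity converges as [N] grows, so some [N] meets all the requirements at
    once. The error on the tail is measured against [B n] itself, the asserted equivalent, because
    an absolute error would be useless for so small a probability. *)
Let truncation_index : exists N : nat -> nat, forall n, (0 < n)%N ->
  [/\ (n < N n)%N,
      1 - primitive (phi (c * r)) 0 ((N n)%:R / n%:R) <= n%:R^-1,
      `|\int[mu]_(t in `[0, +oo[) (phi (c * r) t ^+ 2) -
        primitive (fun t => phi (c * r) t ^+ 2) 0 ((N n)%:R / n%:R)| <= n%:R^-1,
      `|tail n - a (N n) n| <= B n / n%:R &
      `|Psi p (y n) - series (fun j => ln (1 + p j * (y n - 1))) (N n)| <= n%:R^-1].
Proof.
suff h n : exists N, (0 < n)%N ->
  [/\ (n < N)%N,
      1 - primitive (phi (c * r)) 0 (N%:R / n%:R) <= n%:R^-1,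
      `|\int[mu]_(t in `[0, +oo[) (phi (c * r) t ^+ 2) -
        primitive (fun t => phi (c * r) t ^+ 2) 0 (N%:R / n%:R)| <= n%:R^-1,
      `|tail n - a N n| <= B n / n%:R &
      `|Psi p (y n) - series (fun j => ln (1 + p j * (y n - 1))) N| <= n%:R^-1].
  by have [N hN] := choice h; exists N.
have [->|n0] := posnP n; first by exists 0%N.
have n0' : 0 < n%:R^-1 :> R by rewrite invr_gt0 ltr0n.
have Nn : N%:R / n%:R @[N --> \oo] --> (+oo : set_system R).
  apply/cvgryPge => M; near=> N.
  by rewrite ler_pdivlMr ?ltr0n//; near: N; exact: nbhs_infty_ger.
have h1 : primitive (phi (c * r)) 0 (N%:R / n%:R) @[N --> \oo] --> (1 : R).
  by have h := cvg_comp _ _ Nn (primitive_phi_cvg alpha_gt1 cr0); rewrite int1 in h.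
have h2 : primitive (fun t => phi (c * r) t ^+ 2) 0 (N%:R / n%:R) @[N --> \oo] -->
    \int[mu]_(t in `[0, +oo[) (phi (c * r) t ^+ 2).
  exact: cvg_comp _ _ Nn (primitive_phi2_cvg alpha_gt1 cr0).
have h3 : a N n @[N --> \oo] --> tail n.
  exact: (prob_indicator_sum_ge_cvg indep pE).
have h4 := Psi_cvg pE (y_gt0 n0) psum.
near \oo => N; exists N => _; split.
- by near: N; exact: nbhs_infty_gt.
- apply: (le_trans (ler_norm _)); near: N.
  by move/cvgrPdist_le : h1; apply.
- by near: N; move/cvgrPdist_le : h2; apply.
- near: N; move/cvgrPdist_le : h3; apply.
  by rewrite mulr_gt0// B_gt0.
- by near: N; move/cvgrPdist_le : h4; apply.
Unshelve. all: by end_near. Qed.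

Theorem tail_asymp : asymp_equiv tail B.
Proof.
have [N hN] := truncation_index.
pose q n := tilt (y n) p.
pose V n := bern_var (N n) (q n).
pose m n := bern_mean (N n) (q n).
pose b n := (bern_poly (N n) (q n))`_n.
have q01 n j : 0 <= q n j <= 1.
  (* At [n = 0] the tilting parameter [y] is [0], outside the range of [tilt01], but then every
     tilted probability is [0]. *)
  have [->|n0] := posnP n; last exact: tilt01 p01 (y_gt0 n0) j.
  by rewrite /q /tilt /y powR0 ?lt0r_neq0// mulr0 mulr0 mul0r lexx ler01.
have y_ge1 : \forall n \near \oo, 1 <= y n.
  have := @natpowN_cvg0 R alpha alpha0 => /cvgrPdist_le/(_ r r0) h; near=> n.
  have n0 : 0 < n%:R :> R by rewrite ltr0n; near: n; exact: nbhs_infty_gt.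
  have : `|0 - n%:R `^ (- alpha)| <= r by near: n; exact: h.
  rewrite sub0r normrN ger0_norm ?powR_ge0// powRN /y.
  by rewrite -[leLHS]div1r ler_pdivrMr// powR_gt0.
pose D n : R := J%:R + limn (series p) + C * (3 + ln n%:R).
have Dcvg K : (K + D n) / Num.sqrt n%:R @[n --> \oo] --> (0 : R).
  have -> : (fun n => (K + D n) / Num.sqrt n%:R) = (fun n =>
     (K + J%:R + limn (series p) + C * 3) * (Num.sqrt n%:R)^-1 +
     C * (ln n%:R / Num.sqrt n%:R)).
    by apply/funext => n; rewrite /D; ring.
  have -> : 0 = (K + J%:R + limn (series p) + C * 3) * 0 + C * 0 :> R by rewrite !mulr0 addr0.
  by apply: cvgD; apply: cvgMr; [exact: sqrt_natV_cvg0|exact: ln_div_sqrt_cvg0].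
have Vn : V n / n%:R @[n --> \oo] --> eta.
  have h : (4 + D n) / Num.sqrt n%:R * (Num.sqrt n%:R)^-1 @[n --> \oo] --> (0 * 0 : R).
    by apply: cvgM; [exact: Dcvg|exact: sqrt_natV_cvg0].
  rewrite mulr0 in h; apply/cvgrPdist_le => e e0; near=> n.
  have n0 : (0 < n)%N by near: n; exact: nbhs_infty_gt.
  have n0' : 0 < n%:R :> R by rewrite ltr0n.
  have y1 : 1 <= y n by near: n.
  have [nN h1 h2 _ _] := hN n n0.
  have nnN : (0 < n < N n)%N by rewrite n0.
  have h3 := tilt_var_dist alpha_gt1 c0 r0 p01 C0 J0 pC int1 nnN y1 h1 h2.
  rewrite -etaE -/(V n) -/(D n) in h3.
  have -> : eta - V n / n%:R = - (V n - n%:R * eta) / n%:R by field; rewrite lt0r_neq0.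
  rewrite normrM normrN normfV (gtr0_norm n0').
  apply: (@le_trans _ _ ((4 + D n) / n%:R)).
    by rewrite ler_wpM2r// invr_ge0 ltW.
  have -> : (4 + D n) / n%:R = (4 + D n) / Num.sqrt n%:R * (Num.sqrt n%:R)^-1.
    by rewrite -mulrA -invfM -expr2 sqr_sqrtr// ltW.
  by apply: (le_trans (ler_norm _)); rewrite -normrN -sub0r; near: n; move/cvgrPdist_le : h; apply.
have eta2 : 0 < eta / 2 by rewrite divr_gt0.
have V_ge : \forall n \near \oo, eta / 2 * n%:R <= V n.
  near=> n; have n0 : 0 < n%:R :> R by rewrite ltr0n; near: n; exact: nbhs_infty_gt.
  rewrite -ler_pdivlMr//; near: n; move/cvgr_ge : Vn; apply.
  by rewrite ltr_pdivrMr// ltr_pMr// ltr1n.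
have Voo : V n @[n --> \oo] --> +oo.
  apply/cvgryPge => M; near=> n.
  apply: (@le_trans _ _ (eta / 2 * n%:R)); last by near: n.
  by rewrite mulrC -ler_pdivrMr//; near: n; exact: nbhs_infty_ger.
(* This ratio lets the asymptotic variance [eta n] replace [V n], both in the normalisation of the
   mean and in the local limit. *)
have sqrt_ratio : Num.sqrt (eta * n%:R / V n) @[n --> \oo] --> (1 : R).
  have h : eta / (V n / n%:R) @[n --> \oo] --> eta / eta.
    apply: cvgM; first exact: cvg_cst.
    by apply: cvgV => //; rewrite lt0r_neq0.
  rewrite divff ?lt0r_neq0// in h.
  have {}h := cvg_comp _ _ h (@sqrt_continuous R 1).
  rewrite sqrtr1 in h; apply: cvg_trans h; apply: near_eq_cvg; apply: nearW => n /=.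
  by rewrite invfM invrK mulrA mulrAC.
have mk : (m n - n%:R) / Num.sqrt (V n) @[n --> \oo] --> (0 : R).
  have h : (2 + D n) / Num.sqrt n%:R * ((Num.sqrt eta)^-1 * Num.sqrt (eta * n%:R / V n))
      @[n --> \oo] --> (0 * ((Num.sqrt eta)^-1 * 1) : R).
    by apply: cvgM; [exact: Dcvg|apply: cvgMr; exact: sqrt_ratio].
  rewrite mul0r in h; apply/cvgrPdist_le => e e0; near=> n.
  have n0 : (0 < n)%N by near: n; exact: nbhs_infty_gt.
  have n0' : 0 < n%:R :> R by rewrite ltr0n.
  have y1 : 1 <= y n by near: n.
  have V0 : 0 < V n.
    apply: (@lt_le_trans _ _ (eta / 2 * n%:R)); last by near: n.
    by rewrite mulr_gt0.
  have [nN h1 h2 _ _] := hN n n0.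
  have nnN : (0 < n < N n)%N by rewrite n0.
  have h3 := tilt_mean_dist alpha_gt1 c0 r0 p01 C0 J0 pC int1 nnN y1 h1.
  rewrite -/(m n) -/(D n) in h3.
  have s0 : 0 < Num.sqrt (V n) by rewrite sqrtr_gt0.
  rewrite sub0r normrN normrM normfV (gtr0_norm s0).
  apply: (@le_trans _ _ ((2 + D n) / Num.sqrt (V n))).
    by rewrite ler_wpM2r// invr_ge0 ltW.
  have -> : (2 + D n) / Num.sqrt (V n) = (2 + D n) / Num.sqrt n%:R *
      ((Num.sqrt eta)^-1 * Num.sqrt (eta * n%:R / V n)).
    rewrite sqrtrM ?mulr_ge0 ?(ltW eta0) ?(ltW n0')// sqrtrM ?(ltW eta0)// sqrtrV ?(ltW V0)//.
    by field; rewrite !lt0r_neq0 ?sqrtr_gt0.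
  by apply: (le_trans (ler_norm _)); rewrite -normrN -sub0r; near: n; move/cvgrPdist_le : h; apply.
have llt := @bernoulli_local_limit R N q id q01 Voo mk.
have h5 : Num.sqrt (2 * pi * eta * n%:R) * b n @[n --> \oo] --> (1 : R).
  have hh : Num.sqrt (2 * pi * bern_var (N n) (q n)) * (bern_poly (N n) (q n))`_n *
      Num.sqrt (eta * n%:R / V n) @[n --> \oo] --> (1 * 1 : R).
    exact: cvgM llt sqrt_ratio.
  rewrite mulr1 in hh; apply: cvg_trans hh; apply: near_eq_cvg.
  near=> n => /=; rewrite -/(V n) -/(b n).
  have n0 : 0 < n%:R :> R by rewrite ltr0n; near: n; exact: nbhs_infty_gt.
  have V0 : 0 < V n.
    apply: (@lt_le_trans _ _ (eta / 2 * n%:R)); last by near: n.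
    by rewrite mulr_gt0.
  rewrite mulrAC -sqrtrM ?mulr_ge0 ?pi_ge0 ?(ltW V0)//.
  by congr (Num.sqrt _ * _); field; rewrite lt0r_neq0.
have h6 : Num.sqrt (2 * pi * eta * n%:R) * (a (N n) n * y n ^+ n / (bern_poly (N n) p).[y n])
    @[n --> \oo] --> (1 : R).
  (* The error [y^-1] of the tilted tail, multiplied by [sqrt n], is of order [n^(1/2 - alpha)],
     which tends to [0] as [alpha > 1]. *)
  have h : Num.sqrt (2 * pi * eta) / r * (n%:R `^ (- (alpha - 2^-1))) @[n --> \oo] -->
      (Num.sqrt (2 * pi * eta) / r * 0 : R).
    apply: cvgMr; apply: natpowN_cvg0; rewrite subr_gt0.
    by rewrite (lt_trans _ alpha_gt1)// invf_lt1// ltr1n.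
  rewrite mulr0 in h.
  have h' : Num.sqrt (2 * pi * eta * n%:R) *
      (a (N n) n * y n ^+ n / (bern_poly (N n) p).[y n] - b n) @[n --> \oo] --> (0 : R).
    apply/cvgrPdist_le => e e0; near=> n.
    have n0 : (0 < n)%N by near: n; exact: nbhs_infty_gt.
    have n0' : 0 < n%:R :> R by rewrite ltr0n.
    have y1 : 1 <= y n by near: n.
    have h7 := tail_bern_poly_tilt p01 (y_gt0 n0) (N n) n y1.
    rewrite sub0r normrN normrM ger0_norm ?sqrtr_ge0//.
    apply: (@le_trans _ _ (Num.sqrt (2 * pi * eta * n%:R) * (y n)^-1)).
      by rewrite ler_wpM2l// sqrtr_ge0.
    have -> : Num.sqrt (2 * pi * eta * n%:R) * (y n)^-1 =
        Num.sqrt (2 * pi * eta) / r * (n%:R `^ (- (alpha - 2^-1))).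
      rewrite opprB powRD; last by rewrite (lt0r_neq0 n0') implybT.
      rewrite powRN powR12_sqrt ?ltW// sqrtrM ?mulr_ge0 ?pi_ge0 ?(ltW eta0)//.
      by rewrite /y; field; rewrite !lt0r_neq0// powR_gt0.
    by apply: (le_trans (ler_norm _)); rewrite -normrN -sub0r; near: n; move/cvgrPdist_le : h; apply.
  have hh : Num.sqrt (2 * pi * eta * n%:R) *
      (a (N n) n * y n ^+ n / (bern_poly (N n) p).[y n] - b n) +
      Num.sqrt (2 * pi * eta * n%:R) * b n @[n --> \oo] --> (0 + 1 : R).
    exact: cvgD h' h5.
  rewrite add0r in hh; apply: cvg_trans hh; apply: near_eq_cvg.
  by apply: nearW => n /=; rewrite -mulrDr subrK.
have h7 : expR (series (fun j => ln (1 + p j * (y n - 1))) (N n) - Psi p (y n))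
    @[n --> \oo] --> (1 : R).
  have h : series (fun j => ln (1 + p j * (y n - 1))) (N n) - Psi p (y n)
      @[n --> \oo] --> (0 : R).
    have hn : n%:R^-1 @[n --> \oo] --> (0 : R).
      have := @natpowN_cvg0 R 1 ltr01.
      by under eq_fun do rewrite powR_inv1//.
    apply/cvgrPdist_le => e e0; near=> n.
    have n0 : (0 < n)%N by near: n; exact: nbhs_infty_gt.
    have [_ _ _ _ h] := hN n n0.
    rewrite sub0r opprB; apply: (le_trans h).
    by apply: (le_trans (ler_norm _)); rewrite -normrN -sub0r; near: n; move/cvgrPdist_le : hn; apply.
  have := cvg_comp _ _ h (@continuous_expR R 0); by rewrite expR0.
(* The generating polynomial at [y] is the exponential of the partial sum of [Psi], so [h7]
   exchanges it for [expR (Psi p (y n))] at the cost of a factor tending to [1]. *)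
have h8 : a (N n) n / B n @[n --> \oo] --> (1 : R).
  have hh : Num.sqrt (2 * pi * eta * n%:R) *
      (a (N n) n * y n ^+ n / (bern_poly (N n) p).[y n]) *
      expR (series (fun j => ln (1 + p j * (y n - 1))) (N n) - Psi p (y n))
      @[n --> \oo] --> (1 * 1 : R).
    exact: cvgM h6 h7.
  rewrite mulr1 in hh; apply: cvg_trans hh; apply: near_eq_cvg.
  near=> n => /=.
  have n0 : (0 < n)%N by near: n; exact: nbhs_infty_gt.
  have n0' : 0 < n%:R :> R by rewrite ltr0n.
  rewrite expRB (expR_series_ln_genfun pE _ (y_gt0 n0)) /B.
  have Q0 : 0 < (bern_poly (N n) p).[y n].
    by rewrite bern_polyE prodr_gt0// => j _; exact: tilt_denom_gt0 p01 (y_gt0 n0) j.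
  have -> : n%:R `^ (- alpha * n%:R - 2^-1) = ((n%:R `^ alpha) ^+ n)^-1 / Num.sqrt n%:R.
    rewrite powRD; last by rewrite (lt0r_neq0 n0') implybT.
    rewrite powRN powR12_sqrt ?ltW//; congr (_ / _).
    by rewrite mulNr powRN powRrM powR_mulrn// powR_ge0.
  rewrite /y exprMn.
  rewrite [Num.sqrt (_ * n%:R)]sqrtrM ?mulr_ge0 ?pi_ge0 ?(ltW eta0)//.
  rewrite -/(y n); field.
  rewrite !lt0r_neq0 ?expR_gt0 ?exprn_gt0 ?powR_gt0 ?sqrtr_gt0//.
  by rewrite !mulr_gt0// pi_gt0.
have h9 : (tail n - a (N n) n) / B n @[n --> \oo] --> (0 : R).
  have hn : n%:R^-1 @[n --> \oo] --> (0 : R).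
    have := @natpowN_cvg0 R 1 ltr01.
    by under eq_fun do rewrite powR_inv1//.
  apply/cvgrPdist_le => e e0; near=> n.
  have n0 : (0 < n)%N by near: n; exact: nbhs_infty_gt.
  have [_ _ _ h _] := hN n n0.
  rewrite sub0r normrN normrM normfV (gtr0_norm (B_gt0 n0)) ler_pdivrMr ?B_gt0//.
  apply: (le_trans h); rewrite mulrC ler_pM2r ?B_gt0//.
  by apply: (le_trans (ler_norm _)); rewrite -normrN -sub0r; near: n; move/cvgrPdist_le : hn; apply.
have hh : (tail n - a (N n) n) / B n + a (N n) n / B n @[n --> \oo] --> (0 + 1 : R).
  exact: cvgD h9 h8.
rewrite add0r in hh; apply: cvg_trans hh; apply: near_eq_cvg.
by apply: nearW => n /=; rewrite -mulrDl subrK.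
Unshelve. all: by end_near. Qed.

End tail_asymptotics.

(** * Gamma function and Stirling's formula *)

Section gamma_function.
Variable R : realType.
Local Notation mu := (@lebesgue_measure R).
Implicit Types (w z s x : R) (n k : nat).

Definition gamma_fun w x : R := x `^ (w - 1) * expR (- x).

Let cexpN : continuous (fun x : R => expR (- x)).
Proof.
move=> x; apply: continuous_comp; last exact: continuous_expR.
by apply: cvgN; exact: cvg_id.
Qed.

Lemma gamma_fun_continuous w x : 0 < x -> {for x, continuous (gamma_fun w)}.
Proof. by move=> x0; apply: cvgM; [exact: powR_continuous|exact: cexpN]. Qed.

Lemma gamma_fun_ge0 w x : 0 <= gamma_fun w x.
Proof. by rewrite mulr_ge0 ?powR_ge0 ?expR_ge0. Qed.

(** Truncating at both ends keeps the integrand continuous, also when [w < 1] makes it singular at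
    [0]. Identities and inequalities for [Gamma] are proved for the truncations and passed to the
    limit. *)
Definition gamma_trunc w n : R := primitive (gamma_fun w) n.+1%:R^-1 n.+1%:R.

Let natpowN_cvg0S b : 0 < b -> n.+1%:R `^ (- b) @[n --> \oo] --> (0 : R).
Proof.
move=> b0; have := @natpowN_cvg0 R b b0.
by rewrite -(cvg_shiftS (fun n : nat => n%:R `^ (- b) : R)).
Qed.

Let V0 n : 0 < n.+1%:R^-1 :> R. Proof. by rewrite invr_gt0 ltr0n. Qed.
Let Vle1 n : n.+1%:R^-1 <= 1 :> R. Proof. by rewrite invf_le1 ?ltr0n// ler1n. Qed.
Let Vle n : n.+1%:R^-1 <= n.+1%:R :> R.
Proof. by rewrite (le_trans (Vle1 n))// ler1n. Qed.

Let cV w n x : n.+1%:R^-1 <= x -> {for x, continuous (gamma_fun w)}.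
Proof. by move=> nx; apply: gamma_fun_continuous; exact: lt_le_trans nx. Qed.

Lemma gamma_truncE w n :
  (\int[mu]_(x in `[(n.+1%:R^-1)%R, n.+1%:R%R]) (gamma_fun w x)%:E = (gamma_trunc w n)%:E)%E.
Proof.
rewrite /gamma_trunc /primitive /Rintegral fineK//; apply: integrable_fin_num => //.
by apply: integrable_segment => x; exact: cV.
Qed.

Let mgamma w : measurable_fun (`]0, +oo[%classic : set R) (gamma_fun w).
Proof.
apply: open_continuous_measurable_fun; first exact: interval_open.
by move=> x; rewrite inE/= in_itv/= andbT => x0; exact: gamma_fun_continuous.
Qed.

Let itvE : (`]0, +oo[%classic : set R) = \bigcup_n (`[n.+1%:R^-1, n.+1%:R]%classic : set R).
Proof.
apply/seteqP; split => x /=; rewrite in_itv/= ?andbT.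
  move=> x0; have [n hn] : exists n : nat, x^-1 + x <= n.+1%:R.
    exists (Num.bound (x^-1 + x)); apply/ltW/(lt_trans (unstable.ltr_bound _)).
    by rewrite ltr_nat.
  have xV : 0 < x^-1 by rewrite invr_gt0.
  exists n => //; rewrite /= in_itv/= (le_trans _ hn) ?lerDr ?(ltW xV)// andbT.
  by rewrite -[leRHS]invrK lef_pV2 ?posrE ?ltr0n// (le_trans _ hn)// lerDl ltW.
by move=> [n _]; rewrite /= in_itv/= => /andP[nx _]; exact: lt_le_trans nx.
Qed.

Lemma gamma_trunc_ereal_cvg w : (gamma_trunc w n)%:E @[n --> \oo] -->
  (\int[mu]_(x in `]0%R, +oo[) (gamma_fun w x)%:E)%E.
Proof.
under eq_fun do rewrite -gamma_truncE.
rewrite itvE; apply: ge0_nondecreasing_set_cvg_integral.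
- move=> m n mn; apply/subsetPset => x /=; rewrite !in_itv/= => /andP[h1 h2].
  rewrite (le_trans _ h1) ?(le_trans h2)// ?ler_nat//.
  by rewrite lef_pV2 ?posrE ?ltr0n// ler_nat.
- by move=> n.
- move=> n; apply/measurable_EFinP; apply: measurable_funS (mgamma w) => //.
  by move=> x /=; rewrite !in_itv/= => /andP[h1 _]; rewrite andbT (lt_le_trans _ h1).
- by move=> n x _; rewrite lee_fin gamma_fun_ge0.
Qed.

Lemma gamma_trunc_le w1 w2 a b n :
  (forall x, 0 < x -> gamma_fun w1 x <= a * gamma_fun w2 x + b * gamma_fun (w2 + 1) x) ->
  gamma_trunc w1 n <= a * gamma_trunc w2 n + b * gamma_trunc (w2 + 1) n.
Proof.
move=> h.
have i w : mu.-integrable `[n.+1%:R^-1, n.+1%:R] (EFin \o gamma_fun w).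
  by apply: integrable_segment => x; exact: cV.
have iz (e w : R) : mu.-integrable `[n.+1%:R^-1, n.+1%:R] (EFin \o (fun x => e * gamma_fun w x)).
  by apply: integrable_segment => x nx; apply: cvgMr; exact: (cV nx).
rewrite /gamma_trunc /primitive -!RintegralZl// -RintegralD//.
apply: le_Rintegral => //.
  by apply: integrable_segment => x nx; apply: cvgD; apply: cvgMr; exact: (cV nx).
by move=> x /=; rewrite in_itv/= => /andP[h1 _]; apply: h; exact: lt_le_trans h1.
Qed.

(** Integration by parts, carried out by comparing [- x^w exp (-x)] with the primitive of its
    derivative. It holds for every real [w]; the case [w = 0] evaluates [Gamma 1]. *)
Lemma gamma_trunc_rec w n : gamma_trunc (w + 1) n = w * gamma_trunc w n +
  (n.+1%:R^-1 `^ w * expR (- n.+1%:R^-1) - n.+1%:R `^ w * expR (- n.+1%:R)).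
Proof.
pose F x := - (x `^ w * expR (- x)).
have D x : 0 < x -> is_derive x 1 F (gamma_fun (w + 1) x - w * gamma_fun w x).
  move=> x0; have h1 := is_derive1_powR w x0.
  have h2 : is_derive x 1 (fun x : R => expR (- x)) (- expR (- x)).
    by apply: is_derive_eq; rewrite mulrN1.
  have h3 := is_deriveN (is_deriveM h1 h2).
  apply: (@is_derive_eq _ _ _ _ _ _ _ _ h3).
  by rewrite /gamma_fun addrK /GRing.scale/=; ring.
have cF x : 0 < x -> {for x, continuous F}.
  by move=> x0; have [h _] := D x x0; exact/differentiable_continuous/derivable1_diffP.
have i u : mu.-integrable `[n.+1%:R^-1, n.+1%:R] (EFin \o gamma_fun u).
  by apply: integrable_segment => x; exact: cV.
suff <- : gamma_trunc (w + 1) n - w * gamma_trunc w n =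
    n.+1%:R^-1 `^ w * expR (- n.+1%:R^-1) - n.+1%:R `^ w * expR (- n.+1%:R).
  by rewrite [RHS]addrC subrK.
have -> : gamma_trunc (w + 1) n - w * gamma_trunc w n =
    primitive (fun x => gamma_fun (w + 1) x - w * gamma_fun w x) n.+1%:R^-1 n.+1%:R.
  rewrite /gamma_trunc /primitive -RintegralZl// RintegralB//.
  by apply: integrable_segment => x nx; apply: cvgMr; exact: (cV nx).
have cf x : n.+1%:R^-1 <= x -> {for x, continuous (fun x => gamma_fun (w + 1) x - w * gamma_fun w x)}.
  by move=> nx; apply: cvgB; [exact: (cV (n := n))|apply: cvgMr; exact: (cV (n := n))].
have C1 : {within `[n.+1%:R^-1, n.+1%:R], continuous F}.
  apply: continuous_in_subspaceT => x; rewrite inE/= in_itv/= => /andP[nx _].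
  by apply: cF; exact: lt_le_trans nx.
have C2 := primitive_continuous (c := n.+1%:R) cf (lexx n.+1%:R^-1).
have D1 x : x \in `]n.+1%:R^-1, n.+1%:R[ -> is_derive x 1 F (gamma_fun (w + 1) x - w * gamma_fun w x).
  by rewrite in_itv/= => /andP[nx _]; apply: D; exact: lt_trans nx.
have D2 x : x \in `]n.+1%:R^-1, n.+1%:R[ -> is_derive x 1
    (primitive (fun x => gamma_fun (w + 1) x - w * gamma_fun w x) n.+1%:R^-1)
    (gamma_fun (w + 1) x - w * gamma_fun w x).
  by rewrite in_itv/= => /andP[nx _]; exact: is_derive_primitive.
have e : n.+1%:R^-1 `^ w * expR (- n.+1%:R^-1) - n.+1%:R `^ w * expR (- n.+1%:R) =
  F n.+1%:R - F n.+1%:R^-1 by rewrite /F; ring.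
rewrite e; apply/eqP; rewrite eq_le; apply/andP; split.
  have := ler_deriv (Vle n) D2 D1 C2 C1; rewrite primitive_left subr0.
  by apply => x _.
have := ler_deriv (Vle n) D1 D2 C1 C2; rewrite primitive_left subr0.
by apply => x _.
Qed.

Lemma natpow_expRN_cvg0 w : n.+1%:R `^ w * expR (- n.+1%:R) @[n --> \oo] --> (0 : R).
Proof.
pose k := Num.bound w.
have h : k.+1`!%:R * n.+1%:R `^ (- 1) @[n --> \oo] --> (k.+1`!%:R * 0 : R).
  by apply: cvgMr; exact: natpowN_cvg0S.
rewrite mulr0 in h.
apply: (@squeeze_cvgr _ _ _ _ (fun=> 0) (fun n => k.+1`!%:R * n.+1%:R `^ (- 1))) => //; last exact: cvg_cst.
apply: nearW => n; rewrite mulr_ge0 ?powR_ge0 ?expR_ge0//=.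
have n0 : 0 < n.+1%:R :> R by rewrite ltr0n.
have h1 : n.+1%:R `^ w <= n.+1%:R ^+ k.
  by rewrite -powR_mulrn ?(ltW n0)// ler_powR ?ler1n// ltW// unstable.ltr_bound.
have h2 := @expR_ge1Dxn R n.+1%:R k (ltW n0).
rewrite expRN ler_pdivrMr ?expR_gt0// powR_inv1 ?(ltW n0)//.
apply: (le_trans h1); apply: (@le_trans _ _ (k.+1`!%:R / n.+1%:R * (n.+1%:R ^+ k.+1 / k.+1`!%:R))).
  rewrite le_eqVlt; apply/orP; left; apply/eqP; rewrite exprS; field.
  by rewrite nat1r (lt0r_neq0 n0) pnatr_eq0 -lt0n fact_gt0.
rewrite ler_wpM2l//.
by apply: le_trans h2; rewrite lerDr.
Qed.

Lemma natVpow_expRN_cvg0 w : 0 < w ->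
  n.+1%:R^-1 `^ w * expR (- n.+1%:R^-1) @[n --> \oo] --> (0 : R).
Proof.
move=> w0; have h := natpowN_cvg0S w0.
apply: (@squeeze_cvgr _ _ _ _ (fun=> 0) (fun n => n.+1%:R `^ (- w))) => //; last exact: cvg_cst.
apply: nearW => n; rewrite mulr_ge0 ?powR_ge0 ?expR_ge0//=.
rewrite -powR_inv1 -?powRrM ?mulN1r// ler_piMr ?powR_ge0//.
Qed.

Lemma gamma_trunc1 n : gamma_trunc 1 n <= 1.
Proof.
have := gamma_trunc_rec 0 n; rewrite add0r mul0r add0r => ->.
rewrite !powRr0 !mul1r lerBlDr.
apply: (@le_trans _ _ 1); last by rewrite lerDl expR_ge0.
by rewrite -[leRHS]expR0 ler_expR oppr_le0 ltW.
Qed.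

(** Positive integers are handled by the recurrence, reals [w >= 1] by [x^(w - 1) <= 1 + x^k] with
    an integer [k > w], and [w < 1] by reading the recurrence backwards from [w + 1]. *)
Lemma gamma_trunc_bounded w : 0 < w -> exists M, forall n, gamma_trunc w n <= M.
Proof.
have hnat k : exists M, forall n, gamma_trunc k.+1%:R n <= M.
  elim: k => [|k [M hM]]; first by exists 1 => n; exact: gamma_trunc1.
  exists (k.+1%:R * M + 1) => n; rewrite -natr1 gamma_trunc_rec.
  apply: lerD; first by rewrite ler_wpM2l.
  rewrite lerBlDr.
  apply: (@le_trans _ _ 1); last by rewrite lerDl mulr_ge0 ?powR_ge0 ?expR_ge0.
  have : n.+1%:R^-1 `^ k.+1%:R <= 1 :> R.
    by rewrite powR_mulrn ?(ltW (V0 n))// exprn_ile1// (ltW (V0 n)).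
  have : expR (- n.+1%:R^-1) <= 1 :> R by rewrite -[leRHS]expR0 ler_expR oppr_le0 ltW.
  by move=> h1 h2; rewrite mulr_ile1 ?powR_ge0 ?expR_ge0.
have hge1 w' : 1 <= w' -> exists M, forall n, gamma_trunc w' n <= M.
  move=> w1; pose k := Num.bound w'.
  have [M hM] := hnat k; have [M' hM'] := hnat 0%N.
  exists (M' + M) => n.
  have i u : mu.-integrable `[n.+1%:R^-1, n.+1%:R] (EFin \o gamma_fun u).
    by apply: integrable_segment => x; exact: cV.
  apply: (le_trans _ (lerD (hM' n) (hM n))).
  rewrite /gamma_trunc /primitive -RintegralD//; apply: le_Rintegral => //.
    by apply: integrable_segment => x nx; apply: cvgD; exact: (cV nx).
  move=> x /=; rewrite in_itv/= => /andP[h1 _]; have x0 : 0 < x by exact: lt_le_trans h1.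
  rewrite /gamma_fun -mulrDl ler_wpM2r ?expR_ge0//.
  have [x1|/ltW x1] := leP 1 x.
    apply: (@le_trans _ _ (x `^ (k.+1%:R - 1))); last by rewrite lerDr powR_ge0.
    rewrite ler_powR// lerD2r -natr1 -[leLHS]addr0 lerD// ltW//.
    exact: unstable.ltr_bound.
  apply: (@le_trans _ _ (x `^ (1 - 1))); last by rewrite lerDl powR_ge0.
  by rewrite ger_powR ?x0 ?x1// lerD2r.
move=> w0; have [w1|w1] := leP 1 w; first exact: hge1.
have [M hM] := hge1 (w + 1) ltac:(by rewrite lerDr ltW).
exists ((M + 1) / w) => n; rewrite ler_pdivlMr// mulrC.
have := hM n; rewrite gamma_trunc_rec.
have : n.+1%:R `^ w * expR (- n.+1%:R) <= 1.
  apply: (@le_trans _ _ (n.+1%:R `^ 1 * expR (- n.+1%:R))).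
    by rewrite ler_wpM2r ?expR_ge0// ler_powR ?ler1n// ltW.
  rewrite powRr1// expRN ler_pdivrMr ?expR_gt0// mul1r.
  by apply: (le_trans _ (expR_ge1Dx _)); rewrite lerDr.
have : 0 <= n.+1%:R^-1 `^ w * expR (- n.+1%:R^-1) :> R.
  by rewrite mulr_ge0 ?powR_ge0 ?expR_ge0.
lra.
Qed.

Lemma gamma_trunc_cvg w : 0 < w -> gamma_trunc w n @[n --> \oo] --> Gamma w.
Proof.
move=> w0; have [M hM] := gamma_trunc_bounded w0; have h := @gamma_trunc_ereal_cvg w.
suff : (gamma_trunc w n)%:E @[n --> \oo] --> (Gamma w)%:E.
  by move=> {}h; apply: fine_cvg h.
rewrite [X in _ --> X%:E]/Gamma /Rintegral fineK; first exact: h.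
rewrite ge0_fin_numE; last by apply: integral_ge0 => x _; rewrite lee_fin gamma_fun_ge0.
apply: (@le_lt_trans _ _ M%:E); last exact: ltry.
rewrite -(cvg_lim _ h)//; apply: lime_le; first by apply/cvg_ex; eexists; exact: h.
by apply: nearW => n; rewrite lee_fin.
Qed.

Lemma GammaS w : 0 < w -> Gamma (w + 1) = w * Gamma w.
Proof.
move=> w0; have h1 := gamma_trunc_cvg (addr_gt0 w0 ltr01).
have h2 : w * gamma_trunc w n + (n.+1%:R^-1 `^ w * expR (- n.+1%:R^-1) -
    n.+1%:R `^ w * expR (- n.+1%:R)) @[n --> \oo] --> w * Gamma w + (0 - 0).
  apply: cvgD; first by apply: cvgMr; exact: gamma_trunc_cvg.
  by apply: cvgB; [exact: natVpow_expRN_cvg0|exact: natpow_expRN_cvg0].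
rewrite subrr addr0 in h2.
have E : gamma_trunc (w + 1) = fun n => w * gamma_trunc w n +
    (n.+1%:R^-1 `^ w * expR (- n.+1%:R^-1) - n.+1%:R `^ w * expR (- n.+1%:R)).
  by apply/funext => n; exact: gamma_trunc_rec.
rewrite E in h1; exact: (cvg_unique _ h1 h2).
Qed.

Lemma Gamma1 : Gamma 1 = 1 :> R.
Proof.
have h1 := gamma_trunc_cvg (@ltr01 R).
have h2 : expR (- n.+1%:R^-1) - n.+1%:R `^ 0 * expR (- n.+1%:R) @[n --> \oo] --> (expR (- 0) - 0 : R).
  apply: cvgB; last exact: natpow_expRN_cvg0.
  have h := natpowN_cvg0S (@ltr01 R).
  have E : (fun n : nat => n.+1%:R `^ (-1)) = (fun n => n.+1%:R^-1) :> (nat -> R).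
    by apply/funext => n; rewrite powR_inv1.
  by rewrite E in h; exact: (cvg_comp _ _ h (cexpN (x := 0))).
have e1 : expR (- 0) - 0 = 1 :> R by rewrite oppr0 expR0 addr0.
rewrite e1 in h2.
have E : gamma_trunc 1 = (fun n => expR (- n.+1%:R^-1) - n.+1%:R `^ 0 * expR (- n.+1%:R)).
  apply/funext => n; have := gamma_trunc_rec 0 n.
  by rewrite add0r mul0r add0r => ->; rewrite [_^-1 `^ 0]powRr0 mul1r.
rewrite E in h1; exact: (cvg_unique _ h1 h2).
Qed.

(** The mass on [[1, 2]] already exceeds a positive constant independent of the truncation. *)
Lemma Gamma_gt0 w : 0 < w -> 0 < Gamma w.
Proof.
move=> w0; have h := gamma_trunc_cvg w0.
pose m := Num.min 1 (2 `^ (w - 1)) * expR (- 2) : R.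
have m0 : 0 < m by rewrite mulr_gt0 ?expR_gt0// lt_min ltr01 powR_gt0.
apply: (lt_le_trans m0); apply: (ler_cvg_to (cvg_cst m) h); near=> n.
have n2 : 2 <= n.+1%:R :> R.
  by rewrite ler_nat ltnS; near: n; exact: nbhs_infty_gt.
have cf x : n.+1%:R^-1 <= x -> {for x, continuous (gamma_fun w)} by exact: cV.
have h12 : m * (2 - 1) <= primitive (gamma_fun w) n.+1%:R^-1 2 - primitive (gamma_fun w) n.+1%:R^-1 1.
  apply: (primitiveB_ge cf); first by rewrite Vle1 ler1n.
  move=> x; rewrite in_itv/= => /andP[x1 x2]; rewrite /m /gamma_fun.
  apply: ler_pM; rewrite ?expR_ge0//.
  - rewrite ge_min; have [w1|/ltW w1] := leP 1 w.
      by apply/orP; left; have := @ler_powR _ x (ltW x1) 0 (w - 1); rewrite powRr0 subr_ge0; exact.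
    apply/orP; right; rewrite -(opprB 1 w) !powRN lef_pV2 ?posrE ?powR_gt0//.
      by apply: ge0_ler_powR; rewrite ?subr_ge0 ?nnegrE// ltW// (lt_trans _ x1).
    exact: lt_trans x1.
  - by rewrite ler_expR lerN2 ltW.
have homo := primitive_homo cf (fun x _ => gamma_fun_ge0 w x).
have h1 : 0 <= primitive (gamma_fun w) n.+1%:R^-1 1.
  by rewrite -(primitive_left (gamma_fun w) n.+1%:R^-1); apply: homo; rewrite ?in_itv/= ?lexx ?Vle1.
have h2 : primitive (gamma_fun w) n.+1%:R^-1 2 <= gamma_trunc w n.
  by apply: homo => //; rewrite in_itv/= andbT ?Vle// (le_trans (Vle1 n))// ler1n.
lra.
Unshelve. all: by end_near. Qed.

(* Multiplied by the Gamma integrand, this tangent line bound gives [Gamma_le] with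
   no appeal to log-convexity. *)
Lemma powR_le_tangent (s u : R) : 0 <= s <= 1 -> 0 < u -> u `^ s <= 1 + s * (u - 1).
Proof.
move=> /andP[s0 s1] u0; set A := 1 + s * (u - 1).
have A0 : 0 < A.
  rewrite /A; have : 0 <= s * u by rewrite mulr_ge0// ltW.
  have [->|s1'] := eqVneq s 1; first by lra.
  have : s < 1 by rewrite lt_neqAle s1'.
  lra.
have lnb x : 0 < x -> ln x <= x - 1.
  by move=> x0; have := @le_ln1Dx R (x - 1); rewrite addrCA subrr addr0; apply; lra.
rewrite -[leRHS]lnK ?posrE// /powR gt_eqF// ler_expR.
have h1 := lnb (u / A) (divr_gt0 u0 A0).
have h2 := lnb (A^-1) ltac:(by rewrite invr_gt0).
rewrite ln_div ?posrE// in h1; rewrite lnV ?posrE// in h2.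
have h3 : s * (u / A - 1) + (1 - s) * (A^-1 - 1) = 0.
  by rewrite /A; field; rewrite -/A lt0r_neq0.
have h1' : s * (ln u - ln A) <= s * (u / A - 1) by rewrite ler_wpM2l.
have h2' : (1 - s) * (- ln A) <= (1 - s) * (A^-1 - 1) by rewrite ler_wpM2l// subr_ge0.
lra.
Qed.

(** The tangent bound at [u = x / z] is integrated against [x^(z - 1) exp (-x)]. By
    [Gamma (z + 1) = z Gamma z], the mean of [x] under this weight is [z], so the linear term drops
    out in the limit. *)
Lemma Gamma_le (z s : R) : 0 < z -> 0 <= s <= 1 -> Gamma (z + s) <= z `^ s * Gamma z.
Proof.
move=> z0 s01; have /andP[s0 s1] := s01.
have zs : 0 < z + s by rewrite ltr_wpDr.
have h1 := gamma_trunc_cvg zs.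
have h2 : (1 - s) * z `^ s * gamma_trunc z n + s * z `^ s / z * gamma_trunc (z + 1) n
    @[n --> \oo] --> (1 - s) * z `^ s * Gamma z + s * z `^ s / z * Gamma (z + 1).
  by apply: cvgD; apply: cvgMr; apply: gamma_trunc_cvg; rewrite ?addr_gt0.
rewrite GammaS// in h2.
have e : (1 - s) * z `^ s * Gamma z + s * z `^ s / z * (z * Gamma z) = z `^ s * Gamma z.
  by field; rewrite lt0r_neq0.
rewrite e in h2; apply: (ler_cvg_to h1 h2); apply: nearW => n.
apply: gamma_trunc_le => x x0; rewrite /gamma_fun addrK.
have -> : z + s - 1 = (z - 1) + s by ring.
rewrite powRD; last by rewrite (lt0r_neq0 x0) implybT.
have -> : x `^ z = x `^ (z - 1) * x.
  by rewrite -{3}(powRr1 (ltW x0)) -powRD ?subrK// (lt0r_neq0 x0) implybT.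
have h := powR_le_tangent s01 (divr_gt0 x0 z0).
have xs : x `^ s <= z `^ s * (1 + s * (x / z - 1)).
  have -> : x `^ s = z `^ s * (x / z) `^ s.
    rewrite -powRM ?(ltW z0)//; last by rewrite ltW// divr_gt0.
    by rewrite mulrCA divff ?mulr1// lt0r_neq0.
  by rewrite ler_pM2l ?powR_gt0.
have -> : (1 - s) * z `^ s * (x `^ (z - 1) * expR (- x)) + s * z `^ s / z *
    (x `^ (z - 1) * x * expR (- x)) =
    x `^ (z - 1) * (z `^ s * (1 + s * (x / z - 1))) * expR (- x).
  by field; rewrite lt0r_neq0.
by rewrite ler_wpM2r ?expR_ge0// ler_wpM2l// powR_ge0.
Qed.

Lemma Gamma_nat n : Gamma n.+1%:R = n`!%:R :> R.
Proof.
elim: n => [|n ih]; first by rewrite Gamma1.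
by rewrite -natr1 GammaS ?ltr0n// ih factS natrM.
Qed.

(** For [0 < v <= 1] the ratio is squeezed by two uses of [Gamma_le]: from [n] to [n + v] for the
    upper bound, from [n + v] to [n + 1] for the lower one. The recurrence then raises the exponent
    by integers. *)
Lemma Gamma_ratio_cvg w : 0 < w ->
  Gamma (w + n%:R) / (n%:R `^ w * Gamma n%:R) @[n --> \oo] --> (1 : R).
Proof.
have h0 : n%:R^-1 @[n --> \oo] --> (0 : R).
  have := @natpowN_cvg0 R 1 ltr01.
  by under eq_fun do rewrite powR_inv1//.
have small v : 0 < v <= 1 -> Gamma (v + n%:R) / (n%:R `^ v * Gamma n%:R) @[n --> \oo] --> (1 : R).
  move=> /andP[v0 v1].
  have h : (1 + v * n%:R^-1)^-1 @[n --> \oo] --> ((1 + v * 0)^-1 : R).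
    apply: cvgV; first by rewrite mulr0 addr0 oner_eq0.
    by apply: cvgD; [exact: cvg_cst|apply: cvgMr].
  rewrite mulr0 addr0 invr1 in h.
  apply: (@squeeze_cvgr _ _ _ _ (fun n => (1 + v * n%:R^-1)^-1) (fun=> 1)) => //; last exact: cvg_cst.
  near=> n; have n0 : 0 < n%:R :> R by rewrite ltr0n; near: n; exact: nbhs_infty_gt.
  have G0 := Gamma_gt0 n0; have p0 := powR_gt0 v n0.
  have nv : 0 < n%:R + v by rewrite addr_gt0.
  rewrite [v + _]addrC; apply/andP; split; last first.
    rewrite ler_pdivrMr ?mulr_gt0// mul1r; apply: Gamma_le => //.
    by rewrite (ltW v0).
  have := @Gamma_le (n%:R + v) (1 - v) nv; rewrite subr_ge0 v1 gerBl (ltW v0) => /(_ isT).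
  rewrite addrA addrAC addrK GammaS// => hl.
  have e : (n%:R + v) `^ (1 - v) <= n%:R `^ (1 - v) * (1 + v * n%:R^-1).
    have -> : n%:R + v = n%:R * (1 + v * n%:R^-1) by field; rewrite lt0r_neq0.
    have q1 : 1 <= 1 + v * n%:R^-1 by rewrite lerDl mulr_ge0 ?invr_ge0 ?(ltW n0)// ltW.
    rewrite powRM ?(ltW n0) ?(le_trans ler01)// ler_wpM2l ?powR_ge0//.
    by apply: ler1_powR => //; rewrite gerBl ltW.
  have q0 : 0 < 1 + v * n%:R^-1 by rewrite addr_gt0// mulr_gt0// invr_gt0.
  have Gnv := Gamma_gt0 nv.
  rewrite -[leLHS]div1r ler_pdivrMr// mulrAC ler_pdivlMr ?mulr_gt0// mul1r.
  have n1v : n%:R `^ (1 - v) = n%:R / n%:R `^ v.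
    by rewrite powRB ?powRr1 ?ltW// (lt0r_neq0 n0) implybT.
  have : n%:R * Gamma n%:R <= n%:R / n%:R `^ v * (1 + v * n%:R^-1) * Gamma (n%:R + v).
    apply: (le_trans hl); rewrite ler_pM2r//; by rewrite -n1v.
  rewrite -!mulrA ler_pM2l// ler_pdivlMl// => h1.
  by rewrite [leRHS]mulrC.
move=> w0.
suff hk k v : 0 < v <= 1 -> Gamma (v + k%:R + n%:R) / (n%:R `^ (v + k%:R) * Gamma n%:R)
    @[n --> \oo] --> (1 : R).
  have t0 := truncn_itv (ltW w0); set k := Num.truncn w in t0.
  (* The base exponent must be positive, so an integer [w] is split as [1 + (k - 1)] and any other
     [w] as its fractional part plus [k]. *)
  have [wk|wk] := eqVneq w k%:R.
    have k0 : (0 < k)%N by rewrite -(@ltr0n R) -wk.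
    have := hk k.-1 1; rewrite ltr01 lexx => /(_ isT).
    by have -> : 1 + k.-1%:R = w by rewrite nat1r prednK.
  have := hk k (w - k%:R); rewrite subrK; apply.
  case/andP: t0 => t1 t2; rewrite subr_gt0 lt_neqAle eq_sym wk t1/=.
  by rewrite lerBlDr addrC natr1 ltW.
move=> v01; elim: k => [|k ih]; first by rewrite addr0; exact: small.
case/andP: v01 => v0 v1.
have h : (1 + (v + k%:R) * n%:R^-1) * (Gamma (v + k%:R + n%:R) / (n%:R `^ (v + k%:R) * Gamma n%:R))
    @[n --> \oo] --> ((1 + (v + k%:R) * 0) * 1 : R).
  by apply: cvgM => //; apply: cvgD; [exact: cvg_cst|apply: cvgMr].
rewrite mulr0 addr0 mulr1 in h; apply: cvg_trans h; apply: near_eq_cvg; near=> n.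
have n0 : 0 < n%:R :> R by rewrite ltr0n; near: n; exact: nbhs_infty_gt.
have vk : 0 < v + k%:R by rewrite ltr_wpDr.
have -> : v + k.+1%:R + n%:R = v + k%:R + n%:R + 1 by rewrite -natr1; ring.
rewrite GammaS; last by rewrite addr_gt0.
have -> : v + k.+1%:R = v + k%:R + 1 by rewrite -natr1; ring.
rewrite [_ `^ (_ + 1)]powRD; last by rewrite (lt0r_neq0 n0) implybT.
rewrite powRr1 ?(ltW n0)//; field.
by rewrite !lt0r_neq0 ?powR_gt0 ?Gamma_gt0.
Unshelve. all: by end_near. Qed.

End gamma_function.

(** * Euler-Maclaurin estimates at shifted sample points *)

Section euler_cells.
Variables (R : realType) (f df G : R -> R) (lo : R).
Hypothesis cf : forall x, lo <= x -> {for x, continuous f}.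
Hypothesis Df : forall x, lo < x -> is_derive x 1 f (df x).
Hypothesis cG : forall b c, lo <= b -> {within `[b, c], continuous G}.
Hypothesis DG : forall x, lo < x -> is_derive x 1 G (f x).

(* The left-hand side vanishes when [f] is affine; in general [f] and [G] lie between
   the Taylor polynomials at [s] obtained with [m] and [M] in place of [df]. *)
Lemma euler_cell (s d w W m M : R) : lo <= s -> 0 < d -> 0 <= w <= W -> 1 <= W ->
  (forall x, s < x < s + W * d -> m <= df x <= M) ->
  `|f (s + w * d) - (G (s + d) - G s) / d - (w - 2^-1) * (f (s + d) - f s)|
    <= (2 * w + 1) * (d * (M - m)).
Proof.
move=> los d0 /andP[w0 wW] W1 bd.
have cfw y : {within `[s, y], continuous f}.
  apply: continuous_in_subspaceT => x; rewrite inE/= in_itv/= => /andP[sx _].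
  by apply: cf; exact: le_trans sx.
have Dl (k x : R) : is_derive x 1 (fun x => k * x) k.
  by apply: is_derive_eq; rewrite /GRing.scale/= mulr1.
have cl (k y : R) : {within `[s, y], continuous (fun x => k * x)}.
  apply: continuous_subspaceT => x; by apply: cvgMr; exact: cvg_id.
have inc u : 0 <= u <= W -> m * (u * d) <= f (s + u * d) - f s <= M * (u * d).
  move=> /andP[u0 uW]; have su : s <= s + u * d by rewrite lerDl mulr_ge0// ltW.
  have bd' x : x \in `]s, s + u * d[ -> m <= df x <= M.
    rewrite in_itv/= => /andP[sx xu]; apply: bd; rewrite sx (lt_le_trans xu)//.
    by rewrite lerD2l ler_wpM2r// ltW.
  have Df' x : x \in `]s, s + u * d[ -> is_derive x 1 f (df x).
    by rewrite in_itv/= => /andP[sx _]; apply: Df; exact: le_lt_trans sx.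
  have e k : k * (u * d) = k * (s + u * d) - k * s by ring.
  rewrite !e; apply/andP; split.
    apply: (@ler_deriv R (fun x => m * x) f (cst m) df) => // x xu.
    by have /andP[] := bd' x xu.
  apply: (@ler_deriv R f (fun x => M * x) df (cst M)) => // x xu.
  by have /andP[] := bd' x xu.
have sd : s <= s + d by rewrite lerDl ltW.
pose q k x := f s * x + k / 2 * (x - s) ^+ 2.
have Dq k (x : R) : is_derive x 1 (q k) (f s + k * (x - s)).
  by apply: is_derive_eq; rewrite /GRing.scale/=; field.
have cq k : {within `[s, s + d], continuous (q k)}.
  apply: continuous_subspaceT => x; have [h _] := Dq k x.
  exact/differentiable_continuous/derivable1_diffP.
have eq k : q k (s + d) - q k s = f s * d + k / 2 * d ^+ 2.
  by rewrite /q; field.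
have inc' x : x \in `]s, s + d[ -> f s + m * (x - s) <= f x <= f s + M * (x - s).
  rewrite in_itv/= => /andP[sx xd].
  have := inc ((x - s) / d); rewrite divr_ge0 ?subr_ge0 ?(ltW sx) ?(ltW d0)//=.
  rewrite (le_trans _ W1); last by rewrite ler_pdivrMr// mul1r lerBlDl ltW.
  move=> /(_ isT); rewrite divfK ?lt0r_neq0// [s + _]addrC subrK.
  by rewrite lerBrDl lerBlDl.
have DG' x : x \in `]s, s + d[ -> is_derive x 1 G (f x).
  by rewrite in_itv/= => /andP[sx _]; apply: DG; exact: le_lt_trans sx.
have hG1 : f s * d + m / 2 * d ^+ 2 <= G (s + d) - G s.
  rewrite -eq; apply: (@ler_deriv R (q m) G (fun x => f s + m * (x - s)) f) => //.
    exact: cG.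
  by move=> x /inc'/andP[].
have hG2 : G (s + d) - G s <= f s * d + M / 2 * d ^+ 2.
  rewrite -eq; apply: (@ler_deriv R G (q M) f (fun x => f s + M * (x - s))) => //.
    exact: cG.
  by move=> x /inc'/andP[].
have {hG1 hG2} [b [b0 b1 ->]] : exists b, [/\ 0 <= b, b <= 2^-1 * (d * (M - m)) &
    (G (s + d) - G s) / d = f s + m / 2 * d + b].
  exists ((G (s + d) - G s) / d - (f s + m / 2 * d)); split; last by ring.
    rewrite subr_ge0 ler_pdivlMr//; apply: le_trans hG1; rewrite le_eqVlt.
    by apply/orP; left; apply/eqP; field.
  rewrite lerBlDr ler_pdivrMr//; apply: (le_trans hG2); rewrite le_eqVlt.
  by apply/orP; left; apply/eqP; field.
have /andP[a1 a2] := inc w ltac:(by rewrite w0 wW).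
have /andP[c1 c2] := inc 1 ltac:(by rewrite ler01 W1).
rewrite mul1r in c1 c2.
set a := f (s + w * d) - f s in a1 a2.
set c := f (s + d) - f s in c1 c2 *.
have -> : f (s + w * d) - (f s + m / 2 * d + b) - (w - 2^-1) * c =
  (a - m * (w * d)) - b - (w - 2^-1) * (c - m * d) by rewrite /a; field.
have hc : `|(w - 2^-1) * (c - m * d)| <= (w + 2^-1) * (d * (M - m)).
  rewrite normrM; apply: ler_pM => //.
    by rewrite ler_norml; apply/andP; split; lra.
  by rewrite ger0_norm; [lra|rewrite subr_ge0].
have ha : `|a - m * (w * d)| <= w * (d * (M - m)).
  by rewrite ger0_norm; [lra|rewrite subr_ge0].
have hb : `|b| <= 2^-1 * (d * (M - m)) by rewrite ger0_norm.
apply: (le_trans (ler_normB _ _)); apply: (le_trans (lerD (ler_normB _ _) hc)).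
apply: (le_trans (lerD (lerD ha hb) (lexx _))).
by rewrite le_eqVlt; apply/orP; left; apply/eqP; field.
Qed.

(** Cells of width [1/n] are added, and both differences telescope. The coefficient [w - 1/2]
    corrects for sampling at offset [w] instead of at the midpoint of the cell. Since [w] may exceed
    [1], a sample can fall outside its own cell, and the derivative is bounded over [W] cells. *)
Lemma euler_sum (n a b : nat) (w W : R) (m M : nat -> R) : (0 < n)%N -> (a <= b)%N ->
  lo <= a%:R / n%:R -> 0 <= w <= W -> 1 <= W ->
  (forall j x, (a <= j < b)%N -> j%:R / n%:R < x < (j%:R + W) / n%:R ->
    m j <= df x <= M j) ->
  `|\sum_(a <= j < b) f ((w + j%:R) / n%:R) -
     n%:R * (G (b%:R / n%:R) - G (a%:R / n%:R)) -
     (w - 2^-1) * (f (b%:R / n%:R) - f (a%:R / n%:R))|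
    <= (2 * w + 1) / n%:R * \sum_(a <= j < b) (M j - m j).
Proof.
move=> n0 ab loa w0W W1 bd; have n0' : 0 < n%:R :> R by rewrite ltr0n.
pose g (j : nat) := f (j%:R / n%:R); pose H (j : nat) := G (j%:R / n%:R).
rewrite -[X in n%:R * X](telescope_sumr H ab).
rewrite -[X in (w - 2^-1) * X](telescope_sumr g ab) !mulr_sumr -!sumrB.
apply: (le_trans (ler_norm_sum _ _ _)).
rewrite !big_nat; apply: ler_sum => j jab; have /andP[aj jb] := jab.
have e0 : (w + j%:R) / n%:R = j%:R / n%:R + w * n%:R^-1 by ring.
have e1 : j.+1%:R / n%:R = j%:R / n%:R + n%:R^-1 :> R by rewrite -natr1; ring.
have e2 : n%:R * (H j.+1 - H j) = (H j.+1 - H j) / n%:R^-1 by rewrite invrK mulrC.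
rewrite e0 e2 /H /g e1 -mulrA; apply: (@euler_cell _ _ w W) => //.
- by apply: (le_trans loa); rewrite ler_pM2r ?invr_gt0// ler_nat.
- by rewrite invr_gt0.
- by move=> x; rewrite -mulrDl; exact: bd.
Qed.

End euler_cells.

(* The bound does not depend on [b - a]; this is what makes the total error of
   [euler_sum] of order [1/n]. *)
Lemma sum_shift_le (R : realType) (u : nat -> R) (l L : R) (a b W : nat) :
  (a <= b)%N -> (forall j, (a <= j <= b + W)%N -> l <= u j <= L) ->
  \sum_(a <= j < b) (u (j + W)%N - u j) <= W%:R * (L - l).
Proof.
move=> ab; elim: W => [|W ih] ul.
  by rewrite mul0r big1// => j _; rewrite addn0 subrr.
rewrite -natr1 mulrDl mul1r.
have -> : \sum_(a <= j < b) (u (j + W.+1)%N - u j) =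
    \sum_(a <= j < b) (u (j + W)%N - u j) + (u (b + W)%N - u (a + W)%N).
  rewrite -(telescope_sumr (fun j => u (j + W)%N) ab) -big_split/=.
  by apply: eq_bigr => j _; rewrite addnS addSn; ring.
apply: lerD.
  apply: ih => j /andP[aj jb]; apply: ul.
  by rewrite aj (leq_trans jb)// leq_add2l.
have /andP[_ h1] := ul (b + W)%N ltac:(lia).
by have /andP[h2 _] := ul (a + W)%N ltac:(lia); apply: lerB.
Qed.

Section stirling.
Variable R : realType.
Implicit Types n : nat.

Lemma ln_Gamma_sum (a b : nat) : (0 < a)%N -> (a <= b)%N ->
  \sum_(a <= j < b) ln (j%:R : R) = ln (Gamma b%:R) - ln (Gamma a%:R).
Proof.
move=> a0 ab; rewrite -(telescope_sumr (fun j : nat => ln (Gamma (j%:R : R))) ab).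
rewrite !big_nat; apply: eq_bigr => j /andP[aj _].
have j0 : 0 < j%:R :> R by rewrite ltr0n (leq_trans a0).
by rewrite -natr1 GammaS// lnM ?posrE ?Gamma_gt0// addrK.
Qed.

(** The exponent is [n - 1/2] because the formula is for [Gamma n], that is for the factorial of
    [n - 1]. *)
Definition stirling_err n : R := ln (Gamma n%:R) - (n%:R - 2^-1) * ln n%:R + n%:R.

(** The Euler estimate for the logarithm with unit cells and offset [0]; the derivative bounds
    [1/(j + 1)] and [1/j] telescope. The sequence is therefore Cauchy, though its limit is not yet
    identified. *)
Lemma stirling_err_dist (a b : nat) : (0 < a)%N -> (a <= b)%N ->
  `|stirling_err b - stirling_err a| <= a%:R^-1.
Proof.
move=> a0 ab; pose G (x : R) := x * ln x - x.
have DG (x : R) : 1 <= x -> is_derive x 1 G (ln x).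
  move=> x1; have x0 : 0 < x by exact: lt_le_trans x1.
  have h := is_deriveB (is_deriveM (is_derive_id x 1) (is_derive1_ln x0)) (is_derive_id x (1 : R)).
  apply: (@is_derive_eq _ _ _ _ _ _ _ _ h).
  by rewrite /GRing.scale/=; field; rewrite lt0r_neq0.
have cG (c d : R) : 1 <= c -> {within `[c, d], continuous G}.
  move=> c1; apply: continuous_in_subspaceT => x; rewrite inE/= in_itv/= => /andP[cx _].
  have [h _] := DG x (le_trans c1 cx).
  exact/differentiable_continuous/derivable1_diffP.
have cf (x : R) : 1 <= x -> {for x, continuous (@ln R)}.
  by move=> x1; apply: continuous_ln; exact: lt_le_trans x1.
have Df (x : R) : 1 < x -> is_derive x 1 (@ln R) x^-1.
  by move=> x1; apply: is_derive1_ln; exact: lt_trans x1.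
have := @euler_sum R (@ln R) (fun x => x^-1) G 1 cf Df cG (fun x x1 => DG x (ltW x1))
  1 a b 0 1 (fun j => j.+1%:R^-1) (fun j => j%:R^-1) isT ab.
rewrite divr1 !lexx ler01 ler1n => /(_ a0 isT isT).
have hbd j (x : R) : (a <= j < b)%N -> j%:R / 1%:R < x < (j%:R + 1) / 1%:R ->
    j.+1%:R^-1 <= x^-1 <= j%:R^-1.
  move=> /andP[aj _]; rewrite !divr1 natr1 => /andP[x1 x2].
  have j0 : 0 < j%:R :> R by rewrite ltr0n (leq_trans a0).
  have x0 := lt_trans j0 x1.
  by rewrite !lef_pV2 ?posrE// (ltW x1) (ltW x2).
move=> /(_ hbd) {hbd}.
under eq_bigr do rewrite add0r divr1.
rewrite ln_Gamma_sum// !divr1 mulr0 !add0r mul1r.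
have -> : \sum_(a <= j < b) (j%:R^-1 - j.+1%:R^-1) = a%:R^-1 - b%:R^-1 :> R.
  rewrite -opprB -(telescope_sumr (fun j : nat => j%:R^-1 : R) ab) -sumrN.
  by apply: eq_bigr => j _; rewrite opprB.
move=> h; apply: le_trans (le_trans h _); last by rewrite gerBl.
rewrite le_eqVlt; apply/orP; left; apply/eqP; congr `|_|.
rewrite /stirling_err /G.
have alg (g1 g2 l1 l2 x y : R) : g1 - (x - 2^-1) * l1 + x - (g2 - (y - 2^-1) * l2 + y) =
  g1 - g2 - 1 * (x * l1 - x - (y * l2 - y)) - - 2^-1 * (l1 - l2) by ring.
exact: alg.
Qed.

Lemma is_cvg_stirling_err : cvgn stirling_err.
Proof.
apply/cauchy_cvgP/cauchy_exP => e e0.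
have [a ha] : exists a : nat, e^-1 < a.+1%:R.
  exists (Num.bound e^-1); apply: (lt_trans (unstable.ltr_bound _)).
  by rewrite ltr_nat.
exists (stirling_err a.+1).
change (\forall b \near \oo, ball (stirling_err a.+1) e (stirling_err b)); near=> b.
have ab : (a.+1 <= b)%N by near: b; exact: nbhs_infty_ge.
rewrite /ball/= distrC (le_lt_trans (stirling_err_dist _ ab))//.
by rewrite -[ltRHS]invrK ltf_pV2 ?posrE ?invr_gt0// ltr0n.
Unshelve. all: by end_near. Qed.

Lemma coef_bern_poly_half (N k : nat) :
  (bern_poly N (cst (2^-1 : R)))`_k = 'C(N, k)%:R / 2 ^+ N.
Proof.
rewrite /bern_poly /cst /= prodr_const card_ord.
have -> : (1 - 2^-1)%:P + 2^-1 *: 'X = (2^-1 : R) *: (1 + 'X).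
  by rewrite scalerDr -[X in _ = X + _]mul_polyC mulr1; congr (_%:P + _); field.
rewrite exprZn coefZ exprVn mulrC; congr (_ / _).
rewrite exprDn coef_sum.
case: (ltnP k N.+1) => kN; last first.
  rewrite bin_small// big1// => i _; rewrite expr1n mul1r coefMn coefXn.
  rewrite gtn_eqF ?mul0rn//; exact: leq_trans kN.
rewrite (bigD1 (Ordinal kN))//= big1 ?addr0.
  by rewrite expr1n mul1r coefMn coefXn eqxx.
move=> i ik; rewrite expr1n mul1r coefMn coefXn; case: eqP => [e|]; last by rewrite mul0rn.
by move: ik; rewrite -val_eqE/= e eqxx.
Qed.

(** The normalised probability of [n] heads in [2n] fair tosses: the variance is [n / 2], so the
    factor of the local limit theorem is [sqrt (pi n)]. *)
Let dbl n : R := Num.sqrt (pi * n%:R) * ('C(2 * n, n)%:R / 2 ^+ (2 * n)).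

Lemma central_binomial_cvg : dbl n @[n --> \oo] --> (1 : R).
Proof.
have v n : bern_var (2 * n) (cst (2^-1 : R)) = n%:R / 2.
  rewrite /bern_var /cst /= sumr_const card_ord -[LHS]mulr_natr natrM; by field.
have mn n : bern_mean (2 * n) (cst (2^-1 : R)) = n%:R.
  rewrite /bern_mean /cst /= sumr_const card_ord -[LHS]mulr_natr natrM; by field.
have q01 (n j : nat) : 0 <= cst (2^-1 : R) j <= 1 by rewrite /cst; apply/andP; split; lra.
have Voo : bern_var (2 * n) (cst (2^-1 : R)) @[n --> \oo] --> +oo.
  apply/cvgryPge => A; near=> n; rewrite v ler_pdivlMr//.
  by near: n; exact: nbhs_infty_ger.
have mk : (bern_mean (2 * n) (cst (2^-1 : R)) - n%:R) /
    Num.sqrt (bern_var (2 * n) (cst (2^-1 : R))) @[n --> \oo] --> (0 : R).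
  by under eq_fun do rewrite mn subrr mul0r; exact: cvg_cst.
have := @bernoulli_local_limit R (fun n => 2 * n)%N (fun=> cst 2^-1) (fun n => n) (fun n => q01 n) Voo mk.
suff <- : dbl = (fun n => Num.sqrt (2 * pi * bern_var (2 * n) (cst (2^-1 : R))) *
   (bern_poly (2 * n) (cst (2^-1 : R)))`_n) by [].
apply/funext => n; rewrite v coef_bern_poly_half /dbl; congr (Num.sqrt _ * _).
by move: pi n%:R => x y; field.
Unshelve. all: by end_near. Qed.

(** An exact identity: the logarithm of the central binomial coefficient written with [Gamma (2n)]
    and [Gamma n]. *)
Lemma stirling_err_double n : (0 < n)%N ->
  stirling_err (2 * n) - 2 * stirling_err n = ln (dbl n) - 2^-1 * ln (2 * pi).
Proof.
move=> n0; have n0' : 0 < n%:R :> R by rewrite ltr0n.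
have G0 := Gamma_gt0 n0'.
have n20 : 0 < 2 * n%:R :> R by rewrite mulr_gt0.
have G20 := Gamma_gt0 n20.
have fG k : (0 < k)%N -> k`!%:R = k%:R * Gamma k%:R :> R.
  by move=> k0; rewrite -GammaS ?ltr0n// natr1 Gamma_nat.
have hC : 'C(2 * n, n)%:R * (n%:R * Gamma n%:R * (n%:R * Gamma n%:R)) =
    2 * n%:R * Gamma (2 * n%:R) :> R.
  rewrite -natrM -!fG ?muln_gt0// -natrM.
  have := @bin_fact (2 * n) n; have -> : (2 * n - n = n)%N by lia.
  by rewrite leq_pmull// => /(_ isT) <-; rewrite -natrM.
have C0 : 0 < 'C(2 * n, n)%:R :> R by rewrite ltr0n bin_gt0 leq_pmull.
rewrite /dbl; move: ('C(2 * n, n)%:R) C0 hC => C C0 hC.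
have lnM' (x y : R) : 0 < x -> 0 < y -> ln (x * y) = ln x + ln y.
  by move=> x0 y0; rewrite lnM ?posrE.
have nG := mulr_gt0 n0' G0; have nGnG := mulr_gt0 nG nG.
have hL := congr1 (@ln R) hC; rewrite (lnM' _ _ C0 nGnG) (lnM' _ _ nG nG) (lnM' _ _ n0' G0) (lnM' _ _ n20 G20) in hL.
rewrite (lnM' _ _ (ltr0n _ 2) n0') in hL.
have pi0 : 0 < pi :> R by exact: pi_gt0.
have pn0 := mulr_gt0 pi0 n0'.
have s0 : 0 < Num.sqrt (pi * n%:R) :> R by rewrite sqrtr_gt0.
have e0 : 0 < (2 ^+ (2 * n))^-1 :> R by rewrite invr_gt0 exprn_gt0.
have q0 := mulr_gt0 C0 e0.
rewrite -powR12_sqrt ?(ltW pn0)// in s0 *.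
rewrite !lnM ?posrE// ln_powR lnV ?posrE ?exprn_gt0// lnXn// !lnM ?posrE//.
rewrite /stirling_err natrM !lnM ?posrE//.
have -> : ln C = ln 2 + ln n%:R + ln (Gamma (2 * n%:R)) -
   (ln n%:R + ln (Gamma n%:R) + (ln n%:R + ln (Gamma n%:R))) :> R by rewrite -hL; ring.
rewrite -[_ *+ (2 * n)]mulr_natr natrM.
have alg (g1 g2 l1 l2 l3 x : R) :
  g2 - (2 * x - 2^-1) * (l3 + l1) + 2 * x - 2 * (g1 - (x - 2^-1) * l1 + x) =
  2^-1 * (l2 + l1) + (l3 + l1 + g2 - (l1 + g1 + (l1 + g1)) - l3 * (2 * x)) - 2^-1 * (l3 + l2).
  by field.
exact: alg.
Qed.

(** If [l] is the limit of the error, the doubling identity gives [l - 2 l = - (1/2) log (2 pi)] in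
    the limit, which determines [l]. *)
Lemma stirling : stirling_err n @[n --> \oo] --> (2^-1 * ln (2 * pi) : R).
Proof.
have h := is_cvg_stirling_err; set l := limn stirling_err in h.
have h2 : stirling_err (2 * n) @[n --> \oo] --> l.
  apply: (cvg_comp _ _ _ h); apply/cvgnyPge => A; near=> n.
  rewrite (@leq_trans n)// ?leq_pmull//; near: n; exact: nbhs_infty_ge.
have h3 : stirling_err (2 * n) - 2 * stirling_err n @[n --> \oo] --> l - 2 * l.
  by apply: cvgB => //; apply: cvgMr.
have h4 : ln (dbl n) - 2^-1 * ln (2 * pi) @[n --> \oo] --> (ln 1 - 2^-1 * ln (2 * pi) : R).
  apply: cvgB; last exact: cvg_cst.
  by apply: (cvg_comp _ _ central_binomial_cvg); exact: continuous_ln.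
have h5 : stirling_err (2 * n) - 2 * stirling_err n @[n --> \oo] --> (ln 1 - 2^-1 * ln (2 * pi) : R).
  apply: cvg_trans h4; apply: near_eq_cvg; near=> n; rewrite stirling_err_double//.
  by near: n; exact: nbhs_infty_gt.
have e : l - 2 * l = ln 1 - 2^-1 * ln (2 * pi) by exact: (cvg_unique _ h3 h5).
rewrite ln1 in e.
have -> : 2^-1 * ln (2 * pi) = l by lra.
exact: h.
Unshelve. all: by end_near. Qed.

End stirling.

(** * Expansion of Psi for exact power laws *)

Section rate_sums.
Variables (R : realType) (alpha A w : R).
Hypothesis alpha_gt1 : 1 < alpha.
Hypothesis A0 : 0 < A.
Hypothesis w0 : 0 < w.
Local Notation mu := (@lebesgue_measure R).
Implicit Types x y z : R.

Let alpha0 : 0 < alpha. Proof. by rewrite (lt_trans _ alpha_gt1). Qed.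

(** [outer_rate] is the function sampled by [Psi], used for [x >= 1]; [inner_rate] replaces it on
    [[0, 1]], where it is bounded, the difference being [ln A - alpha ln x] (see
    [ln_odds_inner]). *)
Definition inner_rate (x : R) : R := ln (1 + A^-1 * ppow alpha x).
Definition outer_rate (x : R) : R := ln (1 + A * x `^ (- alpha)).
Local Notation g := inner_rate.
Local Notation h := outer_rate.

Let AV0 : 0 < A^-1. Proof. by rewrite invr_gt0. Qed.

Let gden x : 0 < 1 + A^-1 * ppow alpha x.
Proof. by rewrite ltr_wpDr// mulr_ge0 ?ppow_ge0// ltW. Qed.

Let hden x : 0 < 1 + A * x `^ (- alpha).
Proof. by rewrite ltr_wpDr// mulr_ge0 ?powR_ge0// ltW. Qed.

Lemma inner_rate_continuous : continuous g.
Proof.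
move=> x; apply: (@continuous_comp _ _ _ (fun x => 1 + A^-1 * ppow alpha x) (@ln R)).
  by apply: cvgD; [exact: cvg_cst|apply: cvgMr; exact: ppow_continuous].
exact: continuous_ln.
Qed.

(** The derivative of [inner_rate] need not be monotone. It is split into a nondecreasing factor
    [u1] and a nonincreasing factor [u2], so that it can be bounded on a cell by values at the
    endpoints. *)
Let u1 (x : R) := alpha * ppow (alpha - 1) x.
Let u2 (x : R) := (A + ppow alpha x)^-1.

Let den x : 0 < A + ppow alpha x. Proof. by rewrite ltr_wpDr// ppow_ge0. Qed.

Lemma is_derive_inner_rate x : 0 < x -> is_derive x 1 g (u1 x * u2 x).
Proof.
move=> x0; have h1 := is_derive_ppow alpha x0.
have h2 : is_derive x 1 (fun x => 1 + A^-1 * ppow alpha x) (A^-1 * (alpha * x `^ (alpha - 1))).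
  have hD := is_deriveD (is_derive_cst (1 : R) x 1) (is_deriveZ A^-1 h1).
  by apply: (@is_derive_eq _ _ _ _ _ _ _ _ hD); rewrite add0r.
have h3 := @is_derive1_comp _ (@ln R) _ x _ _ (is_derive1_ln (gden x)) h2.
apply: (@is_derive_eq _ _ _ _ _ _ _ _ h3).
rewrite /u1 /u2 [ppow (alpha - 1) x]ppowE//; field.
by rewrite !lt0r_neq0//=; have := gden x; rewrite -(pmulr_rgt0 _ A0) mulrDr mulr1 mulrA divff ?mul1r ?lt0r_neq0.
Qed.

Let u1_ge0 x : 0 <= u1 x.
Proof. by rewrite mulr_ge0 ?ppow_ge0// ltW. Qed.

Let u1_homo : {homo u1 : x y / x <= y}.
Proof.
by move=> x y xy; rewrite ler_wpM2l ?(ltW alpha0)// ppow_homo// subr_ge0 ltW.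
Qed.

Let u2_ge0 x : 0 <= u2 x. Proof. by rewrite invr_ge0 ltW. Qed.

Let u2_le x : u2 x <= A^-1.
Proof. by rewrite lef_pV2 ?posrE// lerDl ppow_ge0. Qed.

Let u2_homo x y : x <= y -> u2 y <= u2 x.
Proof. by move=> xy; rewrite lef_pV2 ?posrE// lerD2l ppow_homo// ltW. Qed.

(** An integer, so that moving by [W] cells is a shift of the index and [sum_shift_le] applies; at
    least [1], as [euler_sum] requires. *)
Let W := (Num.bound w).+1.
Let wW : 0 <= w <= W%:R.
Proof.
rewrite ltW//= ltW// (lt_trans (unstable.ltr_bound w))//.
by rewrite ltr_nat.
Qed.
Let W1 : 1 <= W%:R :> R. Proof. by rewrite ler1n. Qed.

Lemma inner_rate_sum : exists K : R, forall n : nat, (0 < n)%N ->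
  `|\sum_(0 <= j < n) g ((w + j%:R) / n%:R) - n%:R * primitive g 0 1 -
    (w - 2^-1) * g 1| <= K / n%:R.
Proof.
pose U := u1 (1 + W%:R); exists ((2 * w + 1) * (2 * W%:R * U / A)) => n n0.
have n0' : 0 < n%:R :> R by rewrite ltr0n.
have cg x : 0 <= x -> {for x, continuous g} by move=> _; exact: inner_rate_continuous.
have Dg x : 0 < x -> is_derive x 1 g (u1 x * u2 x) by exact: is_derive_inner_rate.
have cG b c : 0 <= b -> {within `[b, c], continuous (primitive g 0)}.
  by move=> b0; apply: (primitive_continuous cg).
have DG x : 0 < x -> is_derive x 1 (primitive g 0) (g x).
  by move=> x0; apply: (is_derive_primitive cg).
pose m (j : nat) := u1 (j%:R / n%:R) * u2 ((j + W)%:R / n%:R).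
pose M (j : nat) := u1 ((j + W)%:R / n%:R) * u2 (j%:R / n%:R).
have bd j x : (0 <= j < n)%N -> j%:R / n%:R < x < (j%:R + W%:R) / n%:R ->
    m j <= u1 x * u2 x <= M j.
  move=> _; rewrite -natrD => /andP[/ltW x1 /ltW x2].
  by rewrite /m /M; apply/andP; split; apply: ler_pM => //; do ?[exact: u1_homo|exact: u2_homo].
have := @euler_sum R g (fun x => u1 x * u2 x) (primitive g 0) 0 cg Dg cG DG n 0 n
  w W%:R m M n0 (leq0n n).
rewrite mul0r lexx divff ?lt0r_neq0// => /(_ isT wW W1 bd).
have g0 : g 0 = 0 by rewrite /g /ppow ltxx mulr0 addr0 ln1.
rewrite primitive_left subr0 g0 subr0 => hs; apply: (le_trans hs).
rewrite mulrAC ler_pM2r ?invr_gt0//.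
apply: ler_wpM2l; first by rewrite addr_ge0// mulr_ge0// ltW.
have jU j : (0 <= j <= n + W)%N -> 0 <= u1 (j%:R / n%:R) <= U.
  move=> jn; rewrite u1_ge0; apply: u1_homo; rewrite ler_pdivrMr//.
  apply: (@le_trans _ _ (n + W)%:R); first by rewrite ler_nat; case/andP: jn.
  by rewrite natrD mulrDl mul1r lerD2l ler_peMr// ler1n.
have s1 := @sum_shift_le R (fun j => u1 (j%:R / n%:R)) 0 U 0 n W (leq0n n) jU.
have s2 := @sum_shift_le R (fun j => - u2 (j%:R / n%:R)) (- A^-1) 0 0 n W (leq0n n).
have {}s2 : \sum_(0 <= j < n) (- u2 ((j + W)%:R / n%:R) - - u2 (j%:R / n%:R)) <= W%:R / A.
  by move: s2; rewrite opprK add0r; apply => j _; rewrite lerN2 u2_le oppr_le0 u2_ge0.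
rewrite subr0 in s1.
(* Each oscillation is split as [(u1' - u1) u2 + u1 (u2 - u2')], primes denoting the shift by [W],
   with [u2 <= A^-1] and [u1 <= U]; the two shift sums stay bounded. *)
apply: (@le_trans _ _ (A^-1 * (\sum_(0 <= j < n) (u1 ((j + W)%:R / n%:R) - u1 (j%:R / n%:R))) +
   U * \sum_(0 <= j < n) (- u2 ((j + W)%:R / n%:R) - - u2 (j%:R / n%:R)))); last first.
  have -> : 2 * W%:R * U / A = A^-1 * (W%:R * U) + U * (W%:R / A) by ring.
  have U0 : 0 <= U by exact: u1_ge0.
  by apply: lerD; apply: ler_wpM2l => //; exact: ltW.
rewrite !mulr_sumr -big_split/= !big_nat; apply: ler_sum => j jn.
have /andP[_ hU] : 0 <= u1 (j%:R / n%:R) <= U.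
  by apply: jU; case/andP: jn => _ /ltnW jn'; rewrite (leq_trans jn')// leq_addr.
have st : j%:R / n%:R <= (j + W)%:R / n%:R :> R.
  by rewrite ler_pM2r ?invr_gt0// ler_nat leq_addr.
have d1 : 0 <= u1 ((j + W)%:R / n%:R) - u1 (j%:R / n%:R) by rewrite subr_ge0 u1_homo.
have d2 : 0 <= u2 (j%:R / n%:R) - u2 ((j + W)%:R / n%:R) by rewrite subr_ge0 u2_homo.
have e1 := ler_wpM2r d1 (u2_le (j%:R / n%:R)).
have e2 := ler_wpM2r d2 hU.
rewrite /M /m opprK [- u2 _ + _]addrC; lra.
Qed.

Lemma is_derive_outer_rate x : 0 < x ->
  is_derive x 1 h (- (alpha * A / (x * x `^ alpha + A * x))).
Proof.
move=> x0; have h1 := is_derive1_powR (- alpha) x0.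
have h2 : is_derive x 1 (fun x => 1 + A * x `^ (- alpha)) (A * (- alpha * x `^ (- alpha - 1))).
  have hD := is_deriveD (is_derive_cst (1 : R) x 1) (is_deriveZ A h1).
  by apply: (@is_derive_eq _ _ _ _ _ _ _ _ hD); rewrite add0r.
have h3 := @is_derive1_comp _ (@ln R) _ x _ _ (is_derive1_ln (hden x)) h2.
apply: (@is_derive_eq _ _ _ _ _ _ _ _ h3).
have p0 := powR_gt0 alpha x0.
rewrite powRB ?(lt0r_neq0 x0) ?implybT// powRr1 ?(ltW x0)// powRN.
field.
by rewrite !lt0r_neq0// addr_gt0 ?mulr_gt0.
Qed.

Lemma outer_rate_continuous x : 0 < x -> {for x, continuous h}.
Proof.
move=> x0; have [D _] := is_derive_outer_rate x0.
exact/differentiable_continuous/derivable1_diffP.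
Qed.

Lemma outer_rate_ge0 x : 0 <= h x.
Proof. by apply: ln_ge0; rewrite lerDl mulr_ge0 ?powR_ge0// ltW. Qed.

Lemma outer_rate_le x : h x <= A * x `^ (- alpha).
Proof. by apply: le_ln1Dx; rewrite (lt_le_trans (ltrN10 R))// mulr_ge0 ?powR_ge0// ltW. Qed.

Let ch x : 1 <= x -> {for x, continuous h}.
Proof. by move=> x1; apply: outer_rate_continuous; exact: lt_le_trans x1. Qed.

Lemma primitive_outer_rate_le x : 1 <= x -> primitive h 1 x <= A / (alpha - 1).
Proof.
move=> x1; have a1 : 0 < alpha - 1 by rewrite subr_gt0.
suff : primitive h 1 x - primitive h 1 1 <=
    - (A / (alpha - 1)) * x `^ (1 - alpha) - - (A / (alpha - 1)) * 1 `^ (1 - alpha).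
  have : 0 <= A / (alpha - 1) * x `^ (1 - alpha).
    by rewrite mulr_ge0 ?powR_ge0// divr_ge0// ltW.
  rewrite powR1 primitive_left; lra.
apply: (@ler_deriv R (primitive h 1)
  (fun x => - (A / (alpha - 1)) * x `^ (1 - alpha)) h
  (fun x => A * x `^ (- alpha)) 1 x x1).
- by move=> z; rewrite in_itv/= => /andP[z1 _]; apply: is_derive_primitive.
- move=> z; rewrite in_itv/= => /andP[z1 _].
  have z0 : 0 < z by exact: lt_trans z1.
  have := is_derive1_powR (1 - alpha) z0 => D.
  apply: is_derive_eq; rewrite /GRing.scale/= (_ : 1 - alpha - 1 = - alpha); last by ring.
  by field; rewrite lt0r_neq0.
- by apply: primitive_continuous.
- apply: continuous_in_subspaceT => z; rewrite inE/= in_itv/= => /andP[z1 _].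
  have z0 : 0 < z by exact: lt_le_trans z1.
  by apply: cvgMr; exact: powR_continuous.
- by move=> z _; exact: outer_rate_le.
Qed.

Lemma primitive_outer_rate_cvg :
  primitive h 1 x @[x --> +oo] --> \int[mu]_(t in `[1, +oo[) h t.
Proof.
apply: (@primitive_cvg R h 1 ch (A / (alpha - 1))).
  by move=> x _; exact: outer_rate_ge0.
exact: primitive_outer_rate_le.
Qed.

Lemma outer_rate_cvg : h x @[x --> +oo] --> (0 : R).
Proof.
have hp : A * x `^ (- alpha) @[x --> +oo] --> (0 : R).
  apply/cvgrPdist_le => e e0; near=> x.
  have x0 : 0 < x by near: x; apply: nbhs_pinfty_gt; rewrite num_real.
  have xe : (e^-1 * A) `^ alpha^-1 <= x by near: x; apply: nbhs_pinfty_ge; rewrite num_real.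
  rewrite sub0r normrN ger0_norm; last by rewrite mulr_ge0 ?powR_ge0// ltW.
  rewrite powRN ler_pdivrMr ?powR_gt0// -ler_pdivrMl//.
  have q0 : 0 < e^-1 * A by rewrite mulr_gt0// invr_gt0.
  have -> : e^-1 * A = ((e^-1 * A) `^ alpha^-1) `^ alpha.
    by rewrite -powRrM mulVf ?lt0r_neq0// powRr1// ltW.
  by apply: ge0_ler_powR; rewrite ?nnegrE ?powR_ge0// ?(ltW x0) ?(ltW alpha0).
apply: (@squeeze_cvgr _ _ _ _ (fun=> 0) (fun x => A * x `^ (- alpha))) => //; last exact: cvg_cst.
by apply: nearW => x; rewrite outer_rate_ge0 outer_rate_le.
Unshelve. all: by end_near. Qed.

(** On [[1, +oo[] the derivative is nondecreasing and stays between [- alpha] and [0], so its values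
    at the ends of a cell bound it and the shift sum is bounded. The constant [K] does not depend on
    [b], which allows [b] to tend to infinity for fixed [n]. *)
Lemma outer_rate_sum : exists K : R, forall n b : nat, (0 < n)%N -> (n <= b)%N ->
  `|\sum_(n <= j < b) h ((w + j%:R) / n%:R) - n%:R * primitive h 1 (b%:R / n%:R) -
    (w - 2^-1) * (h (b%:R / n%:R) - h 1)| <= K / n%:R.
Proof.
exists ((2 * w + 1) * (W%:R * alpha)) => n b n0 nb.
have n0' : 0 < n%:R :> R by rewrite ltr0n.
have Dh x : 1 < x -> is_derive x 1 h (- (alpha * A / (x * x `^ alpha + A * x))).
  by move=> x1; apply: is_derive_outer_rate; exact: lt_trans x1.
have cG d e : 1 <= d -> {within `[d, e], continuous (primitive h 1)}.
  by move=> d1; apply: (primitive_continuous ch).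
have DG x : 1 < x -> is_derive x 1 (primitive h 1) (h x).
  by move=> x1; apply: (is_derive_primitive ch).
pose v x := - (alpha * A / (x * x `^ alpha + A * x)) : R.
have vden x : 0 < x -> 0 < x * x `^ alpha + A * x.
  by move=> x0; rewrite addr_gt0// mulr_gt0// powR_gt0.
have v_homo x y : 0 < x -> x <= y -> v x <= v y.
  move=> x0 xy; have y0 := lt_le_trans x0 xy.
  rewrite /v lerN2 ler_wpM2l//; first by rewrite mulr_ge0// ltW.
  rewrite lef_pV2 ?posrE ?vden//; apply: lerD; last by rewrite ler_wpM2l// ltW.
  apply: ler_pM => //; rewrite ?powR_ge0 ?(ltW x0)//.
  by apply: ge0_ler_powR => //; rewrite ?nnegrE ltW.
have v_bound x : 1 <= x -> - alpha <= v x <= 0.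
  move=> x1; have x0 : 0 < x by exact: lt_le_trans x1.
  rewrite /v lerN2 oppr_le0; apply/andP; split; last first.
    by rewrite divr_ge0 ?mulr_ge0// ltW// vden.
  rewrite ler_pdivrMr ?vden// ler_pM2l//.
  apply: (@le_trans _ _ (A * x)); first by rewrite ler_peMr// ltW.
  by rewrite lerDr mulr_ge0 ?powR_ge0// ltW.
have bd j x : (n <= j < b)%N -> j%:R / n%:R < x < (j%:R + W%:R) / n%:R ->
    v (j%:R / n%:R) <= v x <= v ((j + W)%:R / n%:R).
  move=> /andP[nj _]; rewrite -natrD => /andP[x1 /ltW x2].
  have j0 : 0 < j%:R / n%:R :> R by rewrite divr_gt0// ltr0n (leq_trans n0).
  apply/andP; split; first by apply: v_homo => //; exact: ltW.
  by apply: v_homo => //; exact: lt_trans x1.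
have := @euler_sum R h v (primitive h 1) 1 ch Dh cG DG n n b w W%:R
  (fun j => v (j%:R / n%:R)) (fun j => v ((j + W)%:R / n%:R)) n0 nb.
rewrite divff ?lt0r_neq0// lexx => /(_ isT wW W1 bd).
rewrite primitive_left subr0 => hs; apply: (le_trans hs).
rewrite mulrAC ler_pM2r ?invr_gt0//.
apply: ler_wpM2l; first by rewrite addr_ge0// mulr_ge0// ltW.
have vb j : (n <= j <= b + W)%N -> - alpha <= v (j%:R / n%:R) <= 0.
  move=> /andP[nj _]; apply: v_bound; by rewrite ler_pdivlMr// mul1r ler_nat.
have := @sum_shift_le R (fun j => v (j%:R / n%:R)) (- alpha) 0 n b W nb vb.
by rewrite opprK add0r.
Qed.

Lemma ln_odds_inner x : 0 < x ->
  ln (1 + A * x `^ (- alpha)) = g x + ln A - alpha * ln x.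
Proof.
move=> x0; have p0 := powR_gt0 alpha x0.
rewrite /g ppowE// -ln_powR -lnM ?posrE//; last by have := gden x; rewrite ppowE.
rewrite -ln_div ?posrE//; last first.
  by rewrite mulr_gt0//; have := gden x; rewrite ppowE.
by rewrite powRN; congr ln; field; rewrite !lt0r_neq0.
Qed.

End rate_sums.

Section power_law_asymptotics.
Variables (R : realType) (alpha c r w : R) (p : nat -> R).
Hypothesis alpha_gt1 : 1 < alpha.
Hypothesis c0 : 0 < c.
Hypothesis r0 : 0 < r.
Hypothesis w0 : 0 < w.
Hypothesis p01 : forall j, 0 <= p j <= 1.
Hypothesis p_sum : cvgn (series p).
Hypothesis pE : forall j, p j = c * (w + j%:R) `^ (- alpha).
Hypothesis PsiC : forall y, 0 < y ->
  series (fun j => ln (1 + p j * (y - 1))) @ \oo --> Psi p y.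
Local Notation mu := (@lebesgue_measure R).
Local Notation A := (c * r).
Local Notation g := (inner_rate alpha A).
Local Notation h := (outer_rate alpha A).

Let alpha0 : 0 < alpha. Proof. by rewrite (lt_trans _ alpha_gt1). Qed.
Let A0 : 0 < A. Proof. by rewrite mulr_gt0. Qed.
Let y (n : nat) : R := r * n%:R `^ alpha.
Let x (n j : nat) : R := (w + j%:R) / n%:R.

Let x_gt0 n j : (0 < n)%N -> 0 < x n j.
Proof. by move=> n0; rewrite divr_gt0 ?ltr0n// ltr_wpDr. Qed.

(** For an exact power law the scaling is exact at the points [(w + j)/n], which is why the rates
    are sampled there rather than at [j/n]. *)
Let pyE n j : (0 < n)%N -> p j * y n = A * x n j `^ (- alpha).
Proof.
move=> n0; have n0' : 0 < n%:R :> R by rewrite ltr0n.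
have wj : 0 < w + j%:R by rewrite ltr_wpDr.
rewrite pE /y /x powRM ?(ltW wj) ?invr_ge0 ?(ltW n0')//.
rewrite -(powR_inv1 (ltW n0')) -powRrM mulN1r opprK; ring.
Qed.

(* Each logarithm changes by at most [min p (1 / y)]; the bound [1 / y] is used for
   the first [n] terms. *)
Let shift_bound n b : (0 < n)%N -> (n <= b)%N -> 1 <= y n ->
  0 <= \sum_(0 <= j < b) ln (1 + p j * y n) - \sum_(0 <= j < b) ln (1 + p j * (y n - 1))
    <= n%:R / y n + (limn (series p) - series p n).
Proof.
move=> n0 nb y1; have y0 : 0 < y n by exact: lt_le_trans y1.
have den j : 1 <= 1 + p j * (y n - 1).
  by have /andP[pj _] := p01 j; rewrite lerDl mulr_ge0// subr_ge0.
have den0 j : 0 < 1 + p j * (y n - 1) by exact: lt_le_trans (den j).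
have num0 j : 0 < 1 + p j * y n.
  by have /andP[pj _] := p01 j; rewrite ltr_wpDr// mulr_ge0// ltW.
have dE j : ln (1 + p j * y n) - ln (1 + p j * (y n - 1)) =
    ln (1 + p j / (1 + p j * (y n - 1))).
  rewrite -ln_div ?posrE//; congr ln; field; exact: lt0r_neq0.
have q0 j : 0 <= p j / (1 + p j * (y n - 1)).
  by have /andP[pj _] := p01 j; rewrite divr_ge0// ltW.
have dle j : ln (1 + p j * y n) - ln (1 + p j * (y n - 1)) <=
    p j / (1 + p j * (y n - 1)).
  by rewrite dE; apply: le_ln1Dx; rewrite (lt_le_trans (ltrN10 R)).
rewrite -sumrB; apply/andP; split.
  by apply: sumr_ge0 => j _; rewrite dE ln_ge0// lerDl.
rewrite (@big_cat_nat _ _ _ n)//=; apply: lerD.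
  apply: (@le_trans _ _ (\sum_(0 <= j < n) (y n)^-1)).
    apply: ler_sum => j _; apply: (le_trans (dle j)).
    rewrite ler_pdivrMr// ler_pdivlMl//.
    by have /andP[_ pj] := p01 j; lra.
  by rewrite sumr_const_nat subn0 -[leLHS]mulr_natl.
apply: (@le_trans _ _ (\sum_(n <= j < b) p j)).
  apply: ler_sum => j _; apply: (le_trans (dle j)).
  by have /andP[pj _] := p01 j; rewrite ler_pdivrMr// ler_peMr.
have -> : \sum_(n <= j < b) p j = series p b - series p n.
  by rewrite /series/= (@big_cat_nat _ _ _ n 0%N b)//= addrAC subrr add0r.
rewrite lerD2r; apply: nondecreasing_cvgn_le => //.
by apply: nondecreasing_series => j _ _; have /andP[] := p01 j.
Qed.

(** For fixed [n] the partial sum up to [b] is split at [j = n], the logarithmic identity is applied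
    to the first block, and both blocks are estimated uniformly in [b]. Only then do [b], and
    afterwards [n], tend to infinity. *)
Lemma Psi_expansion :
  Psi p (r * n%:R `^ alpha) -
    (n%:R * (primitive g 0 1 + \int[mu]_(t in `[1, +oo[) h t) + n%:R * ln A -
     (w - 2^-1) * ln A - alpha * \sum_(0 <= j < n) ln ((w + j%:R) / n%:R))
    @[n --> \oo] --> (0 : R).
Proof.
have [Kg hKg] := inner_rate_sum alpha_gt1 A0 w0.
have [Kh hKh] := outer_rate_sum alpha_gt1 A0 w0.
set Ih := \int[mu]_(t in _) _.
(* The error budget: [1/n] from the two Euler sums, [n / y n = r^-1 n^(1 - alpha)] from having
   [y - 1] instead of [y] in the first [n] terms, and the tail of the series of [p] from the
   others. *)
pose e n : R := (Kg + Kh) * n%:R `^ (- 1) + (r^-1 * n%:R `^ (- (alpha - 1)) +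
   (limn (series p) - series p n)).
have he : e n @[n --> \oo] --> ((Kg + Kh) * 0 + (r^-1 * 0 + (limn (series p) - limn (series p))) : R).
  apply: cvgD; first by apply: cvgMr; exact: natpowN_cvg0.
  apply: cvgD; first by apply: cvgMr; apply: natpowN_cvg0; rewrite subr_gt0.
  by apply: cvgB => //; exact: cvg_cst.
rewrite !mulr0 subrr !addr0 in he.
have yoo : \forall n \near \oo, 1 <= y n.
  have := @natpowN_cvg0 R alpha alpha0 => /cvgrPdist_le/(_ r r0) hr; near=> n.
  have n0 : (0 < n)%N by near: n; exact: nbhs_infty_gt.
  have : `|0 - n%:R `^ (- alpha)| <= r by near: n.
  rewrite sub0r normrN ger0_norm ?powR_ge0// powRN /y => hn.
  by rewrite -ler_pdivrMr ?powR_gt0 ?ltr0n// mul1r.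
apply/norm_cvg0P.
apply: (@squeeze_cvgr _ _ _ _ (fun=> 0) e) => //; last exact: cvg_cst.
near=> n; rewrite normr_ge0/=.
have n0 : (0 < n)%N by near: n; exact: nbhs_infty_gt.
have n0' : 0 < n%:R :> R by rewrite ltr0n.
have y1 : 1 <= y n by near: n.
have y0 : 0 < y n by exact: lt_le_trans y1.
set L := \sum_(0 <= j < n) ln _.
pose Z : R := n%:R * primitive g 0 1 + (w - 2^-1) * g 1 + n%:R * ln A - alpha * L.
have bn : b%:R / n%:R @[b --> \oo] --> (+oo : set_system R).
  apply/cvgryPge => C; near=> b; rewrite ler_pdivlMr//.
  by near: b; exact: nbhs_infty_ger.
have hcv : series (fun j => ln (1 + p j * (y n - 1))) b -
   (Z + n%:R * primitive h 1 (b%:R / n%:R) + (w - 2^-1) * (h (b%:R / n%:R) - h 1))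
   @[b --> \oo] --> Psi p (y n) - (Z + n%:R * Ih + (w - 2^-1) * (0 - h 1)).
  apply: cvgB; first exact: PsiC.
  apply: cvgD; first apply: cvgD; first exact: cvg_cst.
    by apply: cvgMr; apply: (cvg_comp _ _ bn); exact: primitive_outer_rate_cvg.
  apply: cvgMr; apply: cvgB; last exact: cvg_cst.
  by apply: (cvg_comp _ _ bn); exact: outer_rate_cvg.
(* The boundary terms of the two blocks at [x = 1] do not cancel; they leave [- (w - 1/2) ln A], the
   origin of the factor [(c r)^(1/2 - w)]. *)
have gh : g 1 - h 1 = - ln A.
  have := ln_odds_inner alpha A0 ltr01; rewrite ln1 mulr0 subr0 -/(h 1) => ->.
  by rewrite opprD addNKr.
have -> : Psi p (r * n%:R `^ alpha) - (n%:R * (primitive g 0 1 + Ih) + n%:R * ln A -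
    (w - 2^-1) * ln A - alpha * L) = Psi p (y n) - (Z + n%:R * Ih + (w - 2^-1) * (0 - h 1)).
  have hA : ln A = h 1 - g 1 by rewrite -[RHS]opprB gh opprK.
  rewrite /Z hA; ring.
apply: (ler_cvg_to (cvg_norm hcv) (cvg_cst (e n))); near=> b.
have nb : (n <= b)%N by near: b; exact: nbhs_infty_ge.
have /andP[d1 d2] := shift_bound n0 nb y1.
have hg := hKg n n0; have hh := hKh n b n0 nb.
have T1 : \sum_(0 <= j < b) ln (1 + p j * y n) =
   \sum_(0 <= j < n) g (x n j) + n%:R * ln A - alpha * L + \sum_(n <= j < b) h (x n j).
  rewrite (@big_cat_nat _ _ _ n)//=; congr (_ + _); last first.
    by apply: eq_bigr => j _; rewrite pyE.
  rewrite /L mulr_sumr.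
  have -> : n%:R * ln A = \sum_(0 <= j < n) ln A by rewrite sumr_const_nat subn0 mulr_natl.
  rewrite -big_split -sumrB/=; apply: eq_bigr => j _.
  by rewrite pyE// ln_odds_inner// x_gt0.
have en : (Kg + Kh) / n%:R + (n%:R / y n + (limn (series p) - series p n)) = e n.
  rewrite /e powR_inv1 ?(ltW n0')//; congr (_ + (_ + _)).
  rewrite /y opprB powRB ?(lt0r_neq0 n0') ?implybT// powRr1 ?(ltW n0')//; field.
  by rewrite !lt0r_neq0// powR_gt0.
rewrite -en /= [series _ b]/series/=.
set T := \sum_(0 <= j < b) ln (1 + p j * y n) in d1 d2 T1.
set S := \sum_(0 <= j < b) _ in d1 d2 *.
set D := n%:R / y n + _ in d2 *.
rewrite -/(x n _) in hg hh.
set Sg := \sum_(0 <= j < n) _ in T1 hg; set Sh := \sum_(n <= j < b) _ in T1 hh.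
have -> : S - (Z + n%:R * primitive h 1 (b%:R / n%:R) + (w - 2^-1) * (h (b%:R / n%:R) - h 1)) =
  (Sg - n%:R * primitive g 0 1 - (w - 2^-1) * g 1) +
  (Sh - n%:R * primitive h 1 (b%:R / n%:R) - (w - 2^-1) * (h (b%:R / n%:R) - h 1)) - (T - S).
  rewrite T1 /Z; ring.
apply: (le_trans (ler_normB _ _)); apply: lerD; last by rewrite ger0_norm.
by rewrite [leRHS]mulrDl; exact: (le_trans (ler_normD _ _) (lerD hg hh)).
Unshelve. all: by end_near. Qed.

(** By the functional equation the sum is exactly [ln Gamma (w + n) - ln Gamma w - n ln n]; the
    ratio limit reduces [Gamma (w + n)] to [Gamma n], and Stirling's formula does the rest. *)
Lemma sum_ln_shift_expansion :
  \sum_(0 <= j < n) ln ((w + j%:R) / n%:R) -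
    (2^-1 * ln (2 * pi) + (w - 2^-1) * ln n%:R - n%:R - ln (Gamma w))
    @[n --> \oo] --> (0 : R).
Proof.
have h1 : ln (Gamma (w + n%:R) / (n%:R `^ w * Gamma n%:R)) +
    (stirling_err R n - 2^-1 * ln (2 * pi)) @[n --> \oo] -->
    (ln 1 + (2^-1 * ln (2 * pi) - 2^-1 * ln (2 * pi)) : R).
  apply: cvgD.
    by apply: (cvg_comp _ _ (Gamma_ratio_cvg w0)); exact: continuous_ln.
  by apply: cvgB; [exact: stirling|exact: cvg_cst].
rewrite ln1 subrr addr0 in h1.
apply: cvg_trans h1; apply: near_eq_cvg; near=> n.
have n0 : (0 < n)%N by near: n; exact: nbhs_infty_gt.
have n0' : 0 < n%:R :> R by rewrite ltr0n.
have wn : 0 < w + n%:R by rewrite addr_gt0.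
have S : \sum_(0 <= j < n) ln ((w + j%:R) / n%:R) =
    ln (Gamma (w + n%:R)) - ln (Gamma w) - n%:R * ln n%:R.
  have -> : n%:R * ln n%:R = \sum_(0 <= j < n) ln n%:R :> R.
    by rewrite sumr_const_nat subn0 mulr_natl.
  have -> : ln (Gamma (w + n%:R)) - ln (Gamma w) = ln (Gamma (w + n%:R)) - ln (Gamma (w + 0%:R)).
    by rewrite addr0.
  rewrite -(telescope_sumr (fun j : nat => ln (Gamma (w + j%:R))) (leq0n n)) -sumrB.
  apply: eq_bigr => j _; have wj : 0 < w + j%:R by rewrite ltr_wpDr.
  by rewrite ln_div ?posrE// -natr1 addrA GammaS// lnM ?posrE ?Gamma_gt0// addrK.
rewrite S ln_div ?posrE ?mulr_gt0 ?powR_gt0 ?Gamma_gt0//.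
rewrite lnM ?posrE ?powR_gt0 ?Gamma_gt0// ln_powR /stirling_err.
have alg (g1 g2 g3 l u q : R) : g1 - (w * l + g2) + (g2 - (u - 2^-1) * l + u - q) =
  g1 - g3 - u * l - (q + (w - 2^-1) * l - u - g3) by ring.
exact: alg.
Unshelve. all: by end_near. Qed.

Lemma gamma_rateE : gamma_rate c alpha r =
  primitive g 0 1 + \int[mu]_(t in `[1, +oo[) h t + alpha + ln c.
Proof.
rewrite /gamma_rate; congr (_ + _ + _ + _).
apply: eq_Rintegral => t; rewrite inE/= in_itv/= => /andP[t0 _].
by rewrite /inner_rate ppow_ge0E// lt0r_neq0.
Qed.

(** In logarithms the quotient is exactly [E1 - alpha E2], a combination of the two vanishing
    errors. In [gamma_rate], the term [alpha] comes from the [- n] of Stirling's formula, and [ln c]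
    is what remains of [n ln (c r)] after the factor [r^-n]. *)
Lemma power_law_equiv (eta : R) : 0 < eta ->
  (Num.sqrt (2 * pi * eta))^-1 * r ^- n * n%:R `^ (- alpha * n%:R - 2^-1) *
     expR (Psi p (r * n%:R `^ alpha)) /
  ((Num.sqrt (2 * pi))^-1 `^ (alpha + 1) * (Gamma w `^ alpha / Num.sqrt eta) *
     (c * r) `^ (2^-1 - w) *
     n%:R `^ (- alpha * n%:R + 2^-1 * (alpha - 1) - w * alpha) *
     expR (gamma_rate c alpha r * n%:R)) @[n --> \oo] --> (1 : R).
Proof.
move=> eta0.
set Ih := \int[mu]_(t in `[1, +oo[) h t.
pose E1 n := Psi p (r * n%:R `^ alpha) -
    (n%:R * (primitive g 0 1 + Ih) + n%:R * ln A -
     (w - 2^-1) * ln A - alpha * \sum_(0 <= j < n) ln ((w + j%:R) / n%:R)).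
pose E2 n : R := \sum_(0 <= j < n) ln ((w + j%:R) / n%:R) -
    (2^-1 * ln (2 * pi) + (w - 2^-1) * ln n%:R - n%:R - ln (Gamma w)).
have hE : E1 n - alpha * E2 n @[n --> \oo] --> (0 - alpha * 0 : R).
  by apply: cvgB; [exact: Psi_expansion|apply: cvgMr; exact: sum_ln_shift_expansion].
rewrite mulr0 subr0 in hE.
have hx : expR (E1 n - alpha * E2 n) @[n --> \oo] --> (expR 0 : R).
  by apply: (cvg_comp _ _ hE); exact: continuous_expR.
rewrite expR0 in hx; apply: cvg_trans hx; apply: near_eq_cvg; near=> n.
have n0 : (0 < n)%N by near: n; exact: nbhs_infty_gt.
have n0' : 0 < n%:R :> R by rewrite ltr0n.
have Gw := Gamma_gt0 w0.
have p0 : 0 < pi :> R by exact: pi_gt0.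
have p2 : 0 < 2 * pi :> R by rewrite mulr_gt0// pi_gt0.
have sE (z : R) : 0 < z -> Num.sqrt z = expR (2^-1 * ln z).
  by move=> z0; rewrite -powR12_sqrt ?ltW// /powR gt_eqF.
have pE' (z a : R) : 0 < z -> z `^ a = expR (a * ln z) by move=> z0; rewrite /powR gt_eqF.
rewrite !sE ?mulr_gt0// -!expRN.
rewrite [_ `^ (alpha + 1)]pE' ?expR_gt0// expRK (pE' _ _ Gw) (pE' _ _ A0).
rewrite [n%:R `^ (_ - 2^-1)]pE'// [n%:R `^ (_ - w * alpha)]pE'//.
have -> : r ^- n = expR (- (n%:R * ln r)).
  by rewrite expRN expRM_natl lnK ?posrE.
rewrite -!expRD -expRN -expRD; congr expR.
rewrite gamma_rateE /E1 /E2 -/Ih !lnM ?posrE//.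
set S := \sum_(0 <= j < n) _.
have alg (P I l lp2 lc lr le lg lpi u Ps : R) :
   Ps - (u * (P + I) + u * (lc + lr) - (w - 2^-1) * (lc + lr) - alpha * S) -
   alpha * (S - (2^-1 * (lp2 + lpi) + (w - 2^-1) * l - u - lg)) =
   - (2^-1 * (lp2 + lpi + le)) + - (u * lr) + (- alpha * u - 2^-1) * l + Ps -
   ((alpha + 1) * - (2^-1 * (lp2 + lpi)) + (alpha * lg + - (2^-1 * le)) +
     (2^-1 - w) * (lc + lr) + (- alpha * u + 2^-1 * (alpha - 1) - w * alpha) * l +
    (P + I + alpha + lc) * u) by field.
exact: alg.
Unshelve. all: by end_near. Qed.

End power_law_asymptotics.

(** * Reducing the hypotheses of both parts to one estimate, and conclusion *)

(** With [u = w / j], one has [1 - alpha u <= (1 + u)^-alpha <= 1], the lower bound from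
    [1 + t <= exp t] and [ln (1 + u) <= u]. *)
Lemma shifted_power_dist (R : realType) (c alpha w : R) (j : nat) :
  0 < c -> 0 < alpha -> 0 < w -> (0 < j)%N ->
  `|c * (w + j%:R) `^ (- alpha) - c * j%:R `^ (- alpha)|
    <= alpha * w / j%:R * (c * j%:R `^ (- alpha)).
Proof.
move=> c0 alpha0 w0 j0; have j0' : 0 < j%:R :> R by rewrite ltr0n.
have u0 : 0 < w / j%:R by rewrite divr_gt0.
have -> : w + j%:R = j%:R * (1 + w / j%:R) by field; rewrite lt0r_neq0.
have q0 : 0 < 1 + w / j%:R by rewrite addr_gt0.
rewrite powRM ?(ltW j0') ?(ltW q0)//.
set q := (1 + w / j%:R) `^ (- alpha).
have q1 : q <= 1.
  rewrite /q powRN invf_le1 ?powR_gt0// -[leLHS](powRr0 (1 + w / j%:R)).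
  by apply: ler_powR; [rewrite lerDl ltW|exact: ltW].
have qge : 1 - alpha * (w / j%:R) <= q.
  rewrite /q /powR gt_eqF//; apply: le_trans (expR_ge1Dx _).
  rewrite lerD2l mulNr lerN2 ler_wpM2l ?(ltW alpha0)//.
  by apply: le_ln1Dx; rewrite (lt_trans (ltrN10 R)).
set k := c * j%:R `^ (- alpha); have k0 : 0 < k by rewrite mulr_gt0// powR_gt0.
rewrite mulrA -/k distrC ger0_norm; last by rewrite subr_ge0 ler_piMr// ltW.
rewrite -{1}[k]mulr1 -mulrBr mulrC ler_pM2r// -mulrA; lra.
Qed.

Lemma bigO_natV_dist (R : realType) (u : nat -> R) (p e : nat -> R) :
  (forall n, 0 <= u n) -> e =O_\oo (fun n : nat => (n%:R : R)^-1 : R^o) ->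
  (\forall n \near \oo, p n = u n * (1 + e n)) ->
  exists (C : R) (J : nat), [/\ 0 <= C, (0 < J)%N &
    forall j, (J <= j)%N -> `|p j - u j| <= C / j%:R * u j].
Proof.
move=> u0 /eqO_exP[C C0 hC] hp.
have [J _ hJ] : \forall n \near \oo, `|p n - u n| <= C / n%:R * u n.
  near=> n.
  have -> : p n = u n * (1 + e n) by near: n.
  have : `|e n| <= C * `|n%:R^-1| by near: n.
  rewrite ger0_norm ?invr_ge0// mulrDr mulr1 addrC addKr normrM ger0_norm// => he.
  by rewrite mulrC; apply: ler_wpM2r => //.
(* The successor makes the threshold positive, so that no division by [j = 0] occurs beyond it. *)
exists C, J.+1; split => //; first exact: ltW.
by move=> j jJ; apply: hJ; exact: ltnW.
Unshelve. all: by end_near. Qed.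

Lemma asymp_equiv_trans (R : realType) (a b b' : nat -> R) :
  (\forall n \near \oo, b n != 0) ->
  asymp_equiv a b -> asymp_equiv b b' -> asymp_equiv a b'.
Proof.
move=> b0 ab bb'.
have h : a n / b n * (b n / b' n) @[n --> \oo] --> (1 * 1 : R) by exact: cvgM.
rewrite mulr1 in h; apply: cvg_trans h; apply: near_eq_cvg; near=> n.
by rewrite mulrA divfK//; near: n.
Unshelve. all: by end_near. Qed.

Theorem theorem4 (R : realType) (d : measure_display) (T : measurableType d)
    (P : probability T R) (I : nat -> {RV P >-> bool}) (p : nat -> R)
    (indep : mutually_independent P I)
    (pE : forall j, P [set t | I j t = true] = (p j)%:E)
    (c alpha : R) (c_gt0 : 0 < c) (alpha_gt1 : 1 < alpha) :
  let tail (n : nat) : R := fine (P [set t | (n%:R%:E <= indicator_sum P I t)%E]) in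
  (exists r, is_rstar c alpha r) /\
  forall r : R, is_rstar c alpha r ->
    ((exists e : nat -> R,
        e =O_\oo (fun n : nat => (n%:R : R)^-1 : R^o) /\
        \forall n \near \oo, p n = c * n%:R `^ (- alpha) * (1 + e n)) ->
      (forall y : R, 0 < y ->
        cumulant_gen_fun P (indicator_sum P I) (ln y) = (Psi p y)%:E) /\
      asymp_equiv tail
        (fun n => (Num.sqrt (2 * pi * eta_star c alpha r))^-1 * r ^- n *
           n%:R `^ (- alpha * n%:R - 2^-1) *
           expR (Psi p (r * n%:R `^ alpha)))) /\
    (forall w : R, 0 < w ->
      (forall n : nat, p n = c * (w + n%:R) `^ (- alpha)) ->
      asymp_equiv tail
        (fun n => (Num.sqrt (2 * pi))^-1 `^ (alpha + 1) *
           (Gamma w `^ alpha / Num.sqrt (eta_star c alpha r)) *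
           (c * r) `^ (2^-1 - w) *
           n%:R `^ (- alpha * n%:R + 2^-1 * (alpha - 1) - w * alpha) *
           expR (gamma_rate c alpha r * n%:R))).
Proof.
move=> tail; split; first exact: exists_rstar.
move=> r rstar; have [r0 _] := rstar.
have alpha0 : 0 < alpha by rewrite (lt_trans _ alpha_gt1).
have cr0 : 0 < c * r by rewrite mulr_gt0.
have eta0 : 0 < eta_star c alpha r.
  by rewrite (eta_starE alpha_gt1 cr0 erefl); exact: integral_psi_gt0.
have p01 := prob01 pE.
split.
  move=> [e [eO pe]].
  have u0 n : 0 <= c * n%:R `^ (- alpha) by rewrite mulr_ge0 ?powR_ge0// ltW.
  have [C [J [C0 J0 pC]]] := bigO_natV_dist u0 eO pe.
  have psum := p_summable alpha_gt1 c_gt0 p01 C0 J0 pC.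
  split; first by move=> y y0; exact: cumulant_gen_funE.
  have h1 := tail_asymp indep pE c_gt0 alpha_gt1 rstar C0 J0 pC.
  exact: h1.
move=> w w0 pw.
(* The exact power law meets the estimate behind part (i) with constant [alpha w] from [j = 1] on,
   so [tail_asymp] serves both parts and only the exponential of [Psi] remains to be made
   explicit. *)
have pC j : (1 <= j)%N -> `|p j - c * j%:R `^ (- alpha)| <=
    alpha * w / j%:R * (c * j%:R `^ (- alpha)).
  by move=> j1; rewrite pw; exact: shifted_power_dist.
have C0 : 0 <= alpha * w by rewrite mulr_ge0// ltW.
have psum := p_summable alpha_gt1 c_gt0 p01 C0 (ltn0Sn 0) pC.
have h1 := tail_asymp indep pE c_gt0 alpha_gt1 rstar C0 (ltn0Sn 0) pC.
apply: asymp_equiv_trans h1 _.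
  near=> n; have n0 : 0 < n%:R :> R by rewrite ltr0n; near: n; exact: nbhs_infty_gt.
  rewrite lt0r_neq0// !mulr_gt0 ?expR_gt0 ?powR_gt0 ?invr_gt0 ?exprn_gt0//.
  by rewrite sqrtr_gt0 !mulr_gt0// pi_gt0.
apply: (power_law_equiv alpha_gt1 c_gt0 r0 w0 p01 psum pw _ eta0).
by move=> y y0; exact: (Psi_cvg pE).
Unshelve. all: by end_near. Qed.
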